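(* Let $n,p$ be integers with $\min(p,n)\ge 3$. Let $X\sim N_p(\theta,\Sigma)$ with unknown mean $\theta\in\mathbb{R}^p$ and unknown positive definite covariance matrix $\Sigma$, and let $S\sim \mathrm{Wishart}_p(n,\Sigma)$ be independent of $X$ (both cases $p\le n$ and $p>n$ are allowed). Let $r:\mathbb{R}\to\mathbb{R}$ be a differentiable function such that: (i) $0\le r\le \dfrac{2(\min(n,p)-2)}{n+p-2\min(n,p)+3}$; (ii) $r$ is nondecreasing; (iii) $r'$ is bounded. Then, under the invariant quadratic loss $L(\theta,\delta)=(\delta-\theta)'\Sigma^{-1}(\delta-\theta)$, the estimator $$\delta_r(X,S)=\left(I-\frac{r(X'S^+X)\,SS^+}{X'S^+X}\right)X$$ dominates the estimator $\delta^0(X,S)=X$.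
   Context: $M'$ denotes the transpose and $M^+$ the Moore--Penrose pseudo-inverse of a matrix $M$; $I$ is the $p\times p$ identity matrix. $S\sim\mathrm{Wishart}_p(n,\Sigma)$ means that $S=Y'Y$ for an $n\times p$ random matrix $Y\sim N_{n\times p}(0,I_n\otimes\Sigma)$, i.e. the rows of $Y$ are i.i.d. $N_p(0,\Sigma)$; no relation between $n$ and $p$ is required, and $S$ is almost surely singular when $p>n$. The estimator $\delta_r$ is defined almost surely (where $X'S^+X\neq 0$). The risk of an estimator $\delta(X,S)$ at $(\theta,\Sigma)$ is $E_{\theta}[(\delta(X,S)-\theta)'\Sigma^{-1}(\delta(X,S)-\theta)]$, the expectation being over $(X,S)$. ''$\delta_r$ dominates $\delta^0$'' means that the risk difference $\Delta_\theta=E_\theta[(\delta_r-\theta)'\Sigma^{-1}(\delta_r-\theta)]-E_\theta[(\delta^0-\theta)'\Sigma^{-1}(\delta^0-\theta)]$ satisfies $\Delta_\theta\le 0$ for every $\theta$ (and every positive definite $\Sigma$). *)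

(* Defs.v *)
(* Vectors of R^p are column vectors 'cV[R]_p. *)
From HB Require Import structures.
From mathcomp Require Import all_boot all_order all_algebra.
From mathcomp Require Import all_classical all_reals all_analysis.

Set Implicit Arguments.
Unset Strict Implicit.
Unset Printing Implicit Defensive.

Import Order.TTheory GRing.Theory Num.Theory.
Import numFieldNormedType.Exports.

Local Open Scope classical_set_scope.
Local Open Scope ring_scope.

(* The product sigma-algebra on matrices: it is generated by the entries, as
   the library does for n.-tuple T. *)
Definition measure_matrix_display : measure_display -> measure_display.
Proof. exact. Qed.

Section measurable_matrix.
Context {d} {T : measurableType d} (m n : nat).

Definition mx_cylinders : set (set 'M[T]_(m, n)) :=
  [set C | exists (i : 'I_m) (j : 'I_n) (B : set T),
     measurable B /\ C = [set M : 'M[T]_(m, n) | B (M i j)]].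

Let mx_set0 : <<s mx_cylinders >> set0.
Proof. exact: sigma_algebra0. Qed.

Let mx_setC A : <<s mx_cylinders >> A -> <<s mx_cylinders >> (~` A).
Proof. exact: sigma_algebraC. Qed.

Let mx_bigcup (F : _^nat) : (forall i, <<s mx_cylinders >> (F i)) ->
  <<s mx_cylinders >> (\bigcup_i F i).
Proof. exact: sigma_algebra_bigcup. Qed.

HB.instance Definition _ := @isMeasurable.Build (measure_matrix_display d)
  'M[T]_(m, n) (<<s mx_cylinders >>) mx_set0 mx_setC mx_bigcup.

End measurable_matrix.

Section linear_algebra.
Context {R : realType}.

Definition qform p (A : 'M[R]_p) (v : 'cV[R]_p) : R := (v^T *m A *m v) 0 0.

Definition posdefmx p (A : 'M[R]_p) : Prop :=
  A^T = A /\ forall v : 'cV[R]_p, v != 0 -> 0 < qform A v.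

Definition penrose m n (M : 'M[R]_(m, n)) (N : 'M[R]_(n, m)) : Prop :=
  [/\ M *m N *m M = M, N *m M *m N = N,
      (M *m N)^T = M *m N & (N *m M)^T = N *m M].

Definition mpinv m n (M : 'M[R]_(m, n)) : 'M[R]_(n, m) :=
  xget 0 [set N | penrose M N].

Lemma penrose_uniq m n (M : 'M[R]_(m, n)) (N1 N2 : 'M[R]_(n, m)) :
  penrose M N1 -> penrose M N2 -> N1 = N2.
Proof.
move=> [a1 b1 c1 d1] [a2 b2 c2 d2].
have e1 : M *m N1 = M *m N2.
  rewrite -c1 -{1}a2 -(mulmxA (M *m N2)) trmx_mul c1 c2.
  by rewrite mulmxA a1.
have e2 : N1 *m M = N2 *m M.
  rewrite -d1 -{1}a2 -(mulmxA M N2 M) mulmxA trmx_mul d1 d2.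
  by rewrite -mulmxA (mulmxA M) a1.
by rewrite -b1 e2 -mulmxA e1 mulmxA b2.
Qed.

Lemma row_free_gram_unit k n (B : 'M[R]_(k, n)) :
  row_free B -> B *m B^T \in unitmx.
Proof.
move=> fB; rewrite -row_free_unit -kermx_eq0; apply/rowV0P => v /sub_kermxP h.
suff vB0 : v *m B = 0 by apply: (row_free_inj fB); rewrite vB0 mul0mx.
have : (v *m B) *m (v *m B)^T = 0.
  by rewrite trmx_mul mulmxA -(mulmxA v) h mul0mx.
move: (v *m B) => w /matrixP/(_ 0 0); rewrite !mxE => /eqP.
under eq_bigr do rewrite mxE -expr2.
rewrite psumr_eq0 => [/allP w0|i _]; last exact: sqr_ge0.
apply/rowP => j; have := w0 j (mem_index_enum _).
by rewrite sqrf_eq0 => /eqP ->; rewrite mxE.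
Qed.

Lemma penrose_full_rank_factorization m k n (C : 'M[R]_(m, k))
    (B : 'M[R]_(k, n)) : row_free C^T -> row_free B ->
  penrose (C *m B)
    (B^T *m invmx (B *m B^T) *m invmx (C^T *m C) *m C^T).
Proof.
move=> /row_free_gram_unit; rewrite trmxK => uC /row_free_gram_unit uB.
set P := invmx (B *m B^T); set Q := invmx (C^T *m C).
have BP : B *m (B^T *m P) = 1%:M by rewrite mulmxA mulmxV.
have QC : Q *m (C^T *m C) = 1%:M by rewrite mulVmx.
have sP : P^T = P by rewrite /P trmx_inv trmx_mul trmxK.
have sQ : Q^T = Q by rewrite /Q trmx_inv trmx_mul trmxK.
have MN : C *m B *m (B^T *m P *m Q *m C^T) = C *m Q *m C^T.
  by rewrite -!mulmxA (mulmxA B^T P) (mulmxA B) BP mul1mx.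
have NM : (B^T *m P *m Q *m C^T) *m (C *m B) = B^T *m P *m B.
  by rewrite -!mulmxA (mulmxA C^T) (mulmxA Q) QC mul1mx.
split; rewrite ?MN ?NM.
- by rewrite -!mulmxA (mulmxA C^T) (mulmxA Q) QC mul1mx.
- by rewrite -!mulmxA !(mulmxA B^T P) (mulmxA B) BP mul1mx.
- by rewrite !trmx_mul trmxK sQ mulmxA.
- by rewrite !trmx_mul trmxK sP mulmxA.
Qed.

Lemma mpinvP m n (M : 'M[R]_(m, n)) : penrose M (mpinv M).
Proof.
suff [N hN] : exists N, penrose M N by exact: (xgetI 0 hN).
rewrite -{1}(mulmx_base M); eexists; apply: penrose_full_rank_factorization.
  by rewrite /row_free mxrank_tr; exact: col_base_full.
exact: row_base_free.
Qed.

End linear_algebra.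

Section probability_notions.
Context {R : realType} {d} {T : measurableType d} (P : probability T R).

Definition independent_pair d1 d2 (T1 : measurableType d1)
    (T2 : measurableType d2) (X : T -> T1) (Y : T -> T2) : Prop :=
  forall A B, measurable A -> measurable B ->
    P (X @^-1` A `&` Y @^-1` B) = (P (X @^-1` A) * P (Y @^-1` B))%E.

Definition mutually_independent (I : finType) d' (T' : measurableType d')
    (Z : I -> T -> T') : Prop :=
  forall (J : {set I}) (A : I -> set T'), (forall i, measurable (A i)) ->
    P (\bigcap_(i in [set` J]) (Z i @^-1` A i)) =
    (\prod_(i in J) P (Z i @^-1` A i))%E.

Definition std_normal_vector p (Z : T -> 'cV[R]_p) : Prop :=
  [/\ measurable_fun setT Z,
      forall (i : 'I_p) (B : set R), measurable B ->
        P [set t | B (Z t i 0)] = normal_prob 0 1 B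
    & mutually_independent (fun i t => Z t i 0)].

(* X ~ N_p(theta, Sigma). For nonsingular Sigma = A A', the vector Z is
   A^-1 (X - theta), so asking for Z on the sample space of X constrains only
   the law of X. *)
Definition normal_vector p (theta : 'cV[R]_p) (Sigma : 'M[R]_p)
    (X : T -> 'cV[R]_p) : Prop :=
  exists (A : 'M[R]_p) (Z : T -> 'cV[R]_p),
    [/\ A *m A^T = Sigma, std_normal_vector Z
      & forall t, X t = theta + A *m Z t].

(* Y ~ N_{n x p}(0, I_n (x) Sigma) *)
Definition normal_matrix n p (Sigma : 'M[R]_p) (Y : T -> 'M[R]_(n, p)) : Prop :=
  (forall i, normal_vector 0 Sigma (fun t => (row i (Y t))^T)) /\
  mutually_independent (fun i t => row i (Y t)).

End probability_notions.

(* The Wishart law is a condition on the distribution of S: the sample space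
   (T', P') carrying the Gaussian matrix Y need not be that of S. *)
Definition wishart (R : realType) d (T : measurableType d)
    (P : probability T R) p (n : nat) (Sigma : 'M[R]_p)
    (S : T -> 'M[R]_p) : Prop :=
  exists (d' : measure_display) (T' : measurableType d')
      (P' : probability T' R) (Y : T' -> 'M[R]_(n, p)),
    normal_matrix P' Sigma Y /\
    forall B : set 'M[R]_p, measurable B ->
      P (S @^-1` B) = P' [set t | B ((Y t)^T *m Y t)].

Section estimation.
Context {R : realType} {p : nat}.

Definition estimator := 'cV[R]_p -> 'M[R]_p -> 'cV[R]_p.

Definition inv_loss (Sigma : 'M[R]_p) (theta a : 'cV[R]_p) : R :=
  qform (invmx Sigma) (a - theta).

Definition risk d (T : measurableType d) (P : probability T R)
    (X : T -> 'cV[R]_p) (S : T -> 'M[R]_p)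
    (theta : 'cV[R]_p) (Sigma : 'M[R]_p) (delta : estimator) : \bar R :=
  'E_P[fun t => inv_loss Sigma theta (delta (X t) (S t))].

(* Risks are integrals of nonnegative functions with values in [0, +oo]. The
   risk of delta_0 is p, so the difference below is not of the form oo - oo. *)
Definition dominates (n : nat) (delta delta' : estimator) : Prop :=
  forall (theta : 'cV[R]_p) (Sigma : 'M[R]_p), posdefmx Sigma ->
  forall (d : measure_display) (T : measurableType d) (P : probability T R)
    (X : {RV P >-> 'cV[R]_p}) (S : {RV P >-> 'M[R]_p}),
  normal_vector P theta Sigma X -> wishart P n Sigma S ->
  independent_pair P X S ->
  (risk P X S theta Sigma delta - risk P X S theta Sigma delta' <= 0)%E.

Definition delta_0 : estimator := fun X _ => X.

(* Division by zero yields zero, so delta_r X S = X on the null event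
   X' S^+ X = 0. *)
Definition delta_r (r : R -> R) : estimator := fun X S =>
  let F := qform (mpinv S) X in
  (1%:M - (r F / F) *: (S *m mpinv S)) *m X.

End estimation.

(* Main.v *)
Require Import Defs.
From HB Require Import structures.
From mathcomp Require Import all_boot all_order all_algebra.
From mathcomp Require Import all_classical all_reals all_analysis.
From mathcomp Require Import measurable_realfun ring lra.
Set Implicit Arguments.
Unset Strict Implicit.
Unset Printing Implicit Defensive.
Import Order.TTheory GRing.Theory Num.Theory.
Import numFieldNormedType.Exports.
Local Open Scope classical_set_scope.
Local Open Scope ring_scope.

(** Let [m = min(n, p)], let [S = Y^T Y] with [Y] a normal [n x p] matrix, and
    let [Si] be the inverse of [Sigma].  Expanding the loss of [X - D], where [D]
    is the correction subtracted from [X], gives the loss of [X], a cross term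
    [(X - theta)^T Si D] and a quadratic term [D^T Si D].  Gaussian integration
    by parts, in [X] for the cross term and in the rows of [Y] for the quadratic
    term, turns both expectations into expectations of divergences, in which
    neither [theta] nor [Sigma] occurs any more; in the limit described below,
    what remains is a function of [X^T S^+ X] alone, which the bound on [r] makes
    nonpositive.

    The pseudo-inverse is not differentiable where the rank of [Y] drops, and
    [r(F) / F] may be singular at [F = 0], so integration by parts is carried out
    for a regularised estimator.  For [d > 0] put [K = (Y Y^T + d I)^-1]
    ([resolvent]), [u = K Y x] ([coefs]), [w = Y^T u] ([fit]), [F = u^T u]
    ([energy]), [tau = tr(K Y Y^T)] ([edf]) and [kappa = d u^T K u]
    ([energy_defect]).  Since [w] is the sum of the [u_a y_a] over the rows
    [y_a] of [Y], the quadratic term of [D = h(F) w] is the sum over [a] of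
    [y_a Si (u_a h(F)^2 w)], to which the integration by parts in row [a]
    ([stein_row]) applies.  With [stein_normal] for the cross term and the
    divergences [mean_jacobian_trace] and [row_jacobian_trace_sum], the risk of
    [X - h(F) w] exceeds that of [X] by the expectation of

      [- 2 h tau - 4 h' (F - kappa)
       + h^2 (F (n + p - 1 - 2 tau) + 2 kappa) + 4 h h' F (2 kappa - F)]

    ([ridge_loss_mean]).  This function is bounded uniformly in [d].  As [d]
    tends to [0], [tau] tends to the rank of [Y], which is almost surely [m]
    ([normal_matrix_full_rank]), [kappa] tends to [0], [F] to [x^T S^+ x] and [w]
    to [S S^+ x].  Dominated convergence on the right and Fatou's lemma on the
    left give [pinv_loss_le]: the risk of [X - h(F) S S^+ X] is at most that of
    [X] as soon as

      [- 2 m h - 4 h' F + h^2 F (n + p - 1 - 2 m) - 4 h h' F^2 <= 0].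

    For [h(s) = rho(s) / (s + e)], with [rho] nondecreasing and
    [0 <= rho <= 2 (m - 2) / (n + p - 2 m + 3)], this inequality is elementary
    ([shrinker_sign]): the terms in [rho'] are nonpositive and the others are, in
    the limit case [e = 0], [rho / F] times [rho (n + p - 2 m + 3) - 2 (m - 2)].
    For [rho] one takes the mean of [r] over [[s, s + e]], which is continuously
    differentiable; a second use of Fatou's lemma as [e] tends to [0] reaches
    [h(s) = r(s) / s]. *)

(** * Entrywise limits, derivatives and bounds of matrices *)

Section mx_cvg.
Context {R : realType} {T : Type} (F : set_system T) {FF : Filter F}.

Definition mx_cvg m n (f : T -> 'M[R]_(m, n)) (A : 'M[R]_(m, n)) :=
  forall i j, f x i j @[x --> F] --> A i j.

Lemma cvg_finsum (I : finType) (f : I -> T -> R) (a : I -> R) :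
  (forall i, f i x @[x --> F] --> a i) ->
  \sum_i f i x @[x --> F] --> \sum_i a i.
Proof. by move=> fa; apply: cvg_big => //; exact: add_continuous. Qed.

Lemma mx_cvg_cst m n (A : 'M[R]_(m, n)) : mx_cvg (fun=> A) A.
Proof. by move=> i j; exact: cvg_cst. Qed.

Lemma mx_cvgD m n (f g : T -> 'M[R]_(m, n)) A B :
  mx_cvg f A -> mx_cvg g B -> mx_cvg (fun x => f x + g x) (A + B).
Proof.
move=> fA gB i j; rewrite mxE; under eq_fun do rewrite mxE.
by apply: cvgD; [exact: fA|exact: gB].
Qed.

Lemma mx_cvgB m n (f g : T -> 'M[R]_(m, n)) A B :
  mx_cvg f A -> mx_cvg g B -> mx_cvg (fun x => f x - g x) (A - B).
Proof.
move=> fA gB i j; rewrite !mxE; under eq_fun do rewrite !mxE.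
by apply: cvgB; [exact: fA|exact: gB].
Qed.

Lemma mx_cvgZ m n (a : T -> R) (b : R) (f : T -> 'M[R]_(m, n)) A :
  a x @[x --> F] --> b -> mx_cvg f A -> mx_cvg (fun x => a x *: f x) (b *: A).
Proof.
move=> ab fA i j; rewrite mxE; under eq_fun do rewrite mxE.
by apply: cvgM => //; exact: fA.
Qed.

Lemma mx_cvg_tr m n (f : T -> 'M[R]_(m, n)) A :
  mx_cvg f A -> mx_cvg (fun x => (f x)^T) A^T.
Proof. by move=> fA i j; rewrite mxE; under eq_fun do rewrite mxE; exact: fA. Qed.

Lemma mx_cvgM m n p (f : T -> 'M[R]_(m, n)) (g : T -> 'M[R]_(n, p)) A B :
  mx_cvg f A -> mx_cvg g B -> mx_cvg (fun x => f x *m g x) (A *m B).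
Proof.
move=> fA gB i j; rewrite mxE; under eq_fun do rewrite mxE.
by apply: cvg_finsum => k; apply: cvgM; [exact: fA|exact: gB].
Qed.

Lemma cvg_mxtrace n (f : T -> 'M[R]_n) A :
  mx_cvg f A -> \tr (f x) @[x --> F] --> \tr A.
Proof. by move=> fA; apply: cvg_finsum => i; exact: fA. Qed.

End mx_cvg.

Section mx_derive.
Context {R : realType}.

Definition mx_is_derive m n (t : R) (f : R -> 'M[R]_(m, n)) (df : 'M[R]_(m, n)) :=
  forall i j, is_derive t 1 (fun s => f s i j) (df i j).

Lemma is_derive_finsum (I : finType) (t : R) (f : I -> R -> R) (df : I -> R) :
  (forall i, is_derive t 1 (f i) (df i)) ->
  is_derive t 1 (fun s => \sum_i f i s) (\sum_i df i).
Proof.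
move=> h; rewrite (_ : (fun s => _) = \sum_i f i); last first.
  by apply/funext => s; rewrite fct_sumE.
by elim/big_ind2 : _ => // [|] *; [exact: is_derive_cst|exact: is_deriveD].
Qed.

Lemma mx_is_derive_cst m n t (A : 'M[R]_(m, n)) : mx_is_derive t (fun=> A) 0.
Proof. by move=> i j; rewrite mxE; exact: is_derive_cst. Qed.

Lemma mx_is_deriveM m n p t (f : R -> 'M[R]_(m, n)) (g : R -> 'M[R]_(n, p)) df dg :
  mx_is_derive t f df -> mx_is_derive t g dg ->
  mx_is_derive t (fun s => f s *m g s) (df *m g t + f t *m dg).
Proof.
move=> hf hg i j; rewrite !mxE -big_split/=.
under eq_fun do rewrite mxE.
apply: is_derive_finsum => k.
have h1 := hf i k; have h2 := hg k j.
by apply: is_derive_eq; rewrite /GRing.scale/=; ring.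
Qed.

Lemma mx_is_deriveZ m n (t : R) (a : R -> R) (da : R) (f : R -> 'M[R]_(m, n)) df :
  is_derive t 1 a da -> mx_is_derive t f df ->
  mx_is_derive t (fun s => a s *: f s) (da *: f t + a t *: df).
Proof.
move=> ha hf i j; rewrite !mxE.
under eq_fun do rewrite mxE.
have h2 := hf i j.
by apply: is_derive_eq; rewrite /GRing.scale/=; ring.
Qed.

Lemma mx_is_derive_tr m n t (f : R -> 'M[R]_(m, n)) df :
  mx_is_derive t f df -> mx_is_derive t (fun s => (f s)^T) df^T.
Proof. by move=> hf i j; rewrite mxE; under eq_fun do rewrite mxE; exact: hf. Qed.

Lemma mx_is_derive_line m n t (A B : 'M[R]_(m, n)) :
  mx_is_derive t (fun s => A + s *: B) B.
Proof.
move=> i j; under eq_fun do rewrite !mxE.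
by apply: is_derive_eq; rewrite /GRing.scale/=; ring.
Qed.

Lemma mx_is_derive_cvg m n t (f : R -> 'M[R]_(m, n)) df :
  mx_is_derive t f df -> mx_cvg (nbhs t) f (f t).
Proof.
move=> hf i j; apply: differentiable_continuous; apply/derivable1_diffP.
exact: ex_derive.
Qed.

End mx_derive.

Section mx_bound.
Context {R : realType}.

Lemma normr_mulmx_le m n p (A : 'M[R]_(m, n)) (B : 'M[R]_(n, p)) (a b : R) i j :
  (forall i k, `|A i k| <= a) -> (forall k j, `|B k j| <= b) ->
  `|(A *m B) i j| <= n%:R * (a * b).
Proof.
move=> Aa Bb; rewrite mxE (le_trans (ler_norm_sum _ _ _))//.
rewrite (le_trans (y := \sum_(k < n) a * b))//.
  by apply: ler_sum => k _; rewrite normrM ler_pM.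
by rewrite sumr_const card_ord mulr_natl.
Qed.

Lemma normr_mx_bounded m n (A : 'M[R]_(m, n)) :
  exists a : R, forall i j, `|A i j| <= a.
Proof.
exists (\sum_i \sum_j `|A i j|) => i j.
by rewrite (bigD1 i)//= (bigD1 j)//= -addrA lerDl addr_ge0// ?sumr_ge0// => *; rewrite ?sumr_ge0.
Qed.

End mx_bound.

Section bounded_family.
Context {R : realType} {T : Type}.

Definition bounded_family m n (f : T -> 'M[R]_(m, n)) :=
  exists C : R, forall t i j, `|f t i j| <= C.

Lemma bounded_family_cst m n (A : 'M[R]_(m, n)) : bounded_family (fun=> A).
Proof. by have [a Aa] := normr_mx_bounded A; exists a. Qed.

Lemma bounded_familyD m n (f g : T -> 'M[R]_(m, n)) :
  bounded_family f -> bounded_family g -> bounded_family (fun t => f t + g t).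
Proof.
move=> [a fa] [b gb]; exists (a + b) => t i j.
by rewrite mxE (le_trans (ler_normD _ _))// lerD.
Qed.

Lemma bounded_familyZ m n (a : T -> R) (f : T -> 'M[R]_(m, n)) (c : R) :
  (forall t, `|a t| <= c) -> bounded_family f -> bounded_family (fun t => a t *: f t).
Proof.
move=> ac [b fb]; exists (c * b) => t i j.
by rewrite mxE normrM ler_pM.
Qed.

Lemma bounded_familyM m n p (f : T -> 'M[R]_(m, n)) (g : T -> 'M[R]_(n, p)) :
  bounded_family f -> bounded_family g -> bounded_family (fun t => f t *m g t).
Proof.
by move=> [a fa] [b gb]; exists (n%:R * (a * b)) => t i j; exact: normr_mulmx_le.
Qed.

Lemma bounded_family_tr m n (f : T -> 'M[R]_(m, n)) :
  bounded_family f -> bounded_family (fun t => (f t)^T).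
Proof. by move=> [a fa]; exists a => t i j; rewrite mxE. Qed.

End bounded_family.

Section cvg0.
Context {R : realType} {T : Type} (F : set_system T) {FF : Filter F}.

Lemma cvg0_bounded_mul (f g : T -> R) (a : R) :
  (forall x, `|f x| <= a) -> g x @[x --> F] --> (0 : R) ->
  f x * g x @[x --> F] --> (0 : R).
Proof.
move=> fa g0; apply/norm_cvg0P.
have ag : a * `|g x| @[x --> F] --> (0 : R).
  rewrite -(mulr0 a); apply: cvgM; first exact: cvg_cst.
  exact/norm_cvg0P.
apply: (squeeze_cvgr (f := cst 0) (h := fun x => a * `|g x|)) => //.
  by apply: nearW => x; rewrite normr_ge0 normrM ler_wpM2r.
exact: cvg_cst.
Qed.

(** The way limits are obtained here: a family bounded uniformly in the parameter
    times an explicit vanishing error. *)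
Lemma mx_cvg0_bounded m n p (f : T -> 'M[R]_(m, n)) (g : T -> 'M[R]_(n, p)) :
  bounded_family f -> mx_cvg F g 0 -> mx_cvg F (fun x => f x *m g x) 0.
Proof.
move=> [a fa] g0 i j; rewrite mxE; under eq_fun do rewrite mxE.
have := @cvg_finsum _ _ F _ 'I_n (fun k x => f x i k * g x k j) (fun=> 0).
rewrite big1//; apply => k; apply: (cvg0_bounded_mul (a := a)) => //.
by have := g0 k j; rewrite mxE.
Qed.

End cvg0.

(** * Measurability of matrix operations *)

Section measurable_mx.
Context d (T : measurableType d).

Lemma measurable_entry d' (S : measurableType d') m n (i : 'I_m) (j : 'I_n) :
  measurable_fun setT (fun M : 'M[S]_(m, n) => M i j).
Proof.
move=> _ B mB; rewrite setTI; apply: sub_sigma_algebra.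
by exists i, j, B.
Qed.

Lemma measurable_to_mx d' (S : measurableType d') m n (f : T -> 'M[S]_(m, n)) :
  (forall i j, measurable_fun setT (fun t => f t i j)) -> measurable_fun setT f.
Proof.
move=> mf; apply: (@measurability _ _ _ _ setT f (@mx_cylinders _ S m n)) => //.
move=> _ [_ [i [j [B [mB ->]]]] <-].
by have := mf i j measurableT B mB; congr measurable.
Qed.

Lemma measurable_mx_entry d' (S : measurableType d') m n
    (f : T -> 'M[S]_(m, n)) i j :
  measurable_fun setT f -> measurable_fun setT (fun t => f t i j).
Proof. by move=> mf; apply: (measurableT_comp (measurable_entry i j) mf). Qed.

Context {R : realType}.

Lemma measurable_mulmx m n p (f : T -> 'M[R]_(m, n)) (g : T -> 'M[R]_(n, p)) :
  measurable_fun setT f -> measurable_fun setT g ->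
  measurable_fun setT (fun t => f t *m g t).
Proof.
move=> mf mg; apply: measurable_to_mx => i j.
under eq_fun do rewrite mxE.
by apply: measurable_sum => k; apply: measurable_funM; exact: measurable_mx_entry.
Qed.

Lemma measurable_trmx m n (f : T -> 'M[R]_(m, n)) :
  measurable_fun setT f -> measurable_fun setT (fun t => (f t)^T).
Proof.
move=> mf; apply: measurable_to_mx => i j.
by under eq_fun do rewrite mxE; exact: measurable_mx_entry.
Qed.

Lemma measurable_addmx m n (f g : T -> 'M[R]_(m, n)) :
  measurable_fun setT f -> measurable_fun setT g ->
  measurable_fun setT (fun t => f t + g t).
Proof.
move=> mf mg; apply: measurable_to_mx => i j.
under eq_fun do rewrite mxE.
by apply: measurable_funD; exact: measurable_mx_entry.
Qed.

Lemma measurable_scalemx m n (a : T -> R) (f : T -> 'M[R]_(m, n)) :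
  measurable_fun setT a -> measurable_fun setT f ->
  measurable_fun setT (fun t => a t *: f t).
Proof.
move=> ma mf; apply: measurable_to_mx => i j.
under eq_fun do rewrite mxE.
by apply: measurable_funM => //; exact: measurable_mx_entry.
Qed.

Lemma measurable_det n (f : T -> 'M[R]_n) :
  measurable_fun setT f -> measurable_fun setT (fun t => \det (f t)).
Proof.
move=> mf; rewrite /determinant.
apply: measurable_sum => s; apply: measurable_funM => //.
by apply: measurable_prod => i _; exact: measurable_mx_entry.
Qed.

Lemma measurable_inv (f : T -> R) :
  measurable_fun setT f -> measurable_fun setT (fun t => (f t)^-1).
Proof.
move=> mf.
(* powers of nonnegative reals are measurable; both sides are 0 where f is 0 *)
rewrite (_ : (fun t => (f t)^-1) = (fun t => f t * (f t ^+ 2) `^ (-1))); last first.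
  apply/funext => t; rewrite powR_inv1 ?sqr_ge0//.
  have [->|f0] := eqVneq (f t) 0; first by rewrite invr0 mul0r.
  by rewrite expr2 invfM mulrA mulfV// mul1r.
apply: measurable_funM => //; apply: (measurableT_comp (measurable_powR (-1))).
exact: measurable_funX.
Qed.

(** By Cramer's rule. *)
Lemma measurable_invmx n (f : T -> 'M[R]_n) :
  (forall t, f t \in unitmx) -> measurable_fun setT f ->
  measurable_fun setT (fun t => invmx (f t)).
Proof.
move=> uf mf; apply: measurable_to_mx => i j.
have -> : (fun t => invmx (f t) i j) =
    (fun t => (\det (f t))^-1 * ((-1) ^+ (j + i) * \det (row' j (col' i (f t))))).
  by apply/funext => t; rewrite /invmx uf !mxE.
apply: measurable_funM; first exact/measurable_inv/measurable_det.
apply: measurable_funM => //; apply: measurable_det; apply: measurable_to_mx => k l.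
by under eq_fun do rewrite !mxE; exact: measurable_mx_entry.
Qed.

End measurable_mx.

(** * Independent pairs and independent rows *)

Section independence.
Context {R : realType}.

Section pair.
Context d (T : measurableType d) (P : probability T R).
Context d1 d2 (T1 : measurableType d1) (T2 : measurableType d2).
Variables (U : {RV P >-> T1}) (V : {RV P >-> T2}).

Definition pairRV : T -> T1 * T2 := fun t => (U t, V t).

Lemma measurable_pairRV : measurable_fun setT pairRV.
Proof. exact: measurable_fun_pair. Qed.

HB.instance Definition _ := isMeasurableFun.Build _ _ _ _ pairRV measurable_pairRV.

(** Independence is the rectangle condition, and rectangles determine the product
    measure. *)
Lemma distribution_pair : independent_pair P U V ->
  forall A, measurable A ->
  distribution P pairRV A = (distribution P U \x distribution P V)%E A.
Proof.
move=> ind A mA; apply/esym.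
by apply: (@product_measure_unique _ _ _ _ _ (distribution P U)
  (distribution P V) (distribution P pairRV)).
Qed.

Lemma ge0_integral_pair (f : T1 * T2 -> \bar R) : independent_pair P U V ->
  measurable_fun setT f -> (forall x, 0 <= f x)%E ->
  (\int[P]_t f (U t, V t) =
   \int[distribution P U \x distribution P V]_z f z)%E.
Proof.
move=> ind mf f0.
rewrite [RHS](eq_measure_integral (distribution P pairRV)); last first.
  by move=> A mA _; exact/esym/distribution_pair.
by rewrite ge0_integral_distribution.
Qed.

Lemma integrable_pair (f : T1 * T2 -> \bar R) : independent_pair P U V ->
  measurable_fun setT f -> P.-integrable setT (fun t => f (U t, V t)) ->
  (distribution P U \x distribution P V)%E.-integrable setT f.
Proof.
move=> ind mf /integrableP[_ fi]; apply/integrableP; split => //.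
rewrite -(ge0_integral_pair (f := abse \o f))//.
  exact: measurableT_comp.
by move=> x; exact: abse_ge0.
Qed.

Lemma integral_pair (f : T1 * T2 -> \bar R) : independent_pair P U V ->
  measurable_fun setT f -> P.-integrable setT (fun t => f (U t, V t)) ->
  (\int[P]_t f (U t, V t) =
   \int[distribution P U \x distribution P V]_z f z)%E.
Proof.
move=> ind mf fi.
rewrite [RHS](eq_measure_integral (distribution P pairRV)); last first.
  by move=> A mA _; exact/esym/distribution_pair.
by rewrite integral_pushforward.
Qed.

End pair.

End independence.

Section rows.
Context {R : realType} d (T : measurableType d) (P : probability T R) (n p : nat).

(** The deleted row is replaced by 0, so that a matrix is the sum of its [i]-th
    row put back in place and of the rest. *)
Definition del_row (i : 'I_n) (M : 'M[R]_(n, p)) : 'M[R]_(n, p) :=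
  \matrix_(k, l) if k == i then 0 else M k l.

Definition put_row (i : 'I_n) (v : 'rV[R]_p) : 'M[R]_(n, p) :=
  \matrix_(k, l) if k == i then v 0 l else 0.

Lemma del_put_row i M : del_row i M + put_row i (row i M) = M.
Proof.
apply/matrixP => k l; rewrite !mxE.
by case: eqP => [->|_]; rewrite ?add0r ?addr0.
Qed.

Lemma measurable_del_row i : measurable_fun setT (del_row i).
Proof.
apply: measurable_to_mx => k l.
under eq_fun do rewrite mxE.
by case: (k == i); [exact: measurable_cst|exact: measurable_entry].
Qed.

Lemma measurable_row m q (k : 'I_m) :
  measurable_fun setT (fun M : 'M[R]_(m, q) => row k M).
Proof.
apply: measurable_to_mx => i j; under eq_fun do rewrite mxE.
exact: measurable_entry.
Qed.

(** A pi-system generating the sigma-algebra of matrices; on it the independence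
    of the rows is a finite product formula. *)
Definition row_boxes : set (set 'M[R]_(n, p)) :=
  [set C | exists B : 'I_n -> set 'rV[R]_p,
     (forall k, measurable (B k)) /\ C = [set M | forall k, B k (row k M)]].

Lemma row_boxes_measurable C : row_boxes C -> measurable C.
Proof.
move=> [B [mB ->]].
rewrite (_ : [set _ | _] = \bigcap_(k in [set` 'I_n]) (row k @^-1` B k)); last first.
  by apply/seteqP; split => [M h k _|M h k]; exact: h.
apply: fin_bigcap_measurable => // k _.
by rewrite -[X in measurable X]setTI; exact: measurable_row.
Qed.

Lemma row_boxes_generate : measurable = <<s row_boxes >>.
Proof.
apply/seteqP; split; last first.
  by apply: smallest_sub; [exact: sigma_algebra_measurable|exact: row_boxes_measurable].
apply: smallest_sub; first exact: smallest_sigma_algebra.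
move=> _ [i [j [B [mB ->]]]]; apply: sub_sigma_algebra.
exists (fun k => if k == i then [set v : 'rV[R]_p | B (v 0 j)] else setT); split.
  move=> k; case: (k == i) => //.
  by rewrite -[X in measurable X]setTI; exact: measurable_entry.
apply/seteqP; split => [M /= BM k|M /=].
  by case: eqP => // ->; rewrite /= mxE.
by move=> /(_ i); rewrite eqxx /= mxE.
Qed.

Lemma row_boxes_setI : setI_closed row_boxes.
Proof.
move=> _ _ [B [mB ->]] [C [mC ->]].
exists (fun k => B k `&` C k); split; first by move=> k; exact: measurableI.
by apply/seteqP; split => [M [h1 h2] k|M h]; split => // k; have [] := h k.
Qed.

Variable Y : {RV P >-> 'M[R]_(n, p)}.

Lemma mutual_independence_all (A : 'I_n -> set 'rV[R]_p) :
  mutually_independent P (fun i t => row i (Y t)) ->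
  (forall i, measurable (A i)) ->
  P [set t | forall i, A i (row i (Y t))] =
  (\prod_i P [set t | A i (row i (Y t))])%E.
Proof.
move=> ind mA; have := ind finset.setT A mA.
rewrite (_ : \bigcap_(_ in _) _ = [set t | forall i, A i (row i (Y t))]); last first.
  by apply/seteqP; split => [t h i|t h i _]; [apply: h; rewrite /= finset.in_setT|exact: h].
by move=> ->; apply: eq_bigl => i; rewrite finset.in_setT.
Qed.

(** For a fixed event on row [i], the two finite measures
    [C |-> P (row_i in A, rest in C)] and [C |-> P (row_i in A) P (rest in C)]
    agree on boxes of rows, hence everywhere. *)
Lemma independent_row_del_row i :
  mutually_independent P (fun i t => row i (Y t)) ->
  independent_pair P (fun t => row i (Y t)) (fun t => del_row i (Y t)).
Proof.
move=> ind A B mA mB.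
have mrow k C : measurable C -> measurable [set t | C (row k (Y t))].
  move=> mC; rewrite -[X in measurable X]setTI.
  exact: (measurableT_comp (measurable_row k) (measurable_funPT Y)).
have mdel : measurable_fun setT (fun t => del_row i (Y t)).
  exact: (measurableT_comp (measurable_del_row i) (measurable_funPT Y)).
pose U := (fun t => row i (Y t)) @^-1` A.
have mU : measurable U := mrow i A mA.
pose m1_ : {measure set 'M[R]_(n, p) -> \bar R} := pushforward (mrestr P mU) (fun t => del_row i (Y t)).
pose m1 := m1_ mdel.
have PUfin : P U \is a fin_num by exact: fin_num_measure.
have PU0 : 0 <= fine (P U) by exact/fine_ge0/measure_ge0.
pose m2_ : {measure set 'M[R]_(n, p) -> \bar R} :=
  mscale (NngNum PU0) (pushforward P (fun t => del_row i (Y t))).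
pose m2 := m2_ mdel.
have key C : row_boxes C -> m1 C = m2 C.
  move=> [D [mD ->]].
  rewrite /m1 /m2 /= /mscale /= /pushforward /mrestr fineK//.
  pose A0 k := if k == i then A else D k.
  pose A1 k := if k == i then setT else D k.
  have mA0 k : measurable (A0 k) by rewrite /A0; case: (k == i).
  have mA1 k : measurable (A1 k) by rewrite /A1; case: (k == i).
  have rowE k t : row k (del_row i (Y t)) = if k == i then 0 else row k (Y t).
    by apply/rowP => l; rewrite !mxE; case: (k == i); rewrite mxE.
  (* row [i] of the rest is constantly 0: the box is empty or does not
     constrain that row *)
  have [D0|D0] := pselect (D i 0); last first.
    rewrite (_ : _ @^-1` _ = set0) ?set0I ?measure0 ?mule0//.
    by rewrite -subset0 => t /= /(_ i); rewrite rowE eqxx.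
  have -> : (fun t => del_row i (Y t)) @^-1` [set M | forall k, D k (row k M)] =
      [set t | forall k, A1 k (row k (Y t))].
    apply/seteqP; split => [t /= h k|t /= h k].
      by have := h k; rewrite rowE /A1; case: eqP.
    by have := h k; rewrite rowE /A1; case: eqP => // ->.
  have -> : [set t | forall k, A1 k (row k (Y t))] `&` U =
      [set t | forall k, A0 k (row k (Y t))].
    apply/seteqP; split => [t /= [h hU] k|t /= h].
      by have := h k; rewrite /A0 /A1; case: eqP => // ->.
    split; last by have := h i; rewrite /A0 eqxx.
    by move=> k; have := h k; rewrite /A0 /A1; case: eqP.
  rewrite !mutual_independence_all// (bigD1 i)//= [in RHS](bigD1 i)//=.
  rewrite [X in (P X * _)%E](_ : _ = U); last first.
    by apply/seteqP; split => t /=; rewrite /A0 eqxx.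
  congr (_ * _)%E; rewrite [X in (P X * _)%E](_ : _ = setT); last first.
    by apply/seteqP; split => t //=; rewrite /A1 eqxx.
  rewrite probability_setT mul1e.
  by apply: eq_bigr => k /negbTE ki; rewrite /A0 /A1 ki.
have mE : m1 B = m2 B.
  apply: (measure_unique row_boxes (fun=> setT)) => //.
  - exact: row_boxes_generate.
  - exact: row_boxes_setI.
  - move=> _; exists (fun=> setT); split => //.
    by apply/seteqP; split.
  - by rewrite bigcup_const.
  - move=> _; rewrite /m1 /= /pushforward /mrestr preimage_setT setTI.
    by rewrite ltey_eq fin_num_measure.
move: mE; rewrite /m1 /m2 /= /mscale /= /pushforward /mrestr fineK// => <-.
by rewrite setIC.
Qed.

End rows.

(** * Integration against a density *)

Import HBNNSimple.

Section density.
Local Open Scope ereal_scope.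
Context d (T : measurableType d) (R : realType).
Variables (mu nu : {measure set T -> \bar R}) (g : T -> R).
Hypotheses (mg : measurable_fun setT g) (g0 : forall x, (0 <= g x)%R).
Hypothesis nuE : forall A, measurable A -> nu A = \int[mu]_(x in A) (g x)%:E.

Lemma integral_density_nnsfun (h : {nnsfun T >-> R}) :
  \int[nu]_x (h x)%:E = \int[mu]_x ((h x)%:E * (g x)%:E).
Proof.
have meg : measurable_fun setT (EFin \o g) by exact/measurable_EFinP.
have E (x : T) : (h x)%:E = \sum_(y \in range h) (y * \1_(h @^-1` [set y]) x)%:E.
  by rewrite fsumEFin//= -fimfunE.
have mi r : measurable_fun setT (fun x => (r * \1_(h @^-1` [set r]) x)%:E).
  exact/measurable_EFinP/measurableT_comp.
transitivity (\sum_(y \in range h) \int[nu]_x (y * \1_(h @^-1` [set y]) x)%:E).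
  under eq_integral do rewrite E.
  by rewrite ge0_integral_fsum// => r x _; exact: nnfun_muleindic_ge0.
transitivity (\sum_(y \in range h)
    \int[mu]_x ((y * \1_(h @^-1` [set y]) x)%:E * (g x)%:E)); last first.
  rewrite -ge0_integral_fsum//.
  - apply: eq_integral => x _; rewrite E ge0_mule_fsuml// => r.
    exact: nnfun_muleindic_ge0.
  - by move=> r; exact: emeasurable_funM.
  - by move=> r x _; apply: mule_ge0; rewrite ?lee_fin ?g0//; exact: nnfun_muleindic_ge0.
apply: eq_fsbigr => r; rewrite inE => -[t _ <-].
rewrite integralZl_indic_nnsfun// integral_indic// setIT.
under eq_integral do rewrite EFinM -muleA.
rewrite ge0_integralZl//.
- rewrite nuE//; congr (_ * _); rewrite integral_mkcond.
  by apply: eq_integral => x _; rewrite epatch_indic muleC.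
- by apply: emeasurable_funM => //; exact/measurable_EFinP.
- by move=> x _; rewrite mule_ge0// lee_fin.
- by rewrite lee_fin.
Qed.

(** Both sides are limits along the same increasing simple functions. *)
Lemma ge0_integral_density (f : T -> \bar R) :
  measurable_fun setT f -> (forall x, 0 <= f x) ->
  \int[nu]_x f x = \int[mu]_x (f x * (g x)%:E).
Proof.
move=> mf f0; pose h := nnsfun_approx measurableT mf.
have hf x : (h n x)%:E @[n --> \oo] --> f x by exact: cvg_nnsfun_approx.
transitivity (limn (fun n => \int[nu]_x (h n x)%:E)).
  rewrite -monotone_convergence//=.
  - by apply: eq_integral => x _; exact/esym/cvg_lim.
  - by move=> n; exact/measurable_EFinP.
  - by move=> n x _; rewrite lee_fin.
  - by move=> x _ a b ab; rewrite lee_fin; exact/lefP/nd_nnsfun_approx.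
under eq_fun do rewrite integral_density_nnsfun.
rewrite -monotone_convergence//=.
- apply: eq_integral => x _; apply/cvg_lim => //.
  exact: cvgeZr.
- by move=> n; apply: emeasurable_funM; exact/measurable_EFinP.
- by move=> n x _; rewrite mule_ge0 ?lee_fin.
- move=> x _ a b ab; rewrite lee_wpmul2r ?lee_fin//.
  exact/lefP/nd_nnsfun_approx.
Qed.

Lemma integrable_density (f : T -> \bar R) : measurable_fun setT f ->
  mu.-integrable setT (fun x => f x * (g x)%:E) -> nu.-integrable setT f.
Proof.
move=> mf /integrableP[_ fi]; apply/integrableP; split => //.
rewrite ge0_integral_density//; last exact: measurableT_comp.
move: fi; congr (_ < _); apply: eq_integral => x _.
by rewrite abseM (gee0_abs (x := (g x)%:E)) ?lee_fin.
Qed.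

Lemma integral_density (f : T -> \bar R) : measurable_fun setT f ->
  \int[nu]_x f x = \int[mu]_x (f x * (g x)%:E).
Proof.
move=> mf; rewrite integralE [RHS]integralE.
congr (_ - _).
  rewrite ge0_integral_density//; last exact: measurable_funepos.
  by apply: eq_integral => x _; rewrite !funeposE muleC maxe_pMr ?lee_fin// mule0 muleC.
rewrite ge0_integral_density//; last exact: measurable_funeneg.
by apply: eq_integral => x _; rewrite !funenegE muleC maxe_pMr ?lee_fin// mule0 muleN muleC.
Qed.

End density.

(** * Stein's identity on the real line *)

Section gauss.
Context {R : realType}.
Notation mu := (@lebesgue_measure R).
Notation phi := (normal_pdf 0 1 : R -> R).
Notation N01 := (normal_prob 0 1 : probability (measurableTypeR R) R).

Lemma std_normal_pdfE (x : R) : phi x = normal_peak 1 * expR (- (x ^+ 2 / 2)).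
Proof.
rewrite normal_pdfE ?oner_neq0// /normal_fun subr0 expr1n.
by congr (_ * expR _); rewrite mulNr.
Qed.

Lemma std_normal_pdf_is_derive (x : R) : is_derive x 1 phi (- (x * phi x)).
Proof.
rewrite (_ : phi = fun x => normal_peak 1 * expR (- (x ^+ 2 / 2))); last first.
  exact/funext/std_normal_pdfE.
apply: is_derive_eq.
rewrite /GRing.scale/= ; lra.
Qed.

(** The factor [1 + x^2] is absorbed by doubling the variance of the density. *)
Lemma integrable_sqr_std_normal :
  mu.-integrable setT (fun x => ((1 + x ^+ 2) * phi x)%:E).
Proof.
have m2 : measurable_fun setT (fun x : R => (1 + x ^+ 2) * phi x).
  apply: measurable_funM; last exact: measurable_normal_pdf.
  exact: measurable_funD.
have s20 : Num.sqrt 2 != 0 :> R by rewrite sqrtr_eq0 -ltNge.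
have := integrable_normal_pdf 0 (Num.sqrt 2 : R).
move=> /(integrableZl measurableT (4 * normal_peak 1 / normal_peak (Num.sqrt 2))).
apply: le_integrable => //; first exact/measurable_EFinP.
move=> x _ /=; rewrite lee_fin ger0_norm; last first.
  by rewrite mulr_ge0 ?normal_pdf_ge0// addr_ge0// sqr_ge0.
rewrite ger0_norm; last first.
  by rewrite !mulr_ge0 ?normal_pdf_ge0 ?invr_ge0 ?normal_peak_ge0.
rewrite std_normal_pdfE normal_pdfE// /normal_fun subr0 sqr_sqrtr//.
rewrite [leLHS]mulrCA; set e1 := (1 + _) * _; set e2 := expR (_ / _).
rewrite -!mulrA [leRHS]mulrCA ler_wpM2l ?normal_peak_ge0//.
rewrite mulKf; last by rewrite gt_eqF// normal_peak_gt0.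
rewrite /e1 /e2 (_ : - (x ^+ 2 / 2) = - x ^+ 2 / (2 *+ 2) + - (x ^+ 2 / 4)); last first.
  by rewrite -mulr_natr; lra.
rewrite expRD mulrCA [leRHS]mulrC ler_wpM2l ?expR_ge0//.
rewrite expRN ler_pdivrMr ?expR_gt0//.
by have := expR_ge1Dx (x ^+ 2 / 4); lra.
Qed.

Lemma std_normal_pdf_cvg0 : phi n.+1%:R @[n --> \oo] --> 0.
Proof.
have h n : phi n.+1%:R <= normal_peak 1 * 2 * n.+1%:R^-1.
  rewrite std_normal_pdfE -mulrA ler_wpM2l ?normal_peak_ge0//.
  rewrite expRN ler_pdivlMr ?ltr0n// ler_pdivrMl ?expR_gt0//.
  have := expR_ge1Dx (n.+1%:R ^+ 2 / 2 : R).
  have : 0 <= (n.+1%:R - 1) ^+ 2 :> R by exact: sqr_ge0.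
  have : 0 <= n.+1%:R :> R by [].
  set x : R := n.+1%:R; set e := expR _; clearbody e; clearbody x.
  move=> x0 h1 h2; nra.
apply: (squeeze_cvgr (f := cst 0) (h := fun n => normal_peak 1 * 2 * n.+1%:R^-1)).
- by near=> n; rewrite normal_pdf_ge0 h.
- exact: cvg_cst.
- rewrite -(mulr0 (normal_peak 1 * 2)); apply: cvgM; first exact: cvg_cst.
  exact: cvg_harmonic.
Unshelve. all: by end_near. Qed.

Lemma std_normal_pdf_even (x : R) : phi (- x) = phi x.
Proof. by rewrite !std_normal_pdfE sqrrN. Qed.

Lemma cvg_integral_symmetric_itv (f : R -> R) :
  mu.-integrable setT (EFin \o f) ->
  (\int[mu]_(x in `[(- n%:R)%R, (n%:R)%R]) (f x)%:E)%E @[n --> \oo] -->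
    (\int[mu]_x (f x)%:E)%E.
Proof.
move=> fi.
under eq_fun do rewrite integral_mkcond.
have [] // := @dominated_convergence _ _ _ mu setT measurableT
  (fun n => (EFin \o f) \_ `[- n%:R, n%:R]) (EFin \o f) (abse \o (EFin \o f)).
- move=> n; apply/(measurable_restrictT _ _).1 => //.
  by apply: measurable_funTS; exact: measurable_int fi.
- exact: measurable_int fi.
- apply: aeW => x _; apply: cvg_near_cst; near=> n.
  rewrite patchE mem_set//= in_itv/= -ler_norml.
  by near: n; exact: nbhs_infty_ger.
- exact: integrable_abse.
- apply: aeW => x n _; rewrite patchE; case: ifP => //=.
  by rewrite normr0 lee_fin.
Unshelve. all: by end_near. Qed.

Lemma integrable_bounded_std_normal (f g : R -> R) (C : R) :
  measurable_fun setT f -> (forall x, `|f x| <= C) ->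
  measurable_fun setT g -> (forall x, `|g x| <= 1 + x ^+ 2) ->
  mu.-integrable setT (fun x => (g x * f x * phi x)%:E).
Proof.
move=> mf fC mg gx.
have C0 : 0 <= C by apply: le_trans (fC 0).
have := integrableZl measurableT C integrable_sqr_std_normal.
apply: le_integrable => //.
  apply/measurable_EFinP/measurable_funM; last exact: measurable_normal_pdf.
  exact: measurable_funM.
move=> x _ /=; rewrite lee_fin !normrM (ger0_norm (normal_pdf_ge0 _ _ _)).
rewrite (ger0_norm C0) (ger0_norm (x := 1 + x ^+ 2)) ?addr_ge0 ?sqr_ge0//.
rewrite mulrA ler_wpM2r ?normal_pdf_ge0// mulrC ler_pM//.
Qed.

(** The derivative of [f phi] is [(f' - x f) phi], and [f phi] vanishes at
    infinity because [f] is bounded: the integral of [(f' - x f) phi] over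
    [[-n, n]] tends to [0]. *)
Lemma stein_std_normal (f f' : R -> R) (C : R) :
  (forall x : R, is_derive x 1 f (f' x)) -> continuous f' ->
  (forall x, `|f x| <= C) -> (forall x, `|f' x| <= C) ->
  (\int[N01]_x (x * f x)%:E = \int[N01]_x (f' x)%:E)%E.
Proof.
move=> df cf' fC f'C.
have cf : continuous f.
  by move=> x; apply: differentiable_continuous; apply/derivable1_diffP; apply: ex_derive.
have mf : measurable_fun setT f by exact: continuous_measurable_fun.
have mf' : measurable_fun setT f' by exact: continuous_measurable_fun.
have mphi : measurable_fun setT phi by exact: measurable_normal_pdf.
have phi0 x : 0 <= phi x by exact: normal_pdf_ge0.
have NE (h : R -> R) : measurable_fun setT h ->
    (\int[N01]_x (h x)%:E = \int[mu]_x (h x * phi x)%:E)%E.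
  move=> mh; rewrite (@integral_density _ _ _ mu N01 _ mphi phi0)//.
  exact/measurable_EFinP.
rewrite (NE (fun x => x * f x)); last exact: measurable_funM.
rewrite (NE f')//.
have i1 : mu.-integrable setT (fun x => (x * f x * phi x)%:E).
  apply: (integrable_bounded_std_normal (C := C)) => // x.
  have : 0 <= (`|x| - 1) ^+ 2 by exact: sqr_ge0.
  by rewrite -(real_normK (num_real x)); nra.
have i2 : mu.-integrable setT (fun x => (f' x * phi x)%:E).
  rewrite (_ : (fun x => _) = fun x => (1 * f' x * phi x)%:E); last first.
    by apply/funext => x; rewrite mul1r.
  apply: (integrable_bounded_std_normal (C := C)) => // x.
  by rewrite normr1 lerDl sqr_ge0.
pose g x := f' x * phi x - x * f x * phi x.
have ig : mu.-integrable setT (EFin \o g).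
  exact: (integrableB measurableT i2 i1).
have gE n : (\int[mu]_(x in `[(- n.+1%:R)%R, (n.+1%:R)%R]) (g x)%:E)%E =
    ((f n.+1%:R - f (- n.+1%:R)) * phi n.+1%:R)%:E.
  have dfphi (x : R) : is_derive x 1 (fun x => f x * phi x) (g x).
    have h1 := df x; have h2 := std_normal_pdf_is_derive x.
    apply: is_derive_eq; rewrite /GRing.scale/= /g; ring.
  have cg : continuous g.
    move=> x; have cphi := @continuous_normal_pdf R 0 1 (oner_neq0 R) x.
    apply: cvgB; first by apply: cvgM => //; exact: cf'.
    by apply: cvgM => //; apply: cvgM => //; exact: cf.
  rewrite (@continuous_FTC2 _ g (fun x => f x * phi x)).
  - by rewrite std_normal_pdf_even -EFinB mulrBl.
  - by rewrite gtrN// ltr0n.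
  - exact: continuous_subspaceT.
  - have cfphi : continuous (fun x => f x * phi x).
      move=> x; apply: cvgM; first exact: cf.
      exact: (@continuous_normal_pdf R 0 1 (oner_neq0 R)).
    split; [by move=> x _; exact: ex_derive| |].
      exact/cvg_at_right_filter/cfphi.
    exact/cvg_at_left_filter/cfphi.
  - move=> x _; rewrite derive1E; exact: derive_val.
have c2 : (\int[mu]_(x in `[(- n%:R)%R, (n%:R)%R]) (g x)%:E)%E
    @[n --> \oo] --> (0%:E : \bar R).
  rewrite -(cvg_shiftS (fun n => (\int[mu]_(x in `[(- n%:R)%R, (n%:R)%R]) (g x)%:E)%E)).
  under eq_fun do rewrite gE.
  apply: cvg_EFin; first by near=> n.
  have h n : `|(f n.+1%:R - f (- n.+1%:R)) * phi n.+1%:R| <= 2 * C * phi n.+1%:R.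
    rewrite normrM (ger0_norm (phi0 _)) ler_wpM2r// mulr_natl mulr2n.
    by rewrite (le_trans (ler_normB _ _))// lerD.
  have c0 : 2 * C * phi n.+1%:R @[n --> \oo] --> 0.
    rewrite -[X in _ --> X](mulr0 (2 * C)); apply: cvgM; first exact: cvg_cst.
    exact: std_normal_pdf_cvg0.
  apply/cvgr0Pnorm_le => e e0; move/cvgr0Pnorm_le : c0 => /(_ e e0).
  apply: filterS => n; apply: le_trans.
  by rewrite (le_trans (h n))// ler_norm.
have h := cvg_unique (@ereal_hausdorff R) c2 (cvg_integral_symmetric_itv ig).
have : (\int[mu]_x (f' x * phi x)%:E - \int[mu]_x (x * f x * phi x)%:E = 0)%E.
  by rewrite -integralB//; apply/esym/h.
have f1 := integrable_fin_num measurableT i1.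
have f2 := integrable_fin_num measurableT i2.
rewrite -(fineK f1) -(fineK f2) -EFinB => -[] /eqP.
by rewrite subr_eq0 => /eqP ->.
Unshelve. all: by end_near. Qed.

End gauss.

(** * Stein's identity in one coordinate of a standard normal vector *)

Section stein_vector.
Context {R : realType}.
Notation N01 := (normal_prob 0 1 : probability (measurableTypeR R) R).

Lemma std_normal_null1 (c : R) : N01 [set c] = 0%E.
Proof.
have /null_content_dominatesP := normal_prob_dominates (0 : R) 1; apply => //.
exact: lebesgue_measure_set1.
Qed.

Lemma std_normal_integrable_sqr :
  N01.-integrable setT (fun x => (1 + x ^+ 2)%:E).
Proof.
apply: (@integrable_density _ _ _ lebesgue_measure _ _
  (measurable_normal_pdf 0 1) (normal_pdf_ge0 0 1)) => //.
  by apply/measurable_EFinP; exact: measurable_funD.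
exact: integrable_sqr_std_normal.
Qed.

Section pack.
Context d (T : measurableType d) d' (T' : measurableType d').
Definition packRV (P : probability T R) (f : T -> T') (mf : measurable_fun setT f)
  : {RV P >-> T'} := HB.pack f (isMeasurableFun.Build _ _ _ _ f mf).
End pack.

Context d (T : measurableType d) (P : probability T R) (p : nat).

(** Differentiability on every line of direction [e], with a derivative that is
    continuous on each of these lines: this is all that integration by parts in
    one direction requires. *)
Definition differentiable_along (V : lmodType R) (f f' : V -> R) (e : V) :=
  (forall z (t : R), is_derive t 1 (fun s => f (z + s *: e)) (f' (z + t *: e)))
  /\ (forall z, continuous (fun s : R => f' (z + s *: e))).

Section coordinate.
Variable Z : T -> 'cV[R]_p.
Hypothesis hZ : std_normal_vector P Z.

Let mZ : measurable_fun setT Z. Proof. by case: hZ. Qed.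

Lemma std_normal_vector_rows : mutually_independent P (fun i t => row i (Z t)).
Proof.
have [_ _ ind] := hZ; move=> J A mA.
pose B i := [set b : R | A i (const_mx b)].
have mB i : measurable (B i).
  rewrite -[X in measurable X]setTI.
  have : measurable_fun setT (fun b : R => const_mx b : 'rV[R]_1).
    by apply: measurable_to_mx => k l; under eq_fun do rewrite mxE; exact: measurable_id.
  by apply.
have E i : (fun t => row i (Z t)) @^-1` A i = (fun t => Z t i 0) @^-1` B i.
  apply/seteqP; split => t /=; rewrite /B /=;
    by congr (A i _); apply/rowP => j; rewrite !mxE ord1.
under eq_bigcapr do rewrite E.
by rewrite ind//; apply: eq_bigr => i _; rewrite E.
Qed.

Let measurable_coord i : measurable_fun setT (fun t => Z t i 0).
Proof. exact: measurable_mx_entry. Qed.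

Let measurable_del i : measurable_fun setT (fun t => del_row i (Z t)).
Proof. exact: (measurableT_comp (measurable_del_row i) mZ). Qed.

Lemma std_normal_vector_independent i :
  independent_pair P (fun t => Z t i 0) (fun t => del_row i (Z t)).
Proof.
move=> A B mA mB.
have := @independent_row_del_row _ _ _ P _ _ (packRV P mZ) i
  std_normal_vector_rows [set v : 'rV[R]_1 | A (v 0 0)] B.
rewrite (_ : _ @^-1` [set v | _] = (fun t => Z t i 0) @^-1` A); last first.
  by apply/seteqP; split => t /=; rewrite !mxE.
apply => //.
rewrite -[X in measurable X]setTI; exact: measurable_entry.
Qed.

Let del_coord i t : del_row i (Z t) + Z t i 0 *: delta_mx i 0 = Z t.
Proof.
apply/colP => k; rewrite !mxE eqxx andbT.
by case: eqP => [->|_]; rewrite ?add0r ?mulr1// mulr0 addr0.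
Qed.

Let coordRV i : {RV P >-> measurableTypeR R} :=
  packRV P (T' := measurableTypeR R) (measurable_coord i).

Let delRV i := packRV P (measurable_del i).

Lemma std_normal_coordinate_distribution i A : measurable A ->
  distribution P (coordRV i) A = N01 A.
Proof. by move=> mA; have [_ h _] := hZ; exact: h. Qed.

Lemma std_normal_coordinate_integrable i :
  P.-integrable setT (fun t => (1 + Z t i 0 ^+ 2)%:E).
Proof.
apply/integrableP; split.
  apply/measurable_EFinP/measurable_funD => //; exact: measurable_funX.
have /integrableP[_] := std_normal_integrable_sqr; congr (_ < _)%E.
rewrite (eq_measure_integral (distribution P (coordRV i))); last first.
  by move=> A mA _; exact/esym/std_normal_coordinate_distribution.
rewrite ge0_integral_distribution//.
apply: measurableT_comp => //; apply/measurable_EFinP.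
exact: measurable_funD.
Qed.

Lemma std_normal_mul_integrable i (h : T -> R) (C : R) :
  measurable_fun setT h -> (forall t, `|h t| <= C) ->
  P.-integrable setT (fun t => (Z t i 0 * h t)%:E).
Proof.
move=> mh hC.
have C0 : 0 <= C by apply: le_trans (hC point).
have := integrableZl measurableT C (std_normal_coordinate_integrable i).
apply: le_integrable => //; first exact/measurable_EFinP/measurable_funM.
move=> t _ /=; rewrite lee_fin normrM mulrC normrM (ger0_norm C0).
rewrite ler_pM// (ger0_norm (x := 1 + _)) ?addr_ge0 ?sqr_ge0//.
have : 0 <= (`|Z t i 0| - 1) ^+ 2 by exact: sqr_ge0.
by rewrite -(real_normK (num_real (Z t i 0))); nra.
Qed.

(** Coordinate [i] is independent of the others; with those frozen, the identity
    is the one on the real line. *)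
Lemma stein_coordinate i (f f' : 'cV[R]_p -> R) (C : R) :
  measurable_fun setT f -> measurable_fun setT f' ->
  differentiable_along f f' (delta_mx i 0) ->
  (forall z, `|f z| <= C) -> (forall z, `|f' z| <= C) ->
  (\int[P]_t (Z t i 0 * f (Z t))%:E = \int[P]_t (f' (Z t))%:E)%E.
Proof.
move=> mf mf' [df cf'] fC f'C.
have C0 : 0 <= C by apply: le_trans (fC 0).
have ind : independent_pair P (coordRV i) (delRV i).
  exact: std_normal_vector_independent.
pose g (h : 'cV[R]_p -> R) (x : measurableTypeR R * 'cV[R]_p) : R :=
  h (x.2 + (x.1 : R) *: delta_mx i 0).
have gE h t : h (Z t) = g h (coordRV i t, delRV i t).
  by rewrite /g /= del_coord.
have mg h : measurable_fun setT h -> measurable_fun setT (g h).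
  move=> mh; apply: measurableT_comp => //.
  apply: measurable_addmx; first exact: measurable_snd.
  apply: (measurable_scalemx (a := fst)) => //; exact: measurable_fst.
pose F1 x := (x.1 * g f x)%:E; pose F2 x := (g f' x)%:E.
have mF1 : measurable_fun setT F1.
  apply/measurable_EFinP; apply: (measurable_funM (f := fst)); last exact: mg.
  exact: measurable_fst.
have mF2 : measurable_fun setT F2 by apply/measurable_EFinP; exact: mg.
have iF1 : P.-integrable setT (fun t => F1 (coordRV i t, delRV i t)).
  have mfZ : measurable_fun setT (f \o Z) by exact: measurableT_comp.
  have := std_normal_mul_integrable i mfZ (fun t => fC (Z t)).
  by apply: eq_integrable => // t _; rewrite /F1 -gE.
have iF2 : P.-integrable setT (fun t => F2 (coordRV i t, delRV i t)).
  apply: (@le_integrable _ _ _ _ _ _ _ (cst C%:E)) => //.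
  - exact: (measurableT_comp mF2 (measurable_pairRV (coordRV i) (delRV i))).
  - by move=> t _ /=; rewrite lee_fin -gE (ger0_norm C0); exact: f'C.
  - exact: finite_measure_integrable_cst.
transitivity (\int[P]_t F1 (coordRV i t, delRV i t))%E.
  by apply: eq_integral => t _; rewrite /F1 -gE.
transitivity (\int[P]_t F2 (coordRV i t, delRV i t))%E; last first.
  by apply: eq_integral => t _; rewrite /F2 -gE.
rewrite !integral_pair// -!integral21_prod_meas1//; try exact: integrable_pair.
apply: eq_integral => v _; rewrite /fubini_G.
rewrite !(@eq_measure_integral _ _ _ _ N01 (distribution P (coordRV i))); last 2 first.
  by move=> A mA _; exact: std_normal_coordinate_distribution.
  by move=> A mA _; exact: std_normal_coordinate_distribution.
apply: (@stein_std_normal _ (fun s => f (v + s *: delta_mx i 0)) _ C) => //.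
  exact: cf'.
by move=> x; exact: f'C.
Qed.

End coordinate.
End stein_vector.

(** * Stein's identity for a normal vector *)

Section square_integrable.
Context {R : realType} d (T : measurableType d) (P : probability T R).

Definition square_integrable (f : T -> R) :=
  measurable_fun setT f /\ P.-integrable setT (fun t => (f t ^+ 2)%:E).

Lemma square_integrable_cst (c : R) : square_integrable (fun=> c).
Proof. by split; [exact: measurable_cst|exact: finite_measure_integrable_cst]. Qed.

Lemma square_integrableD f g :
  square_integrable f -> square_integrable g -> square_integrable (f \+ g).
Proof.
move=> [mf jf] [mg jg]; split; first exact: measurable_funD.
have := integrableD measurableT (integrableZl measurableT 2 jf)
  (integrableZl measurableT 2 jg).
apply: le_integrable => //.
  by apply/measurable_EFinP; apply: measurable_funX; exact: measurable_funD.
move=> t _ /=; rewrite lee_fin ger0_norm ?sqr_ge0// ger0_norm.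
  by have := sqr_ge0 (f t - g t); nra.
by rewrite addr_ge0// mulr_ge0// sqr_ge0.
Qed.

Lemma square_integrableZ c f :
  square_integrable f -> square_integrable (fun t => c * f t).
Proof.
move=> [mf jf]; split; first exact: measurable_funM.
have := integrableZl measurableT (c ^+ 2) jf.
by apply: eq_integrable => // t _; rewrite exprMn.
Qed.

Lemma square_integrable_sum (I : finType) (f : I -> T -> R) :
  (forall i, square_integrable (f i)) ->
  square_integrable (fun t => \sum_i f i t).
Proof.
move=> jf; have : forall s : seq I, square_integrable (fun t => \sum_(i <- s) f i t).
  elim=> [|i s IH].
    under eq_fun do rewrite big_nil; exact: square_integrable_cst.
  under eq_fun do rewrite big_cons; exact: square_integrableD.
exact.
Qed.

End square_integrable.

Section stein_normal.
Context {R : realType} (p : nat).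

(** [dG] is the Jacobian of [G] restricted to the directions [dir v].  With
    [dir = id] this is the full Jacobian; with [V] a space of matrices and [dir]
    the insertion of [v] in one row, it is the Jacobian with respect to that
    row. *)
Definition bounded_C1_field (V : lmodType R) (dir : 'cV[R]_p -> V)
    (G : V -> 'cV[R]_p) (dG : V -> 'M[R]_p) (C : R) :=
  [/\ forall v i, differentiable_along (fun x => G x i 0)
        (fun x => (dG x *m v) i 0) (dir v),
      forall x i, `|G x i 0| <= C
    & forall x i j, `|dG x i j| <= C].

Context d (T : measurableType d) (P : probability T R).
Variables (theta : 'cV[R]_p) (Sigma : 'M[R]_p) (X : T -> 'cV[R]_p).
Hypotheses (hX : normal_vector P theta Sigma X) (hS : posdefmx Sigma).

Lemma posdefmx_unit (S : 'M[R]_p) : posdefmx S -> S \in unitmx.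
Proof.
move=> [_ S0]; rewrite -row_free_unit -kermx_eq0; apply/rowV0P => v /sub_kermxP vS.
apply/eqP; apply: contraT => v0; have := S0 v^T.
by rewrite /qform trmxK vS mul0mx mxE ltxx -(inj_eq (@trmx_inj _ _ _)) trmxK trmx0; apply.
Qed.

Lemma normal_vector_measurable : measurable_fun setT X.
Proof.
have [A [Z [_ [mZ _ _] XE]]] := hX.
rewrite (funext XE); apply: measurable_addmx; first exact: measurable_cst.
by apply: measurable_mulmx => //; exact: measurable_cst.
Qed.

Lemma normal_vector_square_integrable i : square_integrable P (fun t => X t i 0).
Proof.
have [A [Z [_ hZ XE]]] := hX.
have -> : (fun t => X t i 0) = (fun t => theta i 0 + \sum_k A i k * Z t k 0).
  by apply/funext => t; rewrite XE !mxE.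
apply: square_integrableD; first exact: square_integrable_cst.
apply: square_integrable_sum => k; apply: square_integrableZ; split.
  by have [mZ _ _] := hZ; exact: measurable_mx_entry.
have := std_normal_coordinate_integrable hZ k.
have [mZ _ _] := hZ; apply: le_integrable => //.
  by apply/measurable_EFinP; apply: measurable_funX; exact: measurable_mx_entry.
by move=> t _ /=; rewrite lee_fin !ger0_norm ?addr_ge0 ?sqr_ge0// lerDr.
Qed.

(** Write [X = theta + A Z] with [A A^T = Sigma].  Then [A^T Sigma^-1 = A^-1], so
    the left side is the sum over the coordinates of [Z] of the integrals of
    [Z_i (A^-1 G(X))_i]; the derivatives that come out add up to the trace of
    [A^-1 dG A], which is that of [dG]. *)
Lemma stein_normal (G : 'cV[R]_p -> 'cV[R]_p) (dG : 'cV[R]_p -> 'M[R]_p) (C : R) :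
  measurable_fun setT G -> measurable_fun setT dG ->
  bounded_C1_field id G dG C ->
  (\int[P]_t (((X t - theta)^T *m invmx Sigma *m G (X t)) 0 0)%:E
   = \int[P]_t (\tr (dG (X t)))%:E)%E.
Proof.
move=> mG mdG [dGe GC dGC].
have [A [Z [AS hZ XE]]] := hX.
have [mZ _ _] := hZ.
have uS := posdefmx_unit hS.
have uA : A \in unitmx by move: uS; rewrite -AS unitmx_mul => /andP[].
pose B := invmx A.
pose at_ z := theta + A *m z.
pose f i z := (B *m G (at_ z)) i 0.
pose f' i z := (B *m (dG (at_ z) *m col i A)) i 0.
have mat_ : measurable_fun setT at_.
  apply: measurable_addmx; first exact: measurable_cst.
  by apply: measurable_mulmx; [exact: measurable_cst|exact: measurable_id].
have mGat : measurable_fun setT (G \o at_) by exact: measurableT_comp.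
have mdGat : measurable_fun setT (dG \o at_) by exact: measurableT_comp.
have mf i : measurable_fun setT (f i).
  apply: measurable_mx_entry; apply: measurable_mulmx => //; exact: measurable_cst.
have mf' i : measurable_fun setT (f' i).
  apply: measurable_mx_entry; apply: measurable_mulmx; first exact: measurable_cst.
  by apply: measurable_mulmx => //; exact: measurable_cst.
have at_line z i (s : R) : at_ (z + s *: delta_mx i 0) = at_ z + s *: col i A.
  by rewrite /at_ mulmxDr -scalemxAr -colE addrA.
have df i : differentiable_along (f i) (f' i) (delta_mx i 0).
  split => [z t|z t].
    rewrite /f /f'; under eq_fun do rewrite at_line; rewrite at_line.
    rewrite -[B *m _]addr0 [B *m _ + 0]addrC -(mul0mx _ (G (at_ z + t *: col i A))).
    apply: mx_is_deriveM; first exact: mx_is_derive_cst.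
    move=> k j; rewrite ord1; have [h _] := dGe (col i A) k; exact: h.
  have -> : (fun s : R => f' i (z + s *: delta_mx i 0)) =
      fun s => (B *m (dG (at_ z + s *: col i A) *m col i A)) i 0.
    by apply/funext => s; rewrite /f' at_line.
  apply: mx_cvgM; first exact: mx_cvg_cst.
  by move=> k j; rewrite ord1; have [_ h] := dGe (col i A) k; exact: h.
have bnd : exists D, forall i z, `|f i z| <= D /\ `|f' i z| <= D.
  have [b Bb] := normr_mx_bounded B; have [a Aa] := normr_mx_bounded A.
  exists (Num.max (p%:R * (b * C)) (p%:R * (b * (p%:R * (C * a))))) => i z.
  split; rewrite le_max; apply/orP; [left|right].
    by apply: normr_mulmx_le => // k j; rewrite ord1.
  apply: normr_mulmx_le => // k j.
  by apply: normr_mulmx_le => // l l'; rewrite mxE.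
have [D fD] := bnd.
transitivity (\int[P]_t (\sum_i (Z t i 0 * f i (Z t))%:E))%E.
  apply: eq_integral => t _; rewrite sumEFin; congr (_%:E).
  have AB : A^T *m invmx Sigma = B.
    by rewrite -{1}[A^T](mulKmx uA) AS mulmxK.
  rewrite XE addrC addKr trmx_mul -(mulmxA _ A^T) AB -mulmxA mxE.
  by apply: eq_bigr => i _; rewrite mxE /f /at_.
rewrite integral_sum//; last first.
  move=> i; apply: (std_normal_mul_integrable hZ i (C := D)) => //.
    exact: measurableT_comp.
  by move=> t; case: (fD i (Z t)).
transitivity (\sum_i \int[P]_t (f' i (Z t))%:E)%E.
  apply: eq_bigr => i _; apply: (stein_coordinate hZ (C := D)) => // z.
    by case: (fD i z).
  by case: (fD i z).
rewrite -integral_sum//; last first.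
  move=> i; apply: (@le_integrable _ _ _ _ _ _ _ (cst D%:E)) => //.
  - apply/measurable_EFinP; exact: (measurableT_comp (mf' i)).
  - move=> t _; rewrite /= lee_fin.
    have [_ h] := fD i (Z t); exact: le_trans h (ler_norm _).
  - exact: finite_measure_integrable_cst.
apply: eq_integral => t _; rewrite sumEFin; congr (_%:E).
rewrite -[dG (X t)]mulmx1 -(mulmxV uA) mulmxA mxtrace_mulC XE -/B -/(at_ (Z t)).
apply: eq_bigr => i _; rewrite /f' !mxE; apply: eq_bigr => k _; congr (_ * _).
by rewrite !mxE; apply: eq_bigr => l _; rewrite mxE.
Qed.

End stein_normal.

(** * Rows of a normal matrix: Stein's identity and full rank *)

Section null.
Context {R : realType} d (T : measurableType d) (P : probability T R).
Context d1 d2 (T1 : measurableType d1) (T2 : measurableType d2).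

Lemma null_pair (U : {RV P >-> T1}) (V : {RV P >-> T2}) (E : set (T1 * T2)) :
  independent_pair P U V -> measurable E ->
  (forall v, P [set t | E (U t, v)] = 0%E) -> P [set t | E (U t, V t)] = 0%E.
Proof.
move=> ind mE E0.
transitivity ((distribution P U \x distribution P V)%E E).
  by rewrite -distribution_pair.
rewrite (@product_measure_unique _ _ _ _ _ _ _
  ((distribution P U \x^ distribution P V)%E))//; last first.
  by move=> A B mA mB; exact: product_measure2E.
rewrite /product_measure2; apply: integral0_eq => v _ /=.
by rewrite -[RHS](E0 v); congr (P _); apply/seteqP; split => t /=;
  rewrite /ysection/= inE.
Qed.

End null.

Section hyperplane.
Context {R : realType} d (T : measurableType d) (P : probability T R) (p : nat).
Variables (Sigma : 'M[R]_p) (X : T -> 'cV[R]_p).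
Hypotheses (hX : normal_vector P 0 Sigma X) (hS : posdefmx Sigma).

(** [X^T w = Z^T b] with [b = A^T w] nonzero, say [b_i <> 0]; given the other
    coordinates of [Z], the event asks [Z_i] to take one value. *)
Lemma normal_hyperplane_null (w : 'cV[R]_p) : w != 0 ->
  P [set t | ((X t)^T *m w) 0 0 = 0] = 0%E.
Proof.
move=> w0; have [A [Z [AS hZ XE]]] := hX; have [mZ hlaw _] := hZ.
have uA : A \in unitmx.
  by have := posdefmx_unit hS; rewrite -AS unitmx_mul => /andP[].
pose b := A^T *m w.
have [i bi0] : exists i, b i 0 != 0.
  apply/existsP; apply: contraT; rewrite negb_exists => /forallP b0.
  have : b = 0 by apply/colP => i; rewrite [RHS]mxE; have := b0 i; rewrite negbK => /eqP.
  move=> /(congr1 (mulmx (invmx A^T))); rewrite mulmx0 mulKmx ?unitmx_tr// => w00.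
  by rewrite w00 eqxx in w0.
have mcoord : measurable_fun setT (fun t => Z t i 0) by exact: measurable_mx_entry.
pose U : {RV P >-> measurableTypeR R} := packRV P (T' := measurableTypeR R) mcoord.
pose V := packRV P (measurableT_comp (measurable_del_row i) mZ).
pose E := [set x : measurableTypeR R * 'cV[R]_p |
  (x.1 : R) * b i 0 + (x.2^T *m b) 0 0 = 0].
have := @null_pair _ _ _ P _ _ _ _ U V E.
rewrite (_ : [set t | E (U t, V t)] = [set t | ((X t)^T *m w) 0 0 = 0]); last first.
  apply/seteqP.
  suff h t : (U t : R) * b i 0 + ((V t)^T *m b) 0 0 = ((X t)^T *m w) 0 0.
    by split => t /=; rewrite /E /= h.
  have -> : V t = del_row i (Z t) by [].
  rewrite XE add0r trmx_mul -mulmxA -/b; clearbody b; rewrite !mxE.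
  rewrite [in LHS](bigD1 i)//= [in RHS](bigD1 i)//= !mxE eqxx mul0r add0r; congr (_ + _).
  by apply: eq_bigr => k ki; rewrite !mxE (negbTE ki).
apply.
- exact: std_normal_vector_independent.
- rewrite -[X in measurable X]setTI.
  have mg : measurable_fun setT (fun x : measurableTypeR R * 'cV[R]_p =>
      (x.1 : R) * b i 0 + (x.2^T *m b) 0 0).
    apply: measurable_funD; first exact: (measurable_funM (f := fst)).
    apply: measurable_mx_entry; apply: measurable_mulmx => //.
    exact: (measurable_trmx (f := snd)).
  exact: (mg measurableT [set 0] (measurable_set1 _)).
- move=> v.
  have := hlaw i [set - (v^T *m b) 0 0 / b i 0] (measurable_set1 _).
  rewrite std_normal_null1 => <-; congr (P _); apply/seteqP; split => t /=.
    by move=> h; apply: (mulIf bi0); rewrite divfK//; apply/eqP; rewrite -addr_eq0; apply/eqP.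
  by rewrite /E /= => ->; rewrite divfK// addNr.
Qed.

End hyperplane.

Section normal_matrix.
Context {R : realType} d (T : measurableType d) (P : probability T R) (n p : nat).
Variables (Sigma : 'M[R]_p) (Y : T -> 'M[R]_(n, p)).
Hypotheses (hY : normal_matrix P Sigma Y) (hS : posdefmx Sigma).

Lemma normal_matrix_measurable : measurable_fun setT Y.
Proof.
apply: measurable_to_mx => i j.
have [h _] := hY; have := measurable_mx_entry j 0 (normal_vector_measurable (h i)).
by under eq_fun do rewrite !mxE.
Qed.

Let mY := normal_matrix_measurable.

Let mrow i : measurable_fun setT (fun t => row i (Y t)).
Proof. exact: (measurableT_comp (measurable_row i) mY). Qed.

Let mdel i : measurable_fun setT (fun t => del_row i (Y t)).
Proof. exact: (measurableT_comp (measurable_del_row i) mY). Qed.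

Let rowRV i := packRV P (mrow i).
Let delRV i := packRV P (mdel i).

Let ind i : independent_pair P (rowRV i) (delRV i).
Proof.
by have [_ h] := hY; exact: (@independent_row_del_row _ _ _ P _ _ (packRV P mY)).
Qed.

Lemma normal_matrix_square_integrable i j : square_integrable P (fun t => Y t i j).
Proof.
have [h _] := hY; have := normal_vector_square_integrable (h i) j.
by under eq_fun do rewrite !mxE.
Qed.

Lemma measurable_put_row i : measurable_fun setT (fun v : 'rV[R]_p => put_row i v : 'M[R]_(n, p)).
Proof.
apply: measurable_to_mx => k l; under eq_fun do rewrite mxE.
by case: (k == i); [exact: measurable_entry|exact: measurable_cst].
Qed.

Lemma put_rowD (i : 'I_n) (v w : 'rV[R]_p) (s : R) :
  put_row i (v + s *: w) = put_row i v + s *: put_row i w.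
Proof.
by apply/matrixP => k l; rewrite !mxE; case: eqP; rewrite ?mulr0 ?addr0.
Qed.

Lemma square_integrable_mul_bounded (f g : T -> R) (C : R) :
  square_integrable P f -> measurable_fun setT g -> (forall t, `|g t| <= C) ->
  P.-integrable setT (fun t => (f t * g t)%:E).
Proof.
move=> [mf jf] mg gC.
have C0 : 0 <= C by apply: le_trans (gC point).
have j1 : P.-integrable setT (fun t => (1 : R)%:E) by exact: finite_measure_integrable_cst.
have := integrableZl measurableT C (integrableD measurableT j1 jf).
apply: le_integrable => //; first exact/measurable_EFinP/measurable_funM.
move=> t _ /=; rewrite lee_fin normrM mulrC normrM (ger0_norm C0).
rewrite ler_pM// (ger0_norm (x := 1 + _)) ?addr_ge0 ?sqr_ge0//.
have : 0 <= (`|f t| - 1) ^+ 2 by exact: sqr_ge0.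
by rewrite -(real_normK (num_real (f t))); nra.
Qed.

Lemma row_mul_integrable (i : 'I_n) (G : T -> 'cV[R]_p) (C : R) :
  measurable_fun setT G -> (forall t k, `|G t k 0| <= C) ->
  P.-integrable setT
    (fun t => ((row i (Y t) *m invmx Sigma *m G t) 0 0)%:E).
Proof.
move=> mG GC; have [a Sa] := normr_mx_bounded (invmx Sigma).
have -> : (fun t => ((row i (Y t) *m invmx Sigma *m G t) 0 0)%:E) =
    fun t => (\sum_k (Y t i k * (invmx Sigma *m G t) k 0)%:E)%E.
  apply/funext => t; rewrite sumEFin -mulmxA mxE; congr _%:E.
  by apply: eq_bigr => k _; rewrite mxE.
apply: integrable_sum => // k _.
apply: (@square_integrable_mul_bounded _ _ (p%:R * (a * C))).
- exact: normal_matrix_square_integrable.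
- by apply: measurable_mx_entry; apply: measurable_mulmx; first exact: measurable_cst.
- by move=> t; apply: normr_mulmx_le => // l j; rewrite ord1.
Qed.

(** Row [i] is independent of the rest of [Y]; with that rest frozen, the identity
    is the one for a normal vector. *)
Section stein_row.
Variables (i : 'I_n) (G : 'M[R]_(n, p) -> 'cV[R]_p) (dG : 'M[R]_(n, p) -> 'M[R]_p).
Variable C : R.
Hypotheses (mG : measurable_fun setT G) (mdG : measurable_fun setT dG).
Hypothesis GC : bounded_C1_field (fun v => put_row i v^T) G dG C.

Lemma stein_row :
  (\int[P]_t ((row i (Y t) *m invmx Sigma *m G (Y t)) 0 0)%:E
   = \int[P]_t (\tr (dG (Y t)))%:E)%E.
Proof.
have [dGe Gb dGb] := GC.
pose back (x : 'rV[R]_p * 'M[R]_(n, p)) := x.2 + put_row i x.1.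
have mback : measurable_fun setT back.
  apply: measurable_addmx => //; apply: (measurableT_comp (measurable_put_row i)) => //.
have backE t : back (rowRV i t, delRV i t) = Y t by exact: del_put_row.
pose F1 x := ((x.1 *m invmx Sigma *m G (back x)) 0 0)%:E.
pose F2 x := (\tr (dG (back x)))%:E.
have mF1 : measurable_fun setT F1.
  apply/measurable_EFinP/measurable_mx_entry/measurable_mulmx.
    by apply: (measurable_mulmx (f := fst)) => //; exact: measurable_cst.
  exact: measurableT_comp.
have mF2 : measurable_fun setT F2.
  apply/measurable_EFinP/measurable_sum => k; apply: measurable_mx_entry.
  exact: measurableT_comp.
have iF1 : P.-integrable setT (fun t => F1 (rowRV i t, delRV i t)).
  have := row_mul_integrable i (measurableT_comp mG mY) (fun t => Gb (Y t)).
  by apply: eq_integrable => // t _; rewrite /F1 backE.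
have iF2 : P.-integrable setT (fun t => F2 (rowRV i t, delRV i t)).
  apply: (@le_integrable _ _ _ _ _ _ _ (cst (p%:R * C)%:E)) => //.
  - exact: (measurableT_comp mF2 (measurable_pairRV (rowRV i) (delRV i))).
  - move=> t _; rewrite /= lee_fin (le_trans (ler_norm_sum _ _ _))//.
    apply: le_trans (ler_norm _).
    rewrite (le_trans (y := \sum_(k < p) C))//; first exact: ler_sum.
    by rewrite sumr_const card_ord mulr_natl.
  - exact: finite_measure_integrable_cst.
transitivity (\int[P]_t F1 (rowRV i t, delRV i t))%E.
  by apply: eq_integral => t _; rewrite /F1 backE.
transitivity (\int[P]_t F2 (rowRV i t, delRV i t))%E; last first.
  by apply: eq_integral => t _; rewrite /F2 backE.
rewrite (integral_pair (ind i) mF1 iF1) (integral_pair (ind i) mF2 iF2).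
rewrite -(integral21_prod_meas1 (integrable_pair (ind i) mF1 iF1)).
rewrite -(integral21_prod_meas1 (integrable_pair (ind i) mF2 iF2)).
apply: eq_integral => v _; rewrite /fubini_G.
pose Gv (x : 'cV[R]_p) := G (v + put_row i x^T).
pose dGv (x : 'cV[R]_p) := dG (v + put_row i x^T).
have mv : measurable_fun setT (fun x : 'cV[R]_p => v + put_row i x^T).
  apply: measurable_addmx; first exact: measurable_cst.
  by apply: (measurableT_comp (measurable_put_row i)); exact: measurable_trmx.
have mGv : measurable_fun setT Gv by exact: measurableT_comp.
have mdGv : measurable_fun setT dGv by exact: measurableT_comp.
have [hrow _] := hY.
have mrowT := normal_vector_measurable (hrow i).
have GvC : bounded_C1_field id Gv dGv C.
  split => [w k|x k|x k l]; [|exact: Gb|exact: dGb].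
  have lineE (z : 'cV[R]_p) (s : R) :
      v + put_row i (z + s *: w)^T = v + put_row i z^T + s *: put_row i w^T.
    by rewrite linearD linearZ put_rowD addrA.
  have [h1 h2] := dGe w k; split => [z t|z].
    rewrite /Gv /dGv; under eq_fun do rewrite lineE; rewrite lineE; exact: h1.
  rewrite (_ : (fun s => _) = fun s : R =>
    (dG (v + put_row i z^T + s *: put_row i w^T) *m w) k 0); first exact: h2.
  by apply/funext => s; rewrite /dGv lineE.
have push F : measurable_fun setT F -> P.-integrable setT (fun t => F (rowRV i t, v)) ->
    (\int[distribution P (rowRV i)]_x F (x, v) = \int[P]_t F (rowRV i t, v))%E.
  move=> mF iF.
  exact: (integral_pushforward (mrow i) (measurable_fun_pair1 v mF) iF measurableT).
rewrite (push F1)//; last first.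
  have := row_mul_integrable i (measurableT_comp mGv mrowT) (fun t => Gb _).
  by apply: eq_integrable => // t _; rewrite /F1 /back/= /Gv /= trmxK.
rewrite (push F2)//; last first.
  apply: (@le_integrable _ _ _ _ _ _ _ (cst (p%:R * C)%:E)) => //.
  - exact: (measurableT_comp (measurable_fun_pair1 v mF2) (mrow i)).
  - move=> t _; rewrite /= lee_fin (le_trans (ler_norm_sum _ _ _))//.
    apply: le_trans (ler_norm _).
    rewrite (le_trans (y := \sum_(k < p) C))//; first exact: ler_sum.
    by rewrite sumr_const card_ord mulr_natl.
  - exact: finite_measure_integrable_cst.
have := stein_normal (hrow i) hS mGv mdGv GvC.
under eq_integral do rewrite subr0 trmxK /Gv trmxK.
by move=> ->; apply: eq_integral => t _; rewrite /dGv trmxK.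
Qed.

End stein_row.

(** Entries are extended by 0 out of range, so that the leading minors of all
    sizes are given by one formula without type casts. *)
Definition entry0 (M : 'M[R]_(n, p)) (i j : nat) : R :=
  if insub i is Some i' then if insub j is Some j' then M i' j' else 0 else 0.

Definition corner k (M : 'M[R]_(n, p)) : 'M[R]_k := \matrix_(i, j) entry0 M i j.

Lemma entry0E M (i : 'I_n) (j : 'I_p) : entry0 M i j = M i j.
Proof. by rewrite /entry0 !valK. Qed.

Lemma measurable_corner k : measurable_fun setT (corner k).
Proof.
apply: measurable_to_mx => i j; under eq_fun do rewrite mxE.
rewrite /entry0; case: (insub (i : nat) : option 'I_n) => [i'|]; last exact: measurable_cst.
by case: (insub (j : nat) : option 'I_p) => [j'|]; [exact: measurable_entry|exact: measurable_cst].
Qed.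

Let measurable_corner_null k : measurable [set t | \det (corner k (Y t)) = 0].
Proof.
rewrite -[X in measurable X]setTI.
have mc : measurable_fun setT (fun t => corner k (Y t)).
  exact: (measurableT_comp (@measurable_corner k) mY).
exact: (measurable_det mc measurableT (measurable_set1 _)).
Qed.

(** Induction on the size.  The expansion along the last row is a linear form in
    that row of [Y], whose coefficients depend on the other rows only and include
    the previous minor: where the latter is nonzero, the row lies in a hyperplane
    drawn independently of it. *)
Lemma corner_det_null k : (k <= minn n p)%N ->
  P [set t | \det (corner k (Y t)) = 0] = 0%E.
Proof.
elim: k => [|k IH] kp.
  by rewrite (_ : [set _ | _] = set0) ?measure0//; apply/seteqP; split => t //=;
    rewrite det_mx00 => /eqP; rewrite oner_eq0.
have kn : (k < n)%N by rewrite (leq_trans kp)// geq_minl.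
have kp' : (k < p)%N by rewrite (leq_trans kp)// geq_minr.
pose a : 'I_n := Ordinal kn.
pose cof (M : 'M[R]_(n, p)) : 'cV[R]_p :=
  \col_l (if insub (l : nat) is Some j then cofactor (corner k.+1 M) ord_max j else 0).
have cofdel M : cof (del_row a M) = cof M.
  apply/colP => l; rewrite !mxE; case: insubP => // j _ _.
  rewrite /cofactor; congr (_ * \det _); apply/matrixP => i' j'; rewrite !mxE.
  rewrite /entry0; case: insubP => // i1 _ i1E; case: insubP => // j1 _ _.
  rewrite mxE -val_eqE/= i1E /= /bump leqNgt ltn_ord add0n.
  by rewrite (ltn_eqF (ltn_ord i')).
have detE M : \det (corner k.+1 M) = (row a M *m cof M) 0 0.
  pose c (j : nat) : R :=
    if insub j is Some j' then cofactor (corner k.+1 M) ord_max j' else 0.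
  rewrite (expand_det_row _ ord_max) mxE.
  transitivity (\sum_(j < k.+1) entry0 M k j * c j).
    by apply: eq_bigr => j _; rewrite /c valK mxE.
  rewrite (big_ord_widen p (fun j => entry0 M k j * c j) kp') big_mkcond/=.
  apply: eq_bigr => l _; rewrite !mxE -/(c l) -(entry0E M a l)/=.
  by case: ifPn => // lk; rewrite /c insubN// mulr0.
pose l0 := Ordinal kp'.
have cofk M : \det (corner k M) != 0 -> cof M l0 0 != 0.
  apply: contra; rewrite mxE /= -[k in insub k]/(nat_of_ord (ord_max : 'I_k.+1)) valK.
  rewrite /cofactor mulf_eq0 signr_eq0/= => /eqP <-.
  apply/eqP; congr (\det _); apply/matrixP => i j.
  by rewrite !mxE !lift_max.
have sub : [set t | \det (corner k.+1 (Y t)) = 0] `<=`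
    [set t | \det (corner k (Y t)) = 0] `|`
    [set t | cof (delRV a t) l0 0 != 0 /\ (rowRV a t *m cof (delRV a t)) 0 0 = 0].
  move=> t /=; rewrite detE => h; have [d0|d0] := eqVneq (\det (corner k (Y t))) 0; [by left|right].
  by rewrite cofdel; split => //; exact: cofk.
have mcof : measurable_fun setT cof.
  apply: measurable_to_mx => l l'; under eq_fun do rewrite mxE.
  case: (insub (l : nat) : option 'I_k.+1) => [j|]; last exact: measurable_cst.
  apply: measurable_funM => //; apply: measurable_det; apply: measurable_to_mx => i' j'.
  under eq_fun do rewrite !mxE.
  have := measurable_mx_entry (lift ord_max i') (lift j j') (@measurable_corner k.+1).
  by under eq_fun do rewrite mxE.
pose E := [set x : 'rV[R]_p * 'M[R]_(n, p) |
  cof x.2 l0 0 != 0 /\ (x.1 *m cof x.2) 0 0 = 0].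
have mE : measurable E.
  have m1 : measurable_fun setT (fun x : 'rV[R]_p * 'M[R]_(n, p) => cof x.2 l0 0).
    by apply: measurable_mx_entry; exact: (measurableT_comp mcof).
  have m2 : measurable_fun setT (fun x : 'rV[R]_p * 'M[R]_(n, p) => (x.1 *m cof x.2) 0 0).
    apply: measurable_mx_entry; apply: (measurable_mulmx (f := fst)) => //.
    exact: (measurableT_comp mcof).
  have -> : E = (fun x => cof x.2 l0 0) @^-1` (~` [set 0]) `&`
      (fun x => (x.1 *m cof x.2) 0 0) @^-1` [set 0].
    by apply/seteqP; split => x [/= /eqP h1 h2]; split => //=; apply/eqP.
  apply: measurableI; rewrite -[X in measurable X]setTI.
    exact: (m1 measurableT _ (measurableC (measurable_set1 _))).
  exact: (m2 measurableT _ (measurable_set1 _)).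
have E0 : P [set t | E (rowRV a t, delRV a t)] = 0%E.
  apply: null_pair => // v; have [v0|v0] := eqVneq (cof v l0 0) 0.
    rewrite (_ : [set _ | _] = set0) ?measure0//.
    by rewrite -subset0 => t [] /=; rewrite v0 eqxx.
  have v1 : cof v != 0 by apply: contraNneq v0 => ->; rewrite mxE.
  have [hrow _] := hY.
  rewrite -[RHS](normal_hyperplane_null (hrow a) hS v1); congr (P _).
  by apply/seteqP; split => t /=; rewrite /E /= trmxK ?v0 => // -[].
apply: measure_negligible; first exact: measurable_corner_null.
apply: (negligibleS sub); apply: negligibleU; apply/negligibleP => //.
- by apply: IH; exact: ltnW.
- rewrite -[X in measurable X]setTI.
  exact: (measurable_pairRV (rowRV a) (delRV a) measurableT mE).
Qed.

Lemma normal_matrix_full_rank :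
  {ae P, forall t, \rank (Y t) = minn n p}.
Proof.
set m := minn n p.
exists [set t | \det (corner m (Y t)) = 0]; split.
- exact: measurable_corner_null.
- exact: corner_det_null.
- move=> t /= rk; apply/eqP; apply: contra_notT rk => dm.
  have um : corner m (Y t) \in unitmx by rewrite unitmxE unitfE.
  apply/eqP; rewrite eqn_leq leq_min rank_leq_row rank_leq_col/=.
  have mn : (m <= n)%N by exact: geq_minl.
  have mp : (m <= p)%N by exact: geq_minr.
  rewrite -{1}(mxrank_unit um).
  have -> : corner m (Y t) =
      rowsub (widen_ord mn) 1%:M *m Y t *m colsub (widen_ord mp) 1%:M.
    rewrite -rowsubE mulmx_colsub mulmx1; apply/matrixP => i j; rewrite !mxE.
    by rewrite -(entry0E (Y t)).
  by rewrite (leq_trans (mxrankM_maxl _ _))// mxrankM_maxr.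
Qed.

End normal_matrix.

(** * Ridge regression of x on the rows of Y *)

Section dot.
Context {R : realType}.

Definition dot m (u v : 'cV[R]_m) : R := (u^T *m v) 0 0.

Lemma dotE m (u v : 'cV[R]_m) : dot u v = \sum_i u i 0 * v i 0.
Proof. by rewrite /dot mxE; apply: eq_bigr => i _; rewrite mxE. Qed.

Lemma dotC m (u v : 'cV[R]_m) : dot u v = dot v u.
Proof. by rewrite !dotE; apply: eq_bigr => i _; rewrite mulrC. Qed.

Lemma dotDl m (u v w : 'cV[R]_m) : dot (u + v) w = dot u w + dot v w.
Proof. by rewrite /dot linearD mulmxDl mxE. Qed.

Lemma dotDr m (u v w : 'cV[R]_m) : dot u (v + w) = dot u v + dot u w.
Proof. by rewrite /dot mulmxDr mxE. Qed.

Lemma dotZl m a (u v : 'cV[R]_m) : dot (a *: u) v = a * dot u v.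
Proof. by rewrite /dot linearZ -scalemxAl mxE. Qed.

Lemma dotZr m a (u v : 'cV[R]_m) : dot u (a *: v) = a * dot u v.
Proof. by rewrite dotC dotZl dotC. Qed.

Lemma dotBl m (u v w : 'cV[R]_m) : dot (u - v) w = dot u w - dot v w.
Proof. by rewrite -scaleN1r dotDl dotZl mulN1r. Qed.

Lemma dotBr m (u v w : 'cV[R]_m) : dot u (v - w) = dot u v - dot u w.
Proof. by rewrite dotC dotBl dotC (dotC w). Qed.

Lemma dotMl m k (A : 'M[R]_(k, m)) (u : 'cV[R]_m) (v : 'cV[R]_k) :
  dot (A *m u) v = dot u (A^T *m v).
Proof. by rewrite /dot trmx_mul mulmxA. Qed.

Lemma dot_ge0 m (u : 'cV[R]_m) : 0 <= dot u u.
Proof. by rewrite dotE sumr_ge0// => i _; rewrite -expr2 sqr_ge0. Qed.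

Lemma sqr_entry_le_dot m (u : 'cV[R]_m) i : u i 0 ^+ 2 <= dot u u.
Proof.
by rewrite dotE (bigD1 i)//= expr2 lerDl sumr_ge0// => k _; rewrite -expr2 sqr_ge0.
Qed.

Lemma normr_entry_le m (u : 'cV[R]_m) (a : R) i :
  0 <= a -> dot u u <= a ^+ 2 -> `|u i 0| <= a.
Proof.
move=> a0 ua; rewrite -(@ler_pXn2r _ 2) ?nnegrE// real_normK ?num_real//.
exact: le_trans (sqr_entry_le_dot _ _) ua.
Qed.

Lemma dot_eq0 m (u : 'cV[R]_m) : dot u u = 0 -> u = 0.
Proof.
move=> u0; apply/colP => i; rewrite mxE; apply/eqP.
have := sqr_entry_le_dot u i; rewrite u0 => h.
by rewrite -sqrf_eq0 eq_le h sqr_ge0.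
Qed.

Lemma dot_delta m j : dot (delta_mx j 0 : 'cV[R]_m) (delta_mx j 0) = 1.
Proof.
rewrite dotE (bigD1 j)//= !mxE !eqxx mulr1 big1 ?addr0// => i ij.
by rewrite !mxE (negbTE ij) mul0r.
Qed.

End dot.

Section ridge.
Context {R : realType} (n p : nat) (d : R) (d0 : 0 < d).
Implicit Types (Y : 'M[R]_(n, p)) (x : 'cV[R]_p).

Definition ridge Y : 'M[R]_n := Y *m Y^T + d%:M.
Definition resolvent Y : 'M[R]_n := invmx (ridge Y).

Lemma ridge_unit Y : ridge Y \in unitmx.
Proof.
rewrite -unitmx_tr -row_free_unit -kermx_eq0; apply/rowV0P => v /sub_kermxP vW.
have Wv : ridge Y *m v^T = 0 by rewrite -[LHS]trmxK trmx_mul trmxK vW trmx0.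
have : dot v^T (ridge Y *m v^T) = 0 by rewrite Wv /dot mulmx0 mxE.
rewrite mulmxDl mul_scalar_mx dotDr dotZr -mulmxA.
rewrite -{1}[Y]trmxK -dotMl => /eqP.
rewrite paddr_eq0 ?mulr_ge0 ?dot_ge0 1?ltW// => /andP[_].
rewrite mulf_eq0 gt_eqF//= => /eqP/dot_eq0 /(congr1 trmx).
by rewrite trmxK trmx0.
Qed.

Lemma ridge_resolvent Y : ridge Y *m resolvent Y = 1%:M.
Proof. exact/mulmxV/ridge_unit. Qed.

Lemma resolvent_ridge Y : resolvent Y *m ridge Y = 1%:M.
Proof. exact/mulVmx/ridge_unit. Qed.

Lemma resolvent_sym Y : (resolvent Y)^T = resolvent Y.
Proof. by rewrite /resolvent trmx_inv linearD/= trmx_mul trmxK tr_scalar_mx. Qed.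

Lemma gram_resolvent Y : Y *m Y^T *m resolvent Y = 1%:M - d *: resolvent Y.
Proof.
have := ridge_resolvent Y; rewrite mulmxDl mul_scalar_mx => <-.
by rewrite addrK.
Qed.

Lemma resolvent_gram Y : resolvent Y *m (Y *m Y^T) = 1%:M - d *: resolvent Y.
Proof.
have := resolvent_ridge Y; rewrite mulmxDr mul_mx_scalar => <-.
by rewrite addrK.
Qed.

(** With [v = Y Y^T q + d q], all the terms of the expanded square are
    nonnegative: each of them is bounded by [v^T v], whatever [Y] is.  The same
    holds for [fit_dot]. *)
Lemma resolvent_dot Y (v : 'cV[R]_n) : let q := resolvent Y *m v in
  dot v v = dot (Y *m Y^T *m q) (Y *m Y^T *m q) +
            2 * d * dot (Y^T *m q) (Y^T *m q) + d ^+ 2 * dot q q.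
Proof.
move=> q; have -> : v = Y *m Y^T *m q + d *: q.
  by rewrite -mul_scalar_mx -mulmxDl -/(ridge Y) mulmxA ridge_resolvent mul1mx.
have h : dot (Y *m Y^T *m q) q = dot (Y^T *m q) (Y^T *m q).
  by rewrite -mulmxA dotMl.
rewrite !(dotDl, dotDr, dotZl, dotZr) (dotC q) h; ring.
Qed.

(** [x] is approximated by the combination of the rows of [Y] with coefficients
    [coefs Y x], which minimises [|x - Y^T u|^2 + d |u|^2] over [u]. *)
Definition coefs Y x : 'cV[R]_n := resolvent Y *m Y *m x.
Definition fit Y x : 'cV[R]_p := Y^T *m coefs Y x.

Lemma normal_equation Y x : Y *m (x - fit Y x) = d *: coefs Y x.
Proof.
have : ridge Y *m coefs Y x = Y *m x.
  by rewrite /coefs -mulmxA mulmxA ridge_resolvent mul1mx.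
rewrite mulmxDl mul_scalar_mx -mulmxA -/(fit Y x) => E.
by rewrite mulmxBr -E addrC addKr.
Qed.

(** Pythagoras' identity, with the extra term due to the penalty. *)
Lemma fit_dot Y x :
  dot x x = dot (x - fit Y x) (x - fit Y x) + 2 * d * dot (coefs Y x) (coefs Y x)
            + dot (fit Y x) (fit Y x).
Proof.
set e := x - fit Y x; have xE : x = e + fit Y x by rewrite subrK.
have h : dot (fit Y x) e = d * dot (coefs Y x) (coefs Y x).
  by rewrite /fit dotMl trmxK normal_equation dotZr.
clearbody e; rewrite {1 2}xE !(dotDl, dotDr) (dotC e (fit _ _)) h; ring.
Qed.

Lemma fit_dot_le Y x : dot (fit Y x) (fit Y x) <= dot x x.
Proof.
by rewrite [leRHS](fit_dot Y) lerDr addr_ge0 ?mulr_ge0 ?dot_ge0// ltW.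
Qed.

Lemma coefs_dot_le Y x : 2 * d * dot (coefs Y x) (coefs Y x) <= dot x x.
Proof.
by rewrite [leRHS](fit_dot Y) -addrA addrCA lerDl addr_ge0 ?dot_ge0.
Qed.

Lemma residual_dot_le Y x : dot (x - fit Y x) (x - fit Y x) <= dot x x.
Proof.
rewrite [leRHS](fit_dot Y) -addrA lerDl addr_ge0 ?dot_ge0//.
by rewrite !mulr_ge0 ?dot_ge0// ltW.
Qed.

Lemma resolvent_dot_le Y (v : 'cV[R]_n) :
  d ^+ 2 * dot (resolvent Y *m v) (resolvent Y *m v) <= dot v v.
Proof.
rewrite [leRHS](resolvent_dot Y) lerDr addr_ge0 ?dot_ge0//.
by rewrite !mulr_ge0 ?dot_ge0// ltW.
Qed.

(** [edf] is the effective number of degrees of freedom, which tends to the rank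
    of [Y] as [d] vanishes; [energy_defect] is the amount by which [u^T (K Y Y^T) u] falls short
    of [u^T u], where [u] stands for [coefs Y x].  Both enter the divergences
    computed below. *)
Definition edf Y : R := \tr (resolvent Y *m (Y *m Y^T)).
Definition energy_defect Y x : R := d * dot (coefs Y x) (resolvent Y *m coefs Y x).

Lemma energy_defect_bounds Y x : 0 <= energy_defect Y x <= dot (coefs Y x) (coefs Y x).
Proof.
set u := coefs Y x; set q := resolvent Y *m u.
have uE : u = Y *m Y^T *m q + d *: q.
  by rewrite -mul_scalar_mx -mulmxDl -/(ridge Y) mulmxA ridge_resolvent mul1mx.
have h : dot (Y *m Y^T *m q) q = dot (Y^T *m q) (Y^T *m q).
  by rewrite -mulmxA dotMl.
have hs : energy_defect Y x = d * dot (Y^T *m q) (Y^T *m q) + d ^+ 2 * dot q q.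
  by rewrite /energy_defect -/u -/q {1}uE dotDl dotZl h; ring.
apply/andP; split.
  by rewrite hs addr_ge0// !mulr_ge0 ?dot_ge0 ?sqr_ge0// ltW.
rewrite hs [leRHS](resolvent_dot Y) -/q -subr_ge0.
have -> : forall a b c : R, a + 2 * d * b + d ^+ 2 * c - (d * b + d ^+ 2 * c) = a + d * b.
  by move=> a b c; ring.
by rewrite addr_ge0 ?mulr_ge0 ?dot_ge0// ltW.
Qed.

Lemma hat_entry_le Y i j : `|(Y^T *m resolvent Y *m Y) i j| <= 1.
Proof.
have -> : (Y^T *m resolvent Y *m Y) i j = fit Y (delta_mx j (0 : 'I_1)) i 0.
  by rewrite /fit /coefs !mulmxA -colE [RHS]mxE.
by apply: normr_entry_le => //; rewrite (le_trans (fit_dot_le _ _))// dot_delta expr1n.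
Qed.

Lemma edf_bounds Y : `|edf Y| <= p%:R.
Proof.
rewrite /edf mulmxA mxtrace_mulC (le_trans (ler_norm_sum _ _ _))//.
rewrite (le_trans (y := \sum_(j < p) 1))//.
  by apply: ler_sum => j _; rewrite mulmxA hat_entry_le.
by rewrite sumr_const card_ord.
Qed.

End ridge.

(** * Continuity and derivative of the ridge coefficients *)

Section resolvent_calculus.
Context {R : realType} (n p : nat) (d : R) (d0 : 0 < d).
Implicit Types (Y Z : 'M[R]_(n, p)) (x : 'cV[R]_p).

Lemma measurable_resolvent e (T : measurableType e) (f : T -> 'M[R]_(n, p)) :
  measurable_fun setT f -> measurable_fun setT (fun t => resolvent d (f t)).
Proof.
move=> mf; apply: measurable_invmx => [t|]; first exact: ridge_unit.
apply: measurable_addmx; last exact: measurable_cst.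
by apply: measurable_mulmx => //; exact: measurable_trmx.
Qed.

Lemma measurable_coefs e (T : measurableType e) (f : T -> 'M[R]_(n, p))
    (g : T -> 'cV[R]_p) : measurable_fun setT f -> measurable_fun setT g ->
  measurable_fun setT (fun t => coefs d (f t) (g t)).
Proof.
move=> mf mg; apply: measurable_mulmx => //; apply: measurable_mulmx => //.
exact: measurable_resolvent.
Qed.

Lemma measurable_fit e (T : measurableType e) (f : T -> 'M[R]_(n, p))
    (g : T -> 'cV[R]_p) : measurable_fun setT f -> measurable_fun setT g ->
  measurable_fun setT (fun t => fit d (f t) (g t)).
Proof.
move=> mf mg; apply: measurable_mulmx; first exact: measurable_trmx.
exact: measurable_coefs.
Qed.

Lemma bounded_resolvent : bounded_family (fun Y : 'M[R]_(n, p) => resolvent d Y).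
Proof.
exists d^-1 => Y i j; have -> : resolvent d Y i j = (resolvent d Y *m delta_mx j (0 : 'I_1)) i 0.
  by rewrite -colE mxE.
apply: normr_entry_le; first by rewrite invr_ge0 ltW.
have := resolvent_dot_le d0 Y (delta_mx j 0); rewrite dot_delta.
by rewrite exprVn -[_^-1]mul1r ler_pdivlMr ?exprn_gt0// mulrC.
Qed.

Lemma bounded_resolvent_mul : bounded_family (fun Y => resolvent d Y *m Y).
Proof.
exists (1 + (2 * d)^-1) => Y i j.
have -> : (resolvent d Y *m Y) i j = coefs d Y (delta_mx j 0) i 0.
  by rewrite /coefs -colE [RHS]mxE.
have d20 : 0 < 2 * d by rewrite mulr_gt0.
have c0 : 0 <= (2 * d)^-1 by rewrite invr_ge0 ltW.
apply: normr_entry_le; first by rewrite addr_ge0.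
have := coefs_dot_le d0 Y (delta_mx j 0); rewrite dot_delta mulrC -ler_pdivlMr//.
by move=> /le_trans; apply; rewrite mul1r; nra.
Qed.

Lemma bounded_hat : bounded_family (fun Y => Y^T *m resolvent d Y *m Y).
Proof. by exists 1 => Y i j; exact: hat_entry_le.
Qed.

Lemma resolventB Y Z : resolvent d Y - resolvent d Z =
  resolvent d Y *m (ridge d Z - ridge d Y) *m resolvent d Z.
Proof.
by rewrite mulmxBr mulmxBl resolvent_ridge// -mulmxA ridge_resolvent// mulmx1 mul1mx.
Qed.

Variables (Y E : 'M[R]_(n, p)).
Let line (s : R) := Y + s *: E.

Lemma line_cvg (t : R) : mx_cvg (nbhs t) line (line t).
Proof. exact: mx_is_derive_cvg (mx_is_derive_line _ _ _). Qed.

Lemma ridge_line_cvg (t : R) :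
  mx_cvg (nbhs t) (fun s => ridge d (line s)) (ridge d (line t)).
Proof.
apply: mx_cvgD; last exact: mx_cvg_cst.
by apply: mx_cvgM; [|apply: mx_cvg_tr]; exact: line_cvg.
Qed.

(** By [resolventB], as the resolvent is bounded uniformly in [Y]. *)
Lemma resolvent_line_cvg (t : R) :
  mx_cvg (nbhs t) (fun s => resolvent d (line s)) (resolvent d (line t)).
Proof.
have h : mx_cvg (nbhs t) (fun s => resolvent d (line s) *m
    (ridge d (line t) + (-1) *: ridge d (line s))) 0.
  apply: mx_cvg0_bounded.
    by have [C h] := bounded_resolvent; exists C => s; exact: h.
  rewrite -[X in mx_cvg _ _ X](subrr (ridge d (line t))) -[X in _ + X]scaleN1r.
  apply: mx_cvgD; first exact: mx_cvg_cst.
  by apply: mx_cvgZ; [exact: cvg_cst|exact: ridge_line_cvg].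
have -> : (fun s => resolvent d (line s)) = fun s => resolvent d (line s) *m
    (ridge d (line t) + (-1) *: ridge d (line s)) *m resolvent d (line t)
    + resolvent d (line t).
  by apply/funext => s; rewrite scaleN1r -resolventB subrK.
rewrite -[X in mx_cvg _ _ X]add0r.
rewrite -[X in mx_cvg _ _ (X + _)](mul0mx n (resolvent d (line t))).
apply: mx_cvgD; last exact: mx_cvg_cst.
by apply: mx_cvgM; [exact: h|exact: mx_cvg_cst].
Qed.

(** The difference quotient has the closed form
    [(u_s - u_t) / (s - t) = K_s (E (x - w_t) - Y_s E^T u_t)], the function [g] of
    the proof, so only its continuity is needed. *)
Lemma coefs_line_derive x (t : R) :
  mx_is_derive t (fun s => coefs d (line s) x)
    (resolvent d (line t) *m
      (E *m (x - fit d (line t) x) - line t *m (E^T *m coefs d (line t) x))).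
Proof.
pose u := coefs d (line t) x.
pose g s := resolvent d (line s) *m
  (E *m (x - fit d (line t) x) - line s *m (E^T *m u)).
have gE s : coefs d (line s) x - u = (s - t) *: g s.
  have uE : u = resolvent d (line s) *m (ridge d (line s) *m u).
    by rewrite mulmxA resolvent_ridge// mul1mx.
  rewrite {1}uE /coefs -mulmxA -mulmxBr /g scalemxAr; congr (_ *m _).
  have Wt : ridge d (line t) *m u = line t *m x.
    by rewrite /u /coefs -mulmxA mulmxA ridge_resolvent// mul1mx.
  have lsE : line s = line t + (s - t) *: E.
    by rewrite /line -addrA -scalerDl (addrC t) subrK.
  have duE : d *: u = line t *m x - line t *m ((line t)^T *m u).
    by rewrite -Wt mulmxDl mul_scalar_mx -mulmxA [in RHS]addrC addKr.
  have lsu : (line s)^T *m u = (line t)^T *m u + (s - t) *: (E^T *m u).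
    by rewrite lsE linearD linearZ mulmxDl scalemxAl.
  have LE : line s *m x - line s *m ((line t)^T *m u) =
      line t *m x - line t *m ((line t)^T *m u)
      + (s - t) *: (E *m (x - (line t)^T *m u)).
    by rewrite -!mulmxBr lsE mulmxDl scalemxAl.
  have assoc (V : zmodType) (a b c e : V) : a + b + c - (c + e + a) = b - e.
    apply/eqP; rewrite subr_eq (addrC c) !addrA subrK; apply/eqP.
    by rewrite -[LHS]addrA addrC.
  rewrite [ridge d (line s) *m u]mulmxDl mul_scalar_mx duE -[_ *m _^T *m u]mulmxA lsu mulmxDr -scalemxAr.
  by rewrite -[line s *m x](subrK (line s *m ((line t)^T *m u))) LE assoc scalerBr.
have cg : mx_cvg (nbhs t) g (g t).
  apply: mx_cvgM; first exact: resolvent_line_cvg.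
  apply: mx_cvgB; first exact: mx_cvg_cst.
  by apply: mx_cvgM; [exact: line_cvg|exact: mx_cvg_cst].
move=> i j; apply/is_derive1_caratheodory; exists (fun s => g s i j); split.
- move=> s; have := congr1 (fun M : 'M[R]__ => M i j) (gE s).
  by rewrite !mxE mulrC.
- exact: cg.
- by [].
Qed.

End resolvent_calculus.

(** * The field in x and its divergence *)

Section shrinkage.
Context {R : realType}.

(** The conditions make the fields and Jacobians below bounded at every fixed
    [d > 0], and the resulting divergences bounded uniformly in [d].  They only
    concern [s >= 0], where the energies take their values. *)
Record shrinkage (h h' : R -> R) (B : R) : Prop := {
  shrinkage_derive : forall s : R, 0 <= s -> is_derive s 1 h (h' s);
  shrinkage_continuous' : forall s : R, 0 <= s -> h' x @[x --> s] --> h' s;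
  shrinkage_ge0 : forall s : R, 0 <= s -> 0 <= h s;
  shrinkage_le : forall s : R, 0 <= s -> h s <= B;
  shrinkage_mul_le : forall s : R, 0 <= s -> h s * s <= B;
  shrinkage_sqr_le : forall s : R, 0 <= s -> h s ^+ 2 * s <= B;
  shrinkage_le' : forall s : R, 0 <= s -> `|h' s| <= B;
  shrinkage_mul_le' : forall s : R, 0 <= s -> `|h' s| * s <= B }.

Variables (h h' : R -> R) (B : R).
Hypothesis sh : shrinkage h h' B.

Lemma shrinkage_bound_ge0 : 0 <= B.
Proof. exact: le_trans (shrinkage_ge0 sh (lexx _)) (shrinkage_le sh (lexx _)). Qed.

Let continuous_shrinkage (s : R) : 0 <= s -> {for s, continuous h}.
Proof.
move=> s0; have hd := shrinkage_derive sh s0.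
by apply: differentiable_continuous; apply/derivable1_diffP; exact: ex_derive.
Qed.

Lemma measurable_comp_nonneg (f : R -> R) e (T : measurableType e) (g : T -> R) :
  (forall s, 0 <= s -> {for s, continuous f}) ->
  measurable_fun setT g -> (forall t, 0 <= g t) ->
  measurable_fun setT (fun t => f (g t)).
Proof.
move=> cf mg g0.
have mI : measurable (`[0, +oo[%classic : set R) by exact: measurable_itv.
apply: (measurable_comp mI (g := g)) => //.
  by move=> _ [t _ <-]; rewrite /= in_itv/= g0.
apply: subspace_continuous_measurable_fun => //.
by apply: continuous_in_subspaceT => s; rewrite inE/= in_itv/= andbT; exact: cf.
Qed.

Lemma measurable_shrinkage e (T : measurableType e) (g : T -> R) :
  measurable_fun setT g -> (forall t, 0 <= g t) ->
  measurable_fun setT (fun t => h (g t)).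
Proof. exact: measurable_comp_nonneg. Qed.

Lemma measurable_shrinkage' e (T : measurableType e) (g : T -> R) :
  measurable_fun setT g -> (forall t, 0 <= g t) ->
  measurable_fun setT (fun t => h' (g t)).
Proof. by apply: measurable_comp_nonneg => s s0; exact: (shrinkage_continuous' sh s0). Qed.

Lemma mx_is_derive_dot m (t : R) (f : R -> 'cV[R]_m) df :
  mx_is_derive t f df ->
  is_derive t 1 (fun s => dot (f s) (f s)) (2 * dot (f t) df).
Proof.
move=> hf; have := mx_is_deriveM (mx_is_derive_tr hf) hf 0 0.
rewrite mxE -/(dot df (f t)) -/(dot (f t) df) dotC => H.
by apply: (is_derive_eq H); ring.
Qed.

Lemma shrinkage_chain m (t : R) (f : R -> 'cV[R]_m) df :
  mx_is_derive t f df ->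
  is_derive t 1 (fun s => h (dot (f s) (f s)))
    (2 * h' (dot (f t) (f t)) * dot (f t) df).
Proof.
move=> hf; have hd := mx_is_derive_dot hf.
have hh := shrinkage_derive sh (dot_ge0 (f t)).
have H := @is_derive1_comp _ h (fun s => dot (f s) (f s)) t _ _ hh hd.
by apply: (is_derive_eq H); ring.
Qed.

Lemma mx_cvg_dot m (t : R) (f : R -> 'cV[R]_m) :
  mx_cvg (nbhs t) f (f t) ->
  dot (f s) (f s) @[s --> t] --> dot (f t) (f t).
Proof. by move=> hf; apply: (mx_cvgM (mx_cvg_tr hf) hf). Qed.

Lemma shrinkage_cvg m (t : R) (f : R -> 'cV[R]_m) :
  mx_cvg (nbhs t) f (f t) ->
  h (dot (f s) (f s)) @[s --> t] --> h (dot (f t) (f t)).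
Proof.
move=> hf; apply: (cvg_comp _ h (mx_cvg_dot hf)).
exact: (continuous_shrinkage (dot_ge0 (f t))).
Qed.

Lemma shrinkage_cvg' m (t : R) (f : R -> 'cV[R]_m) :
  mx_cvg (nbhs t) f (f t) ->
  h' (dot (f s) (f s)) @[s --> t] --> h' (dot (f t) (f t)).
Proof.
move=> hf; apply: (cvg_comp _ h' (mx_cvg_dot hf)).
exact: (shrinkage_continuous' sh (dot_ge0 (f t))).
Qed.

End shrinkage.

Section mean_field.
Context {R : realType} (n p : nat) (d : R) (d0 : 0 < d).
Variables (h h' : R -> R) (B : R) (sh : shrinkage h h' B).
Implicit Types (Y : 'M[R]_(n, p)) (x : 'cV[R]_p).

(** A regularisation of [x^T S^+ x], for [S = Y^T Y]. *)
Definition energy Y x : R := dot (coefs d Y x) (coefs d Y x).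

(** The correction [h(F) w] subtracted from [x]. *)
Definition mean_field Y x : 'cV[R]_p := Y^T *m (h (energy Y x) *: coefs d Y x).

(** The chain rule, [u] being linear in [x] with matrix [K Y]. *)
Definition mean_jacobian Y x : 'M[R]_p :=
  Y^T *m (h (energy Y x) *: (resolvent d Y *m Y)
    + (2 * h' (energy Y x)) *:
      (coefs d Y x *m (coefs d Y x)^T *m (resolvent d Y *m Y))).

Lemma coefs_line_right Y x v (s : R) :
  coefs d Y (x + s *: v) = coefs d Y x + s *: coefs d Y v.
Proof. by rewrite /coefs mulmxDr -scalemxAr. Qed.

Lemma bounded_shrunken_coefs Y : bounded_family (fun x => h (energy Y x) *: coefs d Y x).
Proof.
have B0 := shrinkage_bound_ge0 sh.
exists (1 + B) => x i j; rewrite ord1; apply: normr_entry_le; first by rewrite addr_ge0.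
rewrite dotZl dotZr mulrA -expr2 -/(energy Y x).
have := shrinkage_sqr_le sh (dot_ge0 (coefs d Y x)).
by move=> /le_trans; apply; nra.
Qed.

Lemma bounded_mean_field Y : bounded_family (mean_field Y).
Proof.
by apply: bounded_familyM; [exact: bounded_family_cst|exact: bounded_shrunken_coefs].
Qed.

Lemma bounded_mean_jacobian Y : bounded_family (mean_jacobian Y).
Proof.
apply: bounded_familyM; first exact: bounded_family_cst.
apply: bounded_familyD.
  apply: (bounded_familyZ (c := B)); last exact: bounded_family_cst.
  move=> x; rewrite ger0_norm; first exact: (shrinkage_le sh (dot_ge0 _)).
  exact: (shrinkage_ge0 sh (dot_ge0 _)).
under [X in bounded_family X]eq_fun do rewrite scalemxAl.
apply: bounded_familyM; last exact: bounded_family_cst.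
exists (2 * B) => x i j.
have uE : (coefs d Y x *m (coefs d Y x)^T) i j = coefs d Y x i 0 * coefs d Y x j 0.
  by rewrite mxE big_ord1 [_^T _ _]mxE.
rewrite mxE uE normrM normrM (ger0_norm (x := 2))// -mulrA.
rewrite ler_wpM2l// (le_trans _ (shrinkage_mul_le' sh (dot_ge0 (coefs d Y x))))//.
rewrite ler_wpM2l// normrM.
have := sqr_entry_le_dot (coefs d Y x) i; have := sqr_entry_le_dot (coefs d Y x) j.
rewrite -(real_normK (num_real (coefs d Y x i 0))) -(real_normK (num_real (coefs d Y x j 0))).
have := sqr_ge0 (`|coefs d Y x i 0| - `|coefs d Y x j 0|); nra.
Qed.

Lemma mean_field_C1 Y : exists C, bounded_C1_field id (mean_field Y) (mean_jacobian Y) C.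
Proof.
have [a Ga] := bounded_mean_field Y; have [b Jb] := bounded_mean_jacobian Y.
exists (Num.max a b); split; last 2 first.
- by move=> x i; rewrite le_max Ga.
- by move=> x i j; rewrite le_max Jb orbT.
move=> v i; split => [z t|z t].
- have hu : mx_is_derive t (fun s => coefs d Y (z + s *: v)) (coefs d Y v).
    under eq_fun do rewrite coefs_line_right; exact: mx_is_derive_line.
  have := mx_is_deriveM (mx_is_derive_cst t Y^T)
    (mx_is_deriveZ (shrinkage_chain sh hu) hu) i 0.
  rewrite mul0mx add0r => H; apply: (is_derive_eq H); congr (fun_of_matrix _ i 0).
  rewrite /mean_jacobian -mulmxA; congr (_ *m _).
  rewrite mulmxDl -!scalemxAl addrC -/(energy _ _); congr (_ + _).
  rewrite -scalerA; congr (_ *: _).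
  rewrite -(mulmxA _ _ v) -/(coefs d Y v) -mulmxA [_^T *m _]mx11_scalar.
  by rewrite mul_mx_scalar.
- have hu : mx_cvg (nbhs t) (fun s => coefs d Y (z + s *: v)) (coefs d Y (z + t *: v)).
    apply: (mx_is_derive_cvg (df := coefs d Y v)).
    under eq_fun do rewrite coefs_line_right; exact: mx_is_derive_line.
  rewrite /mean_jacobian /energy.
  have J : mx_cvg (nbhs t) (fun s => mean_jacobian Y (z + s *: v) *m v)
      (mean_jacobian Y (z + t *: v) *m v); last exact: J.
  apply: mx_cvgM; last exact: mx_cvg_cst.
  apply: mx_cvgM; first exact: mx_cvg_cst.
  apply: mx_cvgD; apply: mx_cvgZ; [|exact: mx_cvg_cst| |].
  + exact: (shrinkage_cvg sh hu).
  + by apply: cvgM; [exact: cvg_cst|exact: (shrinkage_cvg' sh hu)].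
  + apply: mx_cvgM; last exact: mx_cvg_cst.
    by apply: mx_cvgM; [exact: hu|apply: mx_cvg_tr; exact: hu].
Qed.

Lemma coefs_gram Y x : dot (coefs d Y x) (resolvent d Y *m (Y *m Y^T) *m coefs d Y x)
  = energy Y x - energy_defect d Y x.
Proof.
by rewrite resolvent_gram// mulmxBl mul1mx dotBr -scalemxAl dotZr.
Qed.

Lemma mean_jacobian_trace Y x : \tr (mean_jacobian Y x) =
  h (energy Y x) * edf d Y + 2 * h' (energy Y x) * (energy Y x - energy_defect d Y x).
Proof.
have E := coefs_gram Y x.
rewrite /mean_jacobian mxtrace_mulC mulmxDl mxtraceD -!scalemxAl !mxtraceZ -E /edf.
move: (coefs d Y x) => u; rewrite -(mulmxA _ Y); congr (_ + _ * _).
rewrite -(mulmxA (u *m u^T)) -(mulmxA u) mxtrace_mulC /mxtrace big_ord1 /dot.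
by rewrite !mulmxA.
Qed.

End mean_field.

(** * The fields in the rows of Y and their divergence *)

Section row_field.
Context {R : realType} (n p : nat) (d : R) (d0 : 0 < d).
Variables (h h' : R -> R) (B : R) (sh : shrinkage h h' B).
Variable (x : 'cV[R]_p).
Implicit Types (Y : 'M[R]_(n, p)).

Local Notation u := (fun Y => coefs d Y x).
Local Notation w := (fun Y => fit d Y x).
Local Notation F := (fun Y => energy d Y x).
Local Notation K := (resolvent d).

(** Since [w] is the sum of the [u_a y_a], the quadratic term [h^2 w^T Si w] is
    the sum over [a] of [y_a Si (row_field a)]. *)
Definition row_field (a : 'I_n) Y : 'cV[R]_p := (u Y a 0 * h (F Y) ^+ 2) *: w Y.

(** The derivative of [u] along the perturbation [e_a v^T] of [Y], as a linear map
    of [v]: this is [coefs_line_derive] for [E = e_a v^T]. *)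
Definition coefs_jacobian a Y : 'M[R]_(n, p) :=
  K Y *m delta_mx a (0 : 'I_1) *m (x - w Y)^T - u Y a 0 *: (K Y *m Y).

(** The derivative of [w = Y^T u] in row [a] without the term [u_a v] due to the
    factor [Y^T].  The factor [Y^T] is distributed so that each product of
    matrices that occurs is bounded in [Y]. *)
Definition fit_jacobian a Y : 'M[R]_p :=
  Y^T *m K Y *m delta_mx a (0 : 'I_1) *m (x - w Y)^T
  - u Y a 0 *: (Y^T *m K Y *m Y).

Lemma fit_jacobianE a Y : fit_jacobian a Y = Y^T *m coefs_jacobian a Y.
Proof. by rewrite mulmxBr -scalemxAr !mulmxA. Qed.

Definition row_jacobian a Y : 'M[R]_p :=
  h (F Y) ^+ 2 *: (w Y *m ((delta_mx a (0 : 'I_1))^T *m coefs_jacobian a Y))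
  + (u Y a 0 * (4 * h (F Y) * h' (F Y))) *: (w Y *m ((u Y)^T *m coefs_jacobian a Y))
  + (u Y a 0 ^+ 2 * h (F Y) ^+ 2) *: 1%:M
  + (u Y a 0 * h (F Y) ^+ 2) *: fit_jacobian a Y.

Lemma coefs_entry_le a Y : `|u Y a 0| <= 1 + dot x x / (2 * d).
Proof.
have d20 : 0 < 2 * d by rewrite mulr_gt0.
have x0 := dot_ge0 x.
have c0 : 0 <= dot x x / (2 * d) by rewrite divr_ge0// ltW.
apply: normr_entry_le; first by rewrite addr_ge0.
have := coefs_dot_le d0 Y x; rewrite mulrC -ler_pdivlMr//.
by move=> /le_trans; apply; nra.
Qed.

Lemma bounded_coefs : bounded_family u.
Proof. by exists (1 + dot x x / (2 * d)) => Y i j; rewrite ord1 coefs_entry_le. Qed.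

Lemma bounded_fit : bounded_family w.
Proof.
exists (1 + dot x x) => Y i j; rewrite ord1; have x0 := dot_ge0 x.
apply: normr_entry_le; first by rewrite addr_ge0.
by have := fit_dot_le d0 Y x => /le_trans; apply; nra.
Qed.

Lemma bounded_residual : bounded_family (fun Y => x - w Y).
Proof.
exists (1 + dot x x) => Y i j; rewrite ord1; have x0 := dot_ge0 x.
apply: normr_entry_le; first by rewrite addr_ge0.
by have := residual_dot_le d0 Y x => /le_trans; apply; nra.
Qed.

Lemma bounded_coefs_jacobian a : bounded_family (coefs_jacobian a).
Proof.
have hr := bounded_family_tr bounded_residual.
rewrite /coefs_jacobian; under [X in bounded_family X]eq_fun do rewrite -scaleNr.
apply: bounded_familyD.
  apply: bounded_familyM => //; apply: bounded_familyM; first exact: bounded_resolvent.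
  exact: bounded_family_cst.
apply: (bounded_familyZ (c := 1 + dot x x / (2 * d))).
  by move=> Y; rewrite normrN coefs_entry_le.
exact: bounded_resolvent_mul.
Qed.

Lemma bounded_fit_jacobian a : bounded_family (fit_jacobian a).
Proof.
have hr := bounded_family_tr bounded_residual.
rewrite /fit_jacobian; under [X in bounded_family X]eq_fun do rewrite -scaleNr.
apply: bounded_familyD.
  apply: bounded_familyM => //; apply: bounded_familyM; last exact: bounded_family_cst.
  have := bounded_family_tr (@bounded_resolvent_mul _ n p _ d0).
  by under eq_fun do rewrite trmx_mul resolvent_sym.
apply: (bounded_familyZ (c := 1 + dot x x / (2 * d))).
  by move=> Y; rewrite normrN coefs_entry_le.
exact: bounded_hat.
Qed.

Let hF_le Y : `|h (F Y) ^+ 2| <= B ^+ 2.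
Proof.
have h0 := shrinkage_ge0 sh (dot_ge0 (u Y)); have hB := shrinkage_le sh (dot_ge0 (u Y)).
by rewrite ger0_norm ?sqr_ge0// lerXn2r// nnegrE (le_trans h0).
Qed.

Let hh'F_le Y : `|4 * h (F Y) * h' (F Y)| <= 4 * B * B.
Proof.
have h0 := shrinkage_ge0 sh (dot_ge0 (u Y)); have hB := shrinkage_le sh (dot_ge0 (u Y)).
have h'B := shrinkage_le' sh (dot_ge0 (u Y)).
rewrite normrM ger0_norm ?mulr_ge0//.
by apply: ler_pM; rewrite ?mulr_ge0// ler_wpM2l.
Qed.

Lemma bounded_row_field a : bounded_family (row_field a).
Proof.
apply: (bounded_familyZ (c := (1 + dot x x / (2 * d)) * B ^+ 2)); last exact: bounded_fit.
by move=> Y; rewrite normrM ler_pM// coefs_entry_le.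
Qed.

Lemma bounded_row_jacobian a : bounded_family (row_jacobian a).
Proof.
have bc := coefs_entry_le a.
have bw := bounded_fit; have bU := bounded_coefs_jacobian a.
apply: bounded_familyD; last first.
  apply: (bounded_familyZ (c := (1 + dot x x / (2 * d)) * B ^+ 2)).
    by move=> Y; rewrite normrM ler_pM.
  exact: bounded_fit_jacobian.
apply: bounded_familyD; last first.
  apply: (bounded_familyZ (c := (1 + dot x x / (2 * d)) ^+ 2 * B ^+ 2)).
    move=> Y; rewrite normrM ler_pM// normrX lerXn2r// nnegrE//.
    exact: le_trans (bc Y).
  exact: bounded_family_cst.
apply: bounded_familyD.
  apply: (bounded_familyZ (c := B ^+ 2)) => //.
  apply: bounded_familyM => //; apply: bounded_familyM => //.
  exact: bounded_family_cst.
apply: (bounded_familyZ (c := (1 + dot x x / (2 * d)) * (4 * B * B))).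
  by move=> Y; rewrite normrM ler_pM.
apply: bounded_familyM => //; apply: bounded_familyM => //.
exact/bounded_family_tr/bounded_coefs.
Qed.

Lemma row_field_C1 a : exists C,
  bounded_C1_field (fun v => put_row a v^T) (row_field a) (row_jacobian a) C.
Proof.
have [b Gb] := bounded_row_field a; have [c Jc] := bounded_row_jacobian a.
exists (Num.max b c); split; last 2 first.
- by move=> Y i; rewrite le_max Gb.
- by move=> Y i j; rewrite le_max Jc orbT.
move=> v i.
pose E := put_row a v^T : 'M[R]_(n, p).
have EE : E = delta_mx a (0 : 'I_1) *m v^T.
  apply/matrixP => k l; rewrite !mxE big_ord1 !mxE eqxx andbT.
  by case: eqP; rewrite ?mul1r ?mul0r.
have Ez (z : 'cV[R]_p) : E *m z = delta_mx a (0 : 'I_1) *m (z^T *m v).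
  rewrite EE -mulmxA; congr (_ *m _).
  have -> : v^T *m z = (z^T *m v)^T by rewrite trmx_mul trmxK.
  by rewrite [z^T *m v]mx11_scalar tr_scalar_mx.
have Etu (z : 'cV[R]_n) : E^T *m z = z a 0 *: v.
  rewrite EE trmx_mul trmxK -mulmxA trmx_delta -rowE [row a z]mx11_scalar mxE.
  by rewrite mul_mx_scalar.
have hu Z t : mx_is_derive t (fun s => u (Z + s *: E)) (coefs_jacobian a (Z + t *: E) *m v).
  have := coefs_line_derive d0 Z E x t.
  set Yt := Z + t *: E.
  rewrite Ez// Etu mulmxBr -scalemxAr -scalemxAr mulmxBl -scalemxAl.
  by rewrite !mulmxA.
have hw Z t : mx_is_derive t (fun s => w (Z + s *: E))
    (u (Z + t *: E) a 0 *: v + fit_jacobian a (Z + t *: E) *m v).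
  rewrite fit_jacobianE -mulmxA -Etu.
  exact: mx_is_deriveM (mx_is_derive_tr (mx_is_derive_line t Z E)) (hu Z t).
split => [Z t|Z t].
- set Yt := Z + t *: E; pose du := coefs_jacobian a Yt *m v.
  have hFt := shrinkage_chain sh (hu Z t); rewrite -/Yt -/du in hFt.
  have hua := hu Z t a 0; rewrite -/Yt -/du in hua.
  have hs : is_derive t 1 (fun s => u (Z + s *: E) a 0 * h (F (Z + s *: E)) ^+ 2)
      (du a 0 * h (F Yt) ^+ 2 + u Yt a 0 * (4 * h (F Yt) * h' (F Yt)) * dot (u Yt) du).
    by apply: is_derive_eq; rewrite /GRing.scale/= -/(energy _ _ _) -/Yt; ring.
  have H := mx_is_deriveZ hs (hw Z t) i 0; rewrite -/Yt in H.
  apply: (is_derive_eq H); congr (fun_of_matrix _ i 0).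
  rewrite /row_jacobian !mulmxDl -!scalemxAl mul1mx scalerDl scalerDr scalerA.
  have -> : w Yt *m ((delta_mx a (0 : 'I_1))^T *m coefs_jacobian a Yt) *m v = du a 0 *: w Yt.
    rewrite -(mulmxA (w Yt)) -(mulmxA _^T _ v) -/du trmx_delta -rowE [row a du]mx11_scalar.
    by rewrite mul_mx_scalar [row a du 0 0]mxE.
  have -> : w Yt *m ((u Yt)^T *m coefs_jacobian a Yt) *m v = dot (u Yt) du *: w Yt.
    by rewrite -(mulmxA (w Yt)) -(mulmxA _^T _ v) -/du [_^T *m du]mx11_scalar mul_mx_scalar.
  rewrite !scalerA !addrA; congr ((_ : 'cV[R]_p) + _ + _ + _).
  + by congr (_ *: (_ : 'cV[R]_p)); ring.
  + by congr (_ *: (_ : 'cV[R]_p)); ring.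
  + by rewrite -mulmxDl.
- have cu : mx_cvg (nbhs t) (fun s => u (Z + s *: E)) (u (Z + t *: E)).
    exact: mx_is_derive_cvg (hu Z t).
  have cw : mx_cvg (nbhs t) (fun s => w (Z + s *: E)) (w (Z + t *: E)).
    exact: mx_is_derive_cvg (hw Z t).
  have cY : mx_cvg (nbhs t) (fun s => Z + s *: E) (Z + t *: E) by exact: line_cvg.
  have cK : mx_cvg (nbhs t) (fun s => K (Z + s *: E)) (K (Z + t *: E)).
    exact: resolvent_line_cvg.
  have ch : h (F (Z + s *: E)) @[s --> t] --> h (F (Z + t *: E)) := shrinkage_cvg sh cu.
  have ch' : h' (F (Z + s *: E)) @[s --> t] --> h' (F (Z + t *: E)) := shrinkage_cvg' sh cu.
  have ch2 : h (F (Z + s *: E)) ^+ 2 @[s --> t] --> h (F (Z + t *: E)) ^+ 2.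
    by apply: cvgM.
  have cU : mx_cvg (nbhs t) (fun s => coefs_jacobian a (Z + s *: E))
      (coefs_jacobian a (Z + t *: E)).
    apply: mx_cvgB.
      apply: mx_cvgM; first by apply: mx_cvgM => //; exact: mx_cvg_cst.
      by apply: mx_cvg_tr; apply: mx_cvgB => //; exact: mx_cvg_cst.
    by apply: mx_cvgZ; [exact: cu|exact: mx_cvgM].
  have cJ : mx_cvg (nbhs t) (fun s => row_jacobian a (Z + s *: E) *m v)
      (row_jacobian a (Z + t *: E) *m v); last exact: cJ.
  apply: mx_cvgM; last exact: mx_cvg_cst.
  have cua := cu a 0.
  apply: mx_cvgD; last first.
    apply: mx_cvgZ; first exact: cvgM.
    rewrite fit_jacobianE; under eq_fun do rewrite fit_jacobianE.
    by apply: mx_cvgM => //; exact: mx_cvg_tr.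
  apply: mx_cvgD; last first.
    by apply: mx_cvgZ; [apply: cvgM => //; exact: cvgM|exact: mx_cvg_cst].
  apply: mx_cvgD; apply: mx_cvgZ => //.
  + by apply: mx_cvgM => //; apply: mx_cvgM => //; exact: mx_cvg_cst.
  + by apply: cvgM => //; apply: cvgM => //; apply: cvgM => //; exact: cvg_cst.
  + by apply: mx_cvgM => //; apply: mx_cvgM => //; exact: mx_cvg_tr.
Qed.

Lemma residual_fit_dot Y : dot (x - w Y) (w Y) = d * F Y.
Proof. by rewrite dotC /fit dotMl trmxK normal_equation// dotZr. Qed.

Lemma coefs_jacobian_fit a Y : coefs_jacobian a Y *m w Y =
  (d * F Y) *: (K Y *m delta_mx a (0 : 'I_1))
  - u Y a 0 *: (u Y - d *: (K Y *m u Y)).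
Proof.
rewrite mulmxBl -scalemxAl; congr (_ - _ *: _).
  rewrite -(mulmxA _ _ (w Y)) [_^T *m _]mx11_scalar -/(dot _ _) residual_fit_dot.
  by rewrite mul_mx_scalar.
rewrite /fit (mulmxA _ Y^T) -(mulmxA (K Y) Y) resolvent_gram// mulmxBl mul1mx.
by rewrite -scalemxAl.
Qed.

Lemma mxtrace_col_mul (b c : 'cV[R]_p) : \tr (b *m c^T) = dot c b.
Proof. by rewrite mxtrace_mulC /mxtrace big_ord1. Qed.

Lemma row_jacobian_trace a Y : \tr (row_jacobian a Y) =
  h (F Y) ^+ 2 * (d * F Y * K Y a a - u Y a 0 * (u Y a 0 - d * (K Y *m u Y) a 0))
  + u Y a 0 * (4 * h (F Y) * h' (F Y)) *
    (d * F Y * (K Y *m u Y) a 0 - u Y a 0 * (F Y - energy_defect d Y x))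
  + u Y a 0 ^+ 2 * h (F Y) ^+ 2 * p%:R
  + u Y a 0 * h (F Y) ^+ 2 * (d * (K Y *m u Y) a 0 - u Y a 0 * edf d Y).
Proof.
have Kd (v : 'cV[R]_n) : dot v (K Y *m delta_mx a (0 : 'I_1)) = (K Y *m v) a 0.
  rewrite dotC dotMl resolvent_sym /dot trmx_delta -rowE [LHS]mxE; done.
rewrite /row_jacobian !mxtraceD !mxtraceZ mxtrace1.
congr (_ * _ + _ * _ + _ + _ * _).
- rewrite mxtrace_mulC -mulmxA coefs_jacobian_fit trmx_delta -rowE.
  have ent (c1 c2 : R) (b c e : 'cV[R]_n) :
      (c1 *: b - c2 *: (c - d *: e)) a 0 = c1 * b a 0 - c2 * (c a 0 - d * e a 0).
    by rewrite !mxE.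
  rewrite /mxtrace big_ord1 [LHS]mxE ent; congr (_ * _ - _).
  by rewrite -colE [LHS]mxE.
- rewrite mxtrace_mulC -mulmxA coefs_jacobian_fit /mxtrace big_ord1 -/(dot _ _).
  by rewrite dotBr !dotZr dotBr dotZr Kd.
- rewrite /fit_jacobian raddfB/= mxtraceZ; congr (_ - _ * _).
    by rewrite mxtrace_col_mul -mulmxA -dotMl normal_equation// dotZl Kd.
  by rewrite /edf -mulmxA mxtrace_mulC !mulmxA.
Qed.

(** The sums over [a] of [d K_aa], [u_a^2] and [d u_a (K u)_a] are
    [n - tau], [F] and [kappa]. *)
Lemma row_jacobian_trace_sum Y : \sum_a \tr (row_jacobian a Y) =
  h (F Y) ^+ 2 * (F Y * (p%:R + n%:R - 1 - 2 * edf d Y) + 2 * energy_defect d Y x)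
  + 4 * h (F Y) * h' (F Y) * F Y * (2 * energy_defect d Y x - F Y).
Proof.
have trK : d * \sum_a K Y a a = n%:R - edf d Y.
  rewrite /edf resolvent_gram// raddfB/= mxtrace1 mxtraceZ.
  by rewrite opprB addrC subrK.
have sF : \sum_a u Y a 0 ^+ 2 = F Y.
  by rewrite /energy dotE; apply: eq_bigr => a _; rewrite expr2.
have sk : d * \sum_a u Y a 0 * (K Y *m u Y) a 0 = energy_defect d Y x.
  by rewrite /energy_defect dotE.
under eq_bigr do rewrite row_jacobian_trace.
transitivity (\sum_a (h (F Y) ^+ 2 * F Y * d * K Y a a
   + (h (F Y) ^+ 2 * 2 * d + 4 * h (F Y) * h' (F Y) * d * F Y) * (u Y a 0 * (K Y *m u Y) a 0)
   + (h (F Y) ^+ 2 * (p%:R - 1 - edf d Y) - 4 * h (F Y) * h' (F Y) * (F Y - energy_defect d Y x))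
       * u Y a 0 ^+ 2)).
  by apply: eq_bigr => a _; ring.
rewrite !big_split/= -!mulr_sumr sF.
move: trK sk; set SK := \sum_a K Y a a; set SU := \sum_a _ * _ => trK sk.
transitivity (h (F Y) ^+ 2 * F Y * (d * SK)
   + (h (F Y) ^+ 2 * 2 + 4 * h (F Y) * h' (F Y) * F Y) * (d * SU)
   + (h (F Y) ^+ 2 * (p%:R - 1 - edf d Y) - 4 * h (F Y) * h' (F Y) * (F Y - energy_defect d Y x))
       * F Y); first by ring.
by rewrite trK sk; ring.
Qed.

End row_field.

(** * Vanishing ridge penalty and the Moore-Penrose inverse *)

Section pinv_limit.
Context {R : realType} (n p : nat).

Definition vanishing (k : nat) : R := k.+1%:R^-1.

Lemma vanishing_gt0 k : 0 < vanishing k.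
Proof. by rewrite invr_gt0. Qed.

Lemma vanishing_cvg : vanishing k @[k --> \oo] --> (0 : R).
Proof. exact: cvg_harmonic. Qed.

Variable Y : 'M[R]_(n, p).
Let K k := resolvent (vanishing k) Y.
Let V := mpinv Y.
Let N := V *m V^T.

Let YVY : Y *m V *m Y = Y. Proof. by have [] := mpinvP Y. Qed.
Let VYV : V *m Y *m V = V. Proof. by have [] := mpinvP Y. Qed.
Let YVsym : (Y *m V)^T = Y *m V. Proof. by have [] := mpinvP Y. Qed.
Let VYsym : (V *m Y)^T = V *m Y. Proof. by have [] := mpinvP Y. Qed.

Let YtYV : Y^T *m (Y *m V) = Y^T.
Proof. by rewrite -YVsym -trmx_mul YVY. Qed.

Let gramN : Y^T *m Y *m N = V *m Y.
Proof. by rewrite /N mulmxA -(mulmxA Y^T) YtYV -trmx_mul VYsym. Qed.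

Let Ngram : N *m (Y^T *m Y) = V *m Y.
Proof. by rewrite /N mulmxA -(mulmxA V) -trmx_mul YVsym mulmxA VYV. Qed.

Lemma mpinv_gram : mpinv (Y^T *m Y) = V *m V^T.
Proof.
apply: penrose_uniq (mpinvP _) _; rewrite -/N; split; rewrite ?gramN ?Ngram//.
- by rewrite -VYsym mulmxA -trmx_mul mulmxA YVY.
- by rewrite /N mulmxA VYV.
Qed.

Lemma gram_mpinv_gram : Y^T *m Y *m mpinv (Y^T *m Y) = V *m Y.
Proof. by rewrite mpinv_gram gramN. Qed.

(** [Y^T K Y (Y^T Y) = Y^T Y - d Y^T K Y]; multiplying by the pseudo-inverse [N]
    of [Y^T Y] gives [Y^T K Y = V Y - d Y^T K Y N], and the entries of [Y^T K Y]
    are at most 1 in absolute value. *)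
Lemma hat_cvg : mx_cvg \oo (fun k => Y^T *m K k *m Y) (V *m Y).
Proof.
have -> : (fun k => Y^T *m K k *m Y) =
    fun k => V *m Y - Y^T *m K k *m Y *m (vanishing k *: N).
  apply/funext => k.
  have HS : Y^T *m K k *m Y *m (Y^T *m Y) = Y^T *m Y - vanishing k *: (Y^T *m K k *m Y).
    rewrite -(mulmxA (Y^T *m K k)) (mulmxA Y) (mulmxA _ _ Y) -(mulmxA Y^T).
    rewrite resolvent_gram ?vanishing_gt0// mulmxBr mulmx1 mulmxBl.
    by rewrite -scalemxAr -scalemxAl.
  have HE : Y^T *m K k *m Y = Y^T *m K k *m Y *m (Y^T *m Y) *m N.
    rewrite -(mulmxA _ (Y^T *m Y)) gramN -(mulmxA (Y^T *m K k)) (mulmxA Y).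
    by rewrite YVY.
  by rewrite {1}HE HS mulmxBl gramN -scalemxAl scalemxAr.
rewrite -[X in mx_cvg _ _ X]subr0; apply: mx_cvgB; first exact: mx_cvg_cst.
apply: mx_cvg0_bounded.
  by exists 1 => k i j; exact: hat_entry_le (vanishing_gt0 k) _ _ _.
rewrite -(scale0r N); apply: mx_cvgZ; last exact: mx_cvg_cst.
exact: vanishing_cvg.
Qed.

(** [Y^T K = Y^T K Y V], because [K] is [1/d] times the identity on the range of
    [1 - Y V], which [Y^T] kills. *)
Lemma tikhonov_cvg : mx_cvg \oo (fun k => Y^T *m K k) V.
Proof.
have -> : (fun k => Y^T *m K k) = fun k => Y^T *m K k *m Y *m V.
  apply/funext => k.
  have N0 : Y^T *m (1%:M - Y *m V) = 0 by rewrite mulmxBr mulmx1 YtYV subrr.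
  have rM : ridge (vanishing k) Y *m (1%:M - Y *m V) = vanishing k *: (1%:M - Y *m V).
    by rewrite [LHS]mulmxDl -(mulmxA Y Y^T) N0 mulmx0 add0r mul_scalar_mx.
  have KN : vanishing k *: (K k *m (1%:M - Y *m V)) = 1%:M - Y *m V.
    by rewrite scalemxAr -rM mulmxA resolvent_ridge ?vanishing_gt0// mul1mx.
  have : Y^T *m K k *m (1%:M - Y *m V) = 0.
    apply/eqP; rewrite -(inj_eq (scalerI (lt0r_neq0 (vanishing_gt0 k)))) scaler0.
    by rewrite -mulmxA scalemxAr KN N0.
  by rewrite mulmxBr mulmx1 => /eqP; rewrite subr_eq0 => /eqP E; rewrite [LHS]E mulmxA.
rewrite -[X in mx_cvg _ _ X]VYV.
by apply: mx_cvgM; [exact: hat_cvg|exact: mx_cvg_cst].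
Qed.

Lemma resolvent_mul_cvg : mx_cvg \oo (fun k => K k *m Y) V^T.
Proof.
have := mx_cvg_tr tikhonov_cvg; congr mx_cvg.
by apply/funext => k; rewrite trmx_mul trmxK resolvent_sym.
Qed.

Variable x : 'cV[R]_p.

Lemma coefs_cvg : mx_cvg \oo (fun k => coefs (vanishing k) Y x) (V^T *m x).
Proof. by apply: mx_cvgM; [exact: resolvent_mul_cvg|exact: mx_cvg_cst]. Qed.

Lemma fit_cvg :
  mx_cvg \oo (fun k => fit (vanishing k) Y x) (Y^T *m Y *m mpinv (Y^T *m Y) *m x).
Proof.
rewrite gram_mpinv_gram -VYsym trmx_mul -mulmxA.
by apply: mx_cvgM; [exact: mx_cvg_cst|exact: coefs_cvg].
Qed.

Lemma energy_cvg :
  energy (vanishing k) Y x @[k --> \oo] --> qform (mpinv (Y^T *m Y)) x.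
Proof.
rewrite mpinv_gram /qform mulmxA -mulmxA -[x^T *m V]trmxK trmx_mul trmxK.
exact: (mx_cvgM (mx_cvg_tr coefs_cvg) coefs_cvg).
Qed.

(** It has a factor [d], and [K u] converges, as [u] lies in the range of [Y]. *)
Lemma energy_defect_cvg : energy_defect (vanishing k) Y x @[k --> \oo] --> (0 : R).
Proof.
have cKu : mx_cvg \oo (fun k => K k *m coefs (vanishing k) Y x)
    (V^T *m (V *m Y) *m N *m x).
  have -> : (fun k => K k *m coefs (vanishing k) Y x) =
      fun k => K k *m Y *m (Y^T *m K k *m Y) *m N *m x.
    apply/funext => k; rewrite /coefs -/(K k) mulmxA; congr (_ *m _).
    rewrite -[LHS]/(K k *m (K k *m Y)) -(mulmxA (K k)) -(mulmxA (K k)).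
    congr (_ *m _); rewrite -{1}YVY -(mulmxA Y) -gramN !mulmxA.
    rewrite -(mulmxA (K k)) resolvent_gram ?vanishing_gt0//.
    by rewrite gram_resolvent ?vanishing_gt0.
  do 2 (apply: mx_cvgM; last exact: mx_cvg_cst).
  by apply: mx_cvgM; [exact: resolvent_mul_cvg|exact: hat_cvg].
rewrite -(mul0r (((V^T *m x)^T *m (V^T *m (V *m Y) *m N *m x)) 0 0)).
apply: cvgM; first exact: vanishing_cvg.
exact: (mx_cvgM (mx_cvg_tr coefs_cvg) cKu).
Qed.

(** The limit is the trace of [V Y]; at full rank, [Y V] or [V Y] is the
    identity. *)
Lemma edf_cvg : \rank Y = minn n p ->
  edf (vanishing k) Y @[k --> \oo] --> ((minn n p)%:R : R).
Proof.
move=> rY; have -> : (minn n p)%:R = \tr (V *m Y).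
  have [np|pn] := leqP n p.
    have fY : row_free Y by rewrite /row_free rY; apply/eqP/minn_idPl.
    have YV1 : Y *m V = 1%:M.
      by apply: (row_free_inj fY); rewrite YVY mul1mx.
    by rewrite mxtrace_mulC YV1 mxtrace1; congr _%:R; apply/minn_idPl.
  have fY : row_full Y by rewrite /row_full rY; apply/eqP/minn_idPr/ltnW.
  have VY1 : V *m Y = 1%:M.
    by apply: (row_full_inj fY); rewrite mulmxA YVY mulmx1.
  by rewrite VY1 mxtrace1; congr _%:R; apply/minn_idPr/ltnW.
have -> : (fun k => edf (vanishing k) Y) = fun k => \tr (Y^T *m K k *m Y).
  by apply/funext => k; rewrite /edf mulmxA mxtrace_mulC mulmxA.
apply: cvg_mxtrace; exact: hat_cvg.
Qed.

End pinv_limit.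

(** As the pointwise limit in [tikhonov_cvg]. *)
Lemma measurable_mpinv (R : realType) e (T : measurableType e) n p
    (f : T -> 'M[R]_(n, p)) :
  measurable_fun setT f -> measurable_fun setT (fun t => mpinv (f t)).
Proof.
move=> mf; apply: measurable_to_mx => i j.
apply: (@measurable_fun_cvg _ _ _ _
  (fun k t => ((f t)^T *m resolvent (vanishing k) (f t)) i j)).
  move=> k; apply/measurable_mx_entry/measurable_mulmx; first exact: measurable_trmx.
  by apply: measurable_resolvent => //; exact: vanishing_gt0.
by move=> t _; exact: tikhonov_cvg.
Qed.

(** * Smoothing of the shrinkage function *)

Section mollify.
Context {R : realType} (r : R -> R) (c : R).
Hypothesis cr : continuous r.
Hypothesis rc : forall x, 0 <= r x <= c.
Hypothesis r_nd : {homo r : x y / x <= y}.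
Variable e : R.
Hypothesis e0 : 0 < e.

(* the lower bound -1 makes every s >= 0 interior to the domain of integration *)
Let prim (x : R) : R := (\int[lebesgue_measure]_(t in `[(-1)%R, x]) r t)%R.

Let prim_derive (x : R) : -1 < x -> is_derive x 1 prim (r x).
Proof.
move=> x1; have xx : x < x + 1 by rewrite ltrDl.
have ir : lebesgue_measure.-integrable `[(-1)%R, (x + 1)%R] (EFin \o r).
  apply: continuous_compact_integrable; first exact: segment_compact.
  exact: continuous_subspaceT.
have [h1 h2] := continuous_FTC1_closed xx ir x1 (@cr x).
by apply: DeriveDef; [exact: h1|rewrite -derive1E; exact: h2].
Qed.

(** The mean of [r] over [[x, x + e]]: continuously differentiable because [r] is
    continuous, and still nondecreasing with values in [[0, c]]. *)
Definition mollify (x : R) : R := (prim (x + e) - prim x) / e.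
Definition mollify' (x : R) : R := (r (x + e) - r x) / e.

Lemma mollify_derive (x : R) : 0 <= x -> is_derive x 1 mollify (mollify' x).
Proof.
move=> x0.
have h1 : is_derive x 1 prim (r x) by apply: prim_derive; rewrite (lt_le_trans _ x0).
have h2 : is_derive (x + e) 1 prim (r (x + e)).
  by apply: prim_derive; rewrite (lt_le_trans _ (addr_ge0 x0 (ltW e0))).
have h3 : is_derive x 1 (fun y : R => prim (y + e)) (r (x + e)).
  have := @is_derive1_comp _ prim (fun y => y + e) x _ 1 h2.
  rewrite mulr1; apply; apply: is_derive_eq; ring.
by apply: is_derive_eq; rewrite /GRing.scale/= /mollify'; ring.
Qed.

Lemma mollify_between (x : R) : 0 <= x -> r x <= mollify x <= r (x + e).
Proof.
move=> x0; have xe : x < x + e by rewrite ltrDl.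
have hd z : x <= z -> is_derive z 1 prim (r z).
  by move=> xz; apply: prim_derive; rewrite (lt_le_trans _ (le_trans x0 xz)).
have [z||z] := @MVT _ prim r x (x + e) xe.
- by rewrite in_itv/= => /andP[/ltW xz _]; exact: hd.
- apply: derivable_within_continuous => z; rewrite in_itv/= => /andP[xz _].
  by have [] := hd _ xz.
- rewrite in_itv/= => /andP[/ltW xz /ltW ze] E.
  have -> : mollify x = r z by rewrite /mollify E addrAC subrr add0r mulfK// gt_eqF.
  by rewrite !r_nd.
Qed.

Lemma mollify_bounds (x : R) : 0 <= x -> 0 <= mollify x <= c.
Proof.
move=> x0; have /andP[h1 h2] := mollify_between x0.
have /andP[r0 _] := rc x; have /andP[_ rC] := rc (x + e).
by rewrite (le_trans r0 h1) (le_trans h2 rC).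
Qed.

Lemma mollify'_ge0 (x : R) : 0 <= mollify' x.
Proof. by rewrite divr_ge0 ?(ltW e0)// subr_ge0 r_nd// lerDl ltW. Qed.

Lemma mollify'_le (x : R) : mollify' x <= c / e.
Proof.
have /andP[r0 _] := rc x; have /andP[_ rC] := rc (x + e).
by rewrite ler_pM2r ?invr_gt0//; lra.
Qed.

Lemma continuous_mollify' : continuous mollify'.
Proof.
move=> x; apply: cvgM; last exact: cvg_cst.
apply: cvgB; last exact: cr.
apply: (@continuous_comp _ _ _ (fun y => y + e) r); last exact: cr.
by apply: cvgD; [exact: cvg_id|exact: cvg_cst].
Qed.

(** A smooth substitute for [r(s) / s], without its singularity at [0]. *)
Definition shrinker (s : R) : R := mollify s / (s + e).
Definition shrinker' (s : R) : R :=
  mollify' s / (s + e) - mollify s / (s + e) ^+ 2.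

Lemma shrinker_shrinkage : exists B, shrinkage shrinker shrinker' B.
Proof.
have ei0 : 0 < e^-1 by rewrite invr_gt0.
have c0 : 0 <= c by have /andP[] := rc 0; exact: le_trans.
pose B := c + c / e + c ^+ 2 / e + 2 * c / e ^+ 2 + 2 * c / e; exists B.
have p1 : 0 <= c / e by rewrite divr_ge0 ?(ltW e0).
have p2 : 0 <= c ^+ 2 / e by rewrite divr_ge0 ?sqr_ge0 ?(ltW e0).
have p3 : 0 <= 2 * c / e ^+ 2 by rewrite divr_ge0 ?sqr_ge0// mulr_ge0.
have p4 : 0 <= 2 * c / e by rewrite divr_ge0 ?mulr_ge0 ?(ltW e0).
have se (s : R) : 0 <= s -> 0 < s + e by move=> s0; rewrite ltr_wpDl.
have inv (s : R) : 0 <= s -> 0 <= (s + e)^-1 <= e^-1.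
  by move=> s0; rewrite invr_ge0 ltW ?se//= lef_pV2 ?posrE ?se// lerDr.
have sinv (s : R) : 0 <= s -> 0 <= s / (s + e) <= 1.
  move=> s0; rewrite divr_ge0 ?(ltW (se _ s0))//= ler_pdivrMr ?se// mul1r lerDl; exact: ltW.
split.
- move=> s s0; have se0 := se s s0; have hm := mollify_derive s0.
  have hi : is_derive s 1 (fun y : R => (y + e)^-1) (- (s + e) ^- 2).
    have sn : s + e != 0 by rewrite gt_eqF.
    have hd : is_derive s 1 (fun y : R => y + e) 1 by apply: is_derive_eq; rewrite addr0.
    have H := @is_deriveV _ (fun y : R => y + e) s 1 1 sn hd.
    by apply: (is_derive_eq H); rewrite /GRing.scale/= mulr1.
  by apply: is_derive_eq; rewrite /GRing.scale/= /shrinker'; ring.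
- move=> s s0; have se0 := se s s0; have hm := mollify_derive s0.
  have cm : {for s, continuous mollify}.
    by apply: differentiable_continuous; apply/derivable1_diffP; exact: ex_derive.
  have ci : y + e @[y --> s] --> s + e by apply: cvgD; [exact: cvg_id|exact: cvg_cst].
  apply: cvgB; apply: cvgM.
  + exact: continuous_mollify'.
  + by apply: cvgV => //; rewrite gt_eqF.
  + exact: cm.
  + by apply: cvgV; [rewrite expf_neq0// gt_eqF|apply: cvgM].
- move=> s s0; have /andP[m0 _] := mollify_bounds s0; have /andP[i0 _] := inv s s0.
  exact: mulr_ge0.
- move=> s s0; have /andP[m0 mc] := mollify_bounds s0; have /andP[i0 ie] := inv s s0.
  have : shrinker s <= c / e by exact: ler_pM.
  by rewrite /B; lra.
- move=> s s0; have /andP[m0 mc] := mollify_bounds s0.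
  have /andP[v0 v1] := sinv s s0.
  have : shrinker s * s <= c.
    have -> : shrinker s * s = mollify s * (s / (s + e)) by rewrite /shrinker; ring.
    by rewrite -[leRHS]mulr1; apply: ler_pM.
  by rewrite /B; lra.
- move=> s s0; have /andP[m0 mc] := mollify_bounds s0; have /andP[i0 ie] := inv s s0.
  have /andP[v0 v1] := sinv s s0.
  have : shrinker s ^+ 2 * s <= c ^+ 2 / e.
    rewrite /shrinker exprMn -mulrA; apply: ler_pM; rewrite ?sqr_ge0 ?mulr_ge0 ?sqr_ge0//.
      by rewrite lerXn2r ?nnegrE.
    by rewrite expr2 -mulrA -[leRHS]mulr1 ler_pM ?mulr_ge0// mulrC.
  by rewrite /B; lra.
- move=> s s0; have /andP[m0 mc] := mollify_bounds s0; have /andP[i0 ie] := inv s s0.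
  have m'0 := mollify'_ge0 s; have m'c := mollify'_le s.
  have q1 : mollify' s / (s + e) <= c / e ^+ 2.
    by rewrite expr2 invfM mulrA; apply: ler_pM.
  have q2 : mollify s / (s + e) ^+ 2 <= c / e ^+ 2.
    by apply: ler_pM; rewrite ?invr_ge0 ?sqr_ge0// -!exprVn lerXn2r ?nnegrE// ltW.
  have q3 : 0 <= mollify' s / (s + e) by rewrite mulr_ge0.
  have q4 : 0 <= mollify s / (s + e) ^+ 2 by rewrite mulr_ge0 ?invr_ge0 ?sqr_ge0.
  rewrite /shrinker' ler_norml /B; apply/andP; split; lra.
- move=> s s0; have /andP[m0 mc] := mollify_bounds s0; have /andP[i0 ie] := inv s s0.
  have m'0 := mollify'_ge0 s; have m'c := mollify'_le s.
  have /andP[v0 v1] := sinv s s0.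
  have q1 : mollify' s * (s / (s + e)) <= c / e.
    by rewrite -[leRHS]mulr1; apply: ler_pM.
  have q2 : mollify s * (s + e)^-1 * (s / (s + e)) <= c / e.
    have q : mollify s * (s + e)^-1 <= c / e by apply: ler_pM.
    by rewrite -[leRHS]mulr1; apply: ler_pM => //; exact: mulr_ge0.
  have q3 : 0 <= mollify' s * (s / (s + e)) by rewrite mulr_ge0.
  have q4 : 0 <= mollify s * (s + e)^-1 * (s / (s + e)).
    by apply: mulr_ge0 => //; exact: mulr_ge0.
  rewrite -[X in _ * X](ger0_norm s0) -normrM.
  have -> : shrinker' s * s =
      mollify' s * (s / (s + e)) - mollify s * (s + e)^-1 * (s / (s + e)).
    by rewrite /shrinker' expr2 invfM; ring.
  rewrite ler_norml /B; apply/andP; split; lra.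
Qed.

(** Put [th = s / (s + e)], [rho = mollify s] and [h = shrinker s].  Then
    [s h = rho th] and [s h' = rho' th - h th]; the terms in [rho'] are
    nonpositive, and the others are [h] times
    [- 2 m + 4 th + rho th (k - 1 - 2 m) + 4 rho th^2], which is at most
    [- 2 (m - 2) + rho (k - 2 m + 3)] because [0 <= th <= 1]. *)
Lemma shrinker_sign (m k : R) (s : R) : 0 <= s ->
  2 <= m -> -1 - 2 * m + k + 4 > 0 -> c <= 2 * (m - 2) / (k - 2 * m + 3) ->
  - 2 * m * shrinker s - 4 * shrinker' s * s
  + shrinker s ^+ 2 * s * (k - 1 - 2 * m)
  - 4 * shrinker s * shrinker' s * s ^+ 2 <= 0.
Proof.
move=> s0 m2 km cb.
have se0 : 0 < s + e by rewrite ltr_wpDl.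
have /andP[m0 mc] := mollify_bounds s0; have m'0 := mollify'_ge0 s.
have h0 : 0 <= shrinker s by rewrite divr_ge0// ltW.
pose th := s / (s + e).
have th0 : 0 <= th by rewrite divr_ge0// ltW.
have th1 : th <= 1 by rewrite ler_pdivrMr// mul1r lerDl ltW.
have h's : shrinker' s * s = mollify' s * th - shrinker s * th.
  by rewrite /shrinker' /shrinker /th expr2 invfM; ring.
have hs : shrinker s * s = mollify s * th by rewrite /shrinker /th; ring.
have -> : - 2 * m * shrinker s - 4 * shrinker' s * s
  + shrinker s ^+ 2 * s * (k - 1 - 2 * m) - 4 * shrinker s * shrinker' s * s ^+ 2
  = - 2 * m * shrinker s - 4 * (shrinker' s * s)
  + shrinker s * (shrinker s * s) * (k - 1 - 2 * m)
  - 4 * (shrinker s * s) * (shrinker' s * s) by ring.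
rewrite h's hs.
have t0 : 0 <= mollify s * th by rewrite mulr_ge0.
have t1 : mollify s * th <= c by rewrite -[leRHS]mulr1; apply: ler_pM.
have D0 : 0 < k - 2 * m + 3 by lra.
have cb' : c * (k - 2 * m + 3) <= 2 * (m - 2) by rewrite -ler_pdivlMr.
set a := shrinker s in h0 *; set b := mollify s in m0 mc t0 t1 *.
have bc : b * (k - 2 * m + 3) <= 2 * (m - 2).
  by rewrite (le_trans _ cb')// ler_wpM2r// ltW.
have q1 : 0 <= mollify' s * th by rewrite mulr_ge0.
have q2 : 0 <= (b * th) * (mollify' s * th) by rewrite mulr_ge0.
have q3 : a * (- 2 * m + 4 * th + (b * th) * (k - 1 - 2 * m) + 4 * (b * th) * th) <= 0.
  rewrite mulr_ge0_le0//.
  have q4 : (b * th) * th <= b * th by rewrite ler_piMr.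
  have q5 : b * th <= b by rewrite ler_piMr.
  have q6 : (b * th) * (k - 2 * m + 3) <= b * (k - 2 * m + 3) by rewrite ler_wpM2r// ltW.
  lra.
lra.
Qed.

End mollify.

(** * Measurability of the fields and a bound for bilinear forms *)

Section fields_measurable.
Context {R : realType} (n p : nat) (d : R) (d0 : 0 < d).
Variables (h h' : R -> R) (B : R) (sh : shrinkage h h' B).
Context e (T : measurableType e) (f : T -> 'M[R]_(n, p)) (g : T -> 'cV[R]_p).
Hypotheses (mf : measurable_fun setT f) (mg : measurable_fun setT g).

Lemma measurable_dot m (a b : T -> 'cV[R]_m) : measurable_fun setT a ->
  measurable_fun setT b -> measurable_fun setT (fun t => dot (a t) (b t)).
Proof.
move=> ma mb; apply: measurable_mx_entry; apply: measurable_mulmx => //.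
exact: measurable_trmx.
Qed.

Lemma measurable_energy : measurable_fun setT (fun t => energy d (f t) (g t)).
Proof. by apply: measurable_dot; exact: measurable_coefs. Qed.

Lemma measurable_shrink_energy : measurable_fun setT (fun t => h (energy d (f t) (g t))).
Proof. by apply: (measurable_shrinkage sh measurable_energy) => t; exact: dot_ge0. Qed.

Lemma measurable_shrink_energy' : measurable_fun setT (fun t => h' (energy d (f t) (g t))).
Proof. by apply: (measurable_shrinkage' sh measurable_energy) => t; exact: dot_ge0. Qed.

Lemma measurable_mean_field : measurable_fun setT (fun t => mean_field d h (f t) (g t)).
Proof.
apply: measurable_mulmx; first exact: measurable_trmx.
by apply: measurable_scalemx; [exact: measurable_shrink_energy|exact: measurable_coefs].
Qed.

Lemma measurable_mean_jacobian :
  measurable_fun setT (fun t => mean_jacobian d h h' (f t) (g t)).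
Proof.
have mK := measurable_resolvent d0 mf.
have mc := measurable_coefs d0 mf mg.
have mKf : measurable_fun setT (fun t => resolvent d (f t) *m f t) by exact: measurable_mulmx.
apply: measurable_mulmx; first exact: measurable_trmx.
apply: measurable_addmx; apply: measurable_scalemx => //.
- exact: measurable_shrink_energy.
- by apply: measurable_funM => //; exact: measurable_shrink_energy'.
- by apply: measurable_mulmx => //; apply: measurable_mulmx => //; exact: measurable_trmx.
Qed.

Lemma measurable_row_field a : measurable_fun setT (fun t => row_field d h (g t) a (f t)).
Proof.
apply: measurable_scalemx; last exact: measurable_fit.
apply: measurable_funM.
  by apply: measurable_mx_entry; exact: measurable_coefs.
by apply: measurable_funX; exact: measurable_shrink_energy.
Qed.

Lemma measurable_row_jacobian a :
  measurable_fun setT (fun t => row_jacobian d h h' (g t) a (f t)).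
Proof.
have mK := measurable_resolvent d0 mf; have mtf := measurable_trmx mf.
have mc := measurable_coefs d0 mf mg; have mw := measurable_fit d0 mf mg.
have ma : measurable_fun setT (fun t => coefs d (f t) (g t) a 0) by exact: measurable_mx_entry.
have mh := measurable_shrink_energy; have mh' := measurable_shrink_energy'.
have mh2 : measurable_fun setT (fun t => h (energy d (f t) (g t)) ^+ 2) by exact: measurable_funX.
have mr : measurable_fun setT (fun t => (g t - fit d (f t) (g t))^T).
  apply: measurable_trmx; apply: measurable_addmx => //.
  apply: measurable_to_mx => i j; under eq_fun do rewrite mxE.
  by apply: measurable_funN; exact: measurable_mx_entry.
have mN m q (F : T -> 'M[R]_(m, q)) : measurable_fun setT F -> measurable_fun setT (fun t => - F t).
  move=> mF; apply: measurable_to_mx => i j; under eq_fun do rewrite mxE.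
  by apply: measurable_funN; exact: measurable_mx_entry.
have mU : measurable_fun setT (fun t => coefs_jacobian d (g t) a (f t)).
  apply: measurable_addmx.
    apply: measurable_mulmx => //; apply: measurable_mulmx => //; exact: measurable_cst.
  by apply: mN; apply: measurable_scalemx => //; exact: measurable_mulmx.
rewrite /row_jacobian; under eq_fun do rewrite fit_jacobianE.
apply: measurable_addmx; last first.
  by apply: measurable_scalemx; [exact: measurable_funM|exact: measurable_mulmx].
apply: measurable_addmx; last first.
  apply: measurable_scalemx; last exact: measurable_cst.
  by apply: measurable_funM => //; exact: measurable_funX.
apply: measurable_addmx; apply: measurable_scalemx => //.
- apply: measurable_mulmx => //; apply: measurable_mulmx => //; exact: measurable_cst.
- apply: measurable_funM => //; apply: measurable_funM => //; exact: measurable_funM.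
- by apply: measurable_mulmx => //; apply: measurable_mulmx => //; exact: measurable_trmx.
Qed.

Lemma measurable_qform (S : 'M[R]_p) (b : T -> 'cV[R]_p) :
  measurable_fun setT b -> measurable_fun setT (fun t => qform S (b t)).
Proof.
move=> mb; apply: measurable_mx_entry; apply: measurable_mulmx => //.
by apply: measurable_mulmx; [exact: measurable_trmx|exact: measurable_cst].
Qed.

End fields_measurable.

Section bilinear_bound.
Context {R : realType} (p : nat) (S : 'M[R]_p).

Lemma normr_bilinear_le : exists2 s : R, 0 <= s & forall a b : 'cV[R]_p,
  `|(a^T *m S *m b) 0 0| <= s * (dot a a + dot b b).
Proof.
have [s1 Ss1] := normr_mx_bounded S; pose s0 := `|s1|.
have Ss0 i j : `|S i j| <= s0 by exact: le_trans (Ss1 i j) (ler_norm _).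
exists (p%:R * s0); first by rewrite mulr_ge0 ?normr_ge0.
move=> a b; have -> : (a^T *m S *m b) 0 0 = \sum_j \sum_i a i 0 * S i j * b j 0.
  rewrite mxE; apply: eq_bigr => j _; rewrite mxE mulr_suml; apply: eq_bigr => i _.
  by rewrite mxE.
have -> : p%:R * s0 * (dot a a + dot b b) =
    \sum_(j < p) \sum_(i < p) s0 * (a i 0 ^+ 2 + b j 0 ^+ 2).
  have sqE (v : 'cV[R]_p) : dot v v = \sum_i v i 0 ^+ 2.
    by rewrite dotE; apply: eq_bigr => i _; rewrite expr2.
  rewrite !sqE.
  under [RHS]eq_bigr do rewrite -mulr_sumr big_split/= sumr_const card_ord -mulr_natl.
  rewrite -mulr_sumr big_split/= sumr_const card_ord -[X in _ = _ * (X + _)]mulr_natl.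
  by rewrite -[X in _ = _ * (_ + X)]mulr_sumr; ring.
rewrite (le_trans (ler_norm_sum _ _ _))// ler_sum// => j _.
rewrite (le_trans (ler_norm_sum _ _ _))// ler_sum// => i _.
rewrite !normrM -mulrA mulrCA ler_pM ?mulr_ge0//.
rewrite -(real_normK (num_real (a i 0))) -(real_normK (num_real (b j 0))).
by have := sqr_ge0 (`|a i 0| - `|b j 0|); have := normr_ge0 (a i 0); have := normr_ge0 (b j 0); nra.
Qed.

End bilinear_bound.

(** * Risk of the ridge estimator *)

Section product.
Context {R : realType} d1 d2 (T1 : measurableType d1) (T2 : measurableType d2).
Variables (P1 : probability T1 R) (P2 : probability T2 R).

Lemma integrable_comp_fst (f : T1 -> \bar R) :
  P1.-integrable setT f -> (P1 \x P2)%E.-integrable setT (fun z : T1 * T2 => f z.1).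
Proof.
move=> fi; have mf : measurable_fun setT (fun z : T1 * T2 => f z.1).
  exact: (measurableT_comp (measurable_int _ fi) measurable_fst).
apply/integrable12ltyP => //.
have /integrableP[_] := fi; congr (_ < _)%E; apply: eq_integral => t _ /=.
by rewrite integral_cst//= [X in (_ * X)%E]probability_setT mule1.
Qed.

Lemma measurable_mxtrace d (T : measurableType d) q (f : T -> 'M[R]_q) :
  measurable_fun setT f -> measurable_fun setT (fun t => \tr (f t)).
Proof. by move=> mf; apply: measurable_sum => k; exact: measurable_mx_entry. Qed.

Lemma bounded_integrable d (T : measurableType d) (P : probability T R) (f : T -> R) C :
  measurable_fun setT f -> (forall t, `|f t| <= C) ->
  P.-integrable setT (EFin \o f).
Proof.
move=> mf fC; apply: (@le_integrable _ _ _ P _ _ _ (cst C%:E)) => //.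
- exact/measurable_EFinP.
- by move=> t _ /=; rewrite lee_fin (le_trans (fC t))// ler_norm.
- exact: finite_measure_integrable_cst.
Qed.

End product.

(** [X] and [Y] live on separate sample spaces, so that integrating by parts with
    [Y] fixed, then with [X] fixed, is Fubini's theorem on their product. *)
Section ridge_risk.
Context {R : realType} d1 d2 (T1 : measurableType d1) (T2 : measurableType d2).
Variables (P1 : probability T1 R) (P2 : probability T2 R) (n p : nat).
Variables (theta : 'cV[R]_p) (Sigma : 'M[R]_p).
Variables (X : T1 -> 'cV[R]_p) (Y : T2 -> 'M[R]_(n, p)).
Hypotheses (hX : normal_vector P1 theta Sigma X) (hY : normal_matrix P2 Sigma Y).
Hypothesis hS : posdefmx Sigma.
Let M := (P1 \x P2)%E.
Let Si := invmx Sigma.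

Let x (z : T1 * T2) := X z.1.
Let y (z : T1 * T2) := Y z.2.

Let mX : measurable_fun setT X. Proof. exact: normal_vector_measurable hX. Qed.
Let mY : measurable_fun setT Y. Proof. exact: normal_matrix_measurable hY. Qed.
Let mx : measurable_fun setT x. Proof. exact: (measurableT_comp mX). Qed.
Let my : measurable_fun setT y. Proof. exact: (measurableT_comp mY). Qed.

Lemma invmx_sym : Si^T = Si.
Proof. by rewrite /Si trmx_inv (proj1 hS). Qed.

Lemma qform_inv_ge0 (v : 'cV[R]_p) : 0 <= qform Si v.
Proof.
have [->|v0] := eqVneq v 0; first by rewrite /qform mulmx0 mxE.
have uS := posdefmx_unit hS.
have E : qform Si v = qform Sigma (Si *m v).
  rewrite /qform trmx_mul invmx_sym -!mulmxA (mulmxA Sigma) mulmxV// mul1mx.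
  done.
rewrite E ltW//; apply: (proj2 hS).
by apply: contraNneq v0 => Sv; rewrite -[v](mulKVmx uS) Sv mulmx0.
Qed.

Let gap (t : T1) := X t - theta.
Let mgap : measurable_fun setT gap.
Proof. by apply: measurable_addmx => //; exact: measurable_cst. Qed.

Lemma gap_integrable : P1.-integrable setT (fun t => (dot (gap t) (gap t))%:E).
Proof.
have -> : (fun t => (dot (gap t) (gap t))%:E) =
    fun t => (\sum_i ((X t i 0 + - theta i 0) ^+ 2)%:E)%E.
  apply/funext => t; rewrite sumEFin dotE; congr _%:E; apply: eq_bigr => i _.
  by rewrite !mxE expr2.
apply: integrable_sum => // i _.
exact: (square_integrableD (normal_vector_square_integrable hX i)
  (square_integrable_cst _ (- theta i 0))).2.
Qed.

Lemma position_integrable : P1.-integrable setT (fun t => (dot (X t) (X t))%:E).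
Proof.
have -> : (fun t => (dot (X t) (X t))%:E) = fun t => (\sum_i (X t i 0 ^+ 2)%:E)%E.
  apply/funext => t; rewrite sumEFin dotE; congr _%:E; exact: eq_bigr.
apply: integrable_sum => // i _.
exact: (normal_vector_square_integrable hX i).2.
Qed.

Definition loss0 (z : T1 * T2) : R := qform Si (gap z.1).

Let dominated (f : T1 * T2 -> R) (a b : R) : measurable_fun setT f ->
  0 <= a -> 0 <= b ->
  (forall z, `|f z| <= a * dot (gap z.1) (gap z.1) + b * dot (x z) (x z)) ->
  M.-integrable setT (EFin \o f).
Proof.
move=> mf a0 b0 fab.
have i1 := integrable_comp_fst P2 (integrableD measurableT
  (integrableZl measurableT a gap_integrable) (integrableZl measurableT b position_integrable)).
apply: le_integrable i1 => //; first exact/measurable_EFinP.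
move=> z _ /=; rewrite lee_fin (le_trans (fab z))//; exact: ler_norm.
Qed.

Lemma loss0_integrable : M.-integrable setT (EFin \o loss0).
Proof.
have [s s0 hs] := normr_bilinear_le Si.
apply: (dominated (a := 2 * s) (b := 0)) => //.
- by apply: measurable_qform; exact: (measurableT_comp mgap).
- exact: mulr_ge0.
- by move=> z; rewrite mul0r addr0; have := hs (gap z.1) (gap z.1); rewrite -/(qform _ _); lra.
Qed.

Section fixed_ridge.
Variables (d : R) (d0 : 0 < d).
Variables (h h' : R -> R) (B : R) (sh : shrinkage h h' B).

Definition ridge_estimate (z : T1 * T2) : 'cV[R]_p := mean_field d h (y z) (x z).

Definition ridge_loss z : R := qform Si (gap z.1 - ridge_estimate z).

Let cross z : R := ((gap z.1)^T *m Si *m ridge_estimate z) 0 0.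
Let quad z : R := qform Si (ridge_estimate z).

Definition mean_divergence z : R := \tr (mean_jacobian d h h' (y z) (x z)).
Definition row_divergence z : R := \sum_a \tr (row_jacobian d h h' (x z) a (y z)).

Let mest : measurable_fun setT ridge_estimate.
Proof. exact: (measurable_mean_field d0 sh my mx). Qed.

Lemma ridge_estimateE z : ridge_estimate z = h (energy d (y z) (x z)) *: fit d (y z) (x z).
Proof. by rewrite /ridge_estimate /mean_field -scalemxAr. Qed.

Lemma ridge_estimate_le z : dot (ridge_estimate z) (ridge_estimate z) <= B ^+ 2 * dot (x z) (x z).
Proof.
rewrite ridge_estimateE dotZl dotZr mulrA -expr2.
have F0 : 0 <= energy d (y z) (x z) by exact: dot_ge0.
have h0 := shrinkage_ge0 sh F0; have hB := shrinkage_le sh F0.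
apply: ler_pM; rewrite ?sqr_ge0 ?dot_ge0 ?fit_dot_le//.
by rewrite lerXn2r// nnegrE (le_trans h0).
Qed.

Lemma ridge_lossE z : ridge_loss z = loss0 z - 2 * cross z + quad z.
Proof.
rewrite /ridge_loss /loss0 /quad /cross.
move: (gap z.1) (ridge_estimate z) => a b.
have E : (b^T *m Si *m a) 0 0 = (a^T *m Si *m b) 0 0.
  have -> : b^T *m Si *m a = (a^T *m Si *m b)^T.
    by rewrite !trmx_mul trmxK invmx_sym mulmxA.
  by rewrite mxE.
have tB : (a - b)^T = a^T - b^T by rewrite linearB.
rewrite /qform tB !mulmxBl !mulmxBr.
have ent (N1 N2 N3 N4 : 'M[R]_1) : (N1 - N2 - (N3 - N4)) 0 0 =
    N1 0 0 - N2 0 0 - (N3 0 0 - N4 0 0) by rewrite !mxE.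
by rewrite ent E; ring.
Qed.

Lemma mean_divergenceE z : let F := energy d (y z) (x z) in
  mean_divergence z = h F * edf d (y z) + 2 * h' F * (F - energy_defect d (y z) (x z)).
Proof. exact: mean_jacobian_trace. Qed.

Lemma row_divergenceE z : let F := energy d (y z) (x z) in row_divergence z =
  h F ^+ 2 * (F * (p%:R + n%:R - 1 - 2 * edf d (y z)) + 2 * energy_defect d (y z) (x z))
  + 4 * h F * h' F * F * (2 * energy_defect d (y z) (x z) - F).
Proof. exact: row_jacobian_trace_sum. Qed.

Lemma cross_integrable : M.-integrable setT (EFin \o cross).
Proof.
have [s s0 hs] := normr_bilinear_le Si.
apply: (dominated (a := s) (b := s * B ^+ 2)) => //.
- apply: measurable_mx_entry; apply: measurable_mulmx => //.
  apply: measurable_mulmx; last exact: measurable_cst.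
  by apply: measurable_trmx; exact: (measurableT_comp mgap).
- by rewrite mulr_ge0 ?sqr_ge0.
- move=> z; rewrite (le_trans (hs _ _))// mulrDr lerD2l -mulrA ler_wpM2l//.
  exact: ridge_estimate_le.
Qed.

Lemma quad_integrable : M.-integrable setT (EFin \o quad).
Proof.
have [s s0 hs] := normr_bilinear_le Si.
apply: (dominated (a := 0) (b := 2 * s * B ^+ 2)) => //.
- exact: measurable_qform.
- by rewrite mulr_ge0 ?sqr_ge0// mulr_ge0.
- move=> z; rewrite mul0r add0r -!mulrA mulrCA (le_trans (hs _ _))// ler_wpM2l//.
  by have := ridge_estimate_le z; lra.
Qed.

Definition ridge_bound : R := 
  B * (3 * p%:R + n%:R + 1) + 2 * B + 4 * B ^+ 2 + 2 * (B * p%:R + 2 * B).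

(** The bounds on both divergences do not involve [d]: this is what allows [d] to
    vanish under the integral. *)
Lemma mean_divergence_le z : `|mean_divergence z| <= B * p%:R + 2 * B.
Proof.
rewrite mean_divergenceE; set F := energy _ _ _; set k := energy_defect _ _ _.
have F0 : 0 <= F by exact: dot_ge0.
have /andP[k0 kF] := energy_defect_bounds d0 (y z) (x z); rewrite -/k -/(energy _ _ _) -/F in k0 kF.
have h0 := shrinkage_ge0 sh F0; have hB := shrinkage_le sh F0.
have hF := shrinkage_mul_le' sh F0.
apply: (le_trans (ler_normD _ _)); apply: lerD.
  by rewrite normrM ger0_norm// ler_pM// edf_bounds.
rewrite -mulrA normrM ger0_norm// ler_pM2l// normrM (le_trans _ hF)//.
by rewrite ler_wpM2l// ger0_norm ?subr_ge0// gerBl.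
Qed.

Lemma row_divergence_le z :
  `|row_divergence z| <= B * (3 * p%:R + n%:R + 1) + 2 * B + 4 * B ^+ 2.
Proof.
rewrite row_divergenceE; set F := energy _ _ _; set k := energy_defect _ _ _; set t := edf _ _.
have F0 : 0 <= F by exact: dot_ge0.
have /andP[k0 kF] := energy_defect_bounds d0 (y z) (x z); rewrite -/k -/(energy _ _ _) -/F in k0 kF.
have h0 := shrinkage_ge0 sh F0; have hB := shrinkage_mul_le sh F0.
have h2F := shrinkage_sqr_le sh F0; have hF := shrinkage_mul_le' sh F0.
have tp : `|p%:R + n%:R - 1 - 2 * t| <= 3 * p%:R + n%:R + 1.
  have := edf_bounds d0 (y z); rewrite -/t => /ler_normlP[t1 t2].
  have p0 : 0 <= p%:R :> R by []. have n0 : 0 <= n%:R :> R by [].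
  by apply/ler_normlP; split; lra.
move: (p%:R + n%:R - 1 - 2 * t) tp => q tp.
have h20 : 0 <= h F ^+ 2 by exact: sqr_ge0.
apply: (le_trans (ler_normD _ _)); apply: lerD.
  rewrite mulrDr; apply: (le_trans (ler_normD _ _)); apply: lerD.
    by rewrite mulrA normrM ler_pM// ger0_norm// mulr_ge0.
  rewrite ger0_norm; last by rewrite mulr_ge0// mulr_ge0.
  by rewrite mulrCA ler_pM2l// (le_trans _ h2F)// ler_wpM2l.
have -> : 4 * h F * h' F * F * (2 * k - F) = 4 * ((h F * F) * (h' F * (2 * k - F))) by ring.
rewrite normrM ger0_norm// ler_pM2l// normrM expr2 ler_pM//.
  by rewrite ger0_norm// mulr_ge0.
rewrite normrM (le_trans _ hF)// ler_wpM2l//.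
by apply/ler_normlP; split; lra.
Qed.

Definition ridge_gain z : R := row_divergence z - 2 * mean_divergence z.

Lemma ridge_gain_le z : `|ridge_gain z| <= ridge_bound.
Proof.
apply: (le_trans (ler_normB _ _)); apply: lerD; first exact: row_divergence_le.
by rewrite normrM ger0_norm// ler_pM2l// mean_divergence_le.
Qed.

Lemma measurable_mean_divergence : measurable_fun setT mean_divergence.
Proof.
exact: (measurable_mxtrace (measurable_mean_jacobian d0 sh my mx)).
Qed.

Lemma measurable_row_divergence : measurable_fun setT row_divergence.
Proof.
apply: measurable_sum => a.
exact: (measurable_mxtrace (measurable_row_jacobian d0 sh my mx a)).
Qed.

Let mean_divergence_integrable : M.-integrable setT (EFin \o mean_divergence).
Proof. exact: bounded_integrable measurable_mean_divergence mean_divergence_le. Qed.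

Let row_divergence_integrable : M.-integrable setT (EFin \o row_divergence).
Proof. exact: bounded_integrable measurable_row_divergence row_divergence_le. Qed.

Lemma cross_mean : (\int[M]_z (cross z)%:E = \int[M]_z (mean_divergence z)%:E)%E.
Proof.
rewrite -(integral21_prod_meas1 cross_integrable).
rewrite -(integral21_prod_meas1 mean_divergence_integrable).
apply: eq_integral => t _; rewrite /cross /mean_divergence /=.
have [C GC] := mean_field_C1 d sh (Y t).
by apply: (stein_normal hX hS _ _ GC);
  [apply: (measurable_mean_field d0 sh) | apply: (measurable_mean_jacobian d0 sh)].
Qed.

Lemma quad_row z : quad z = \sum_a
  (row a (y z) *m Si *m row_field d h (x z) a (y z)) 0 0.
Proof.
rewrite /quad ridge_estimateE /row_field; set c := h _.
pose w := fit d (y z) (x z); rewrite -/w.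
have tZ : (c *: w)^T = c *: w^T by rewrite linearZ.
have -> : qform Si (c *: w) = c ^+ 2 * dot (coefs d (y z) (x z)) (y z *m (Si *m w)).
  rewrite /qform tZ -!scalemxAl -scalemxAr [LHS]mxE [X in c * X]mxE mulrA -expr2.
  by congr (_ * _); rewrite -mulmxA -/(dot w (Si *m w)) {1}/w dotMl trmxK.
rewrite dotE mulr_sumr; apply: eq_bigr => a _.
rewrite -scalemxAr [in RHS]mxE -mulmxA -row_mul [X in _ = _ * X]mxE.
by rewrite mulrA [_ ^+ 2 * _]mulrC.
Qed.

Lemma quad_mean : (\int[M]_z (quad z)%:E = \int[M]_z (row_divergence z)%:E)%E.
Proof.
rewrite -(integral12_prod_meas1 quad_integrable).
rewrite -(integral12_prod_meas1 row_divergence_integrable).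
apply: eq_integral => t _; rewrite /row_divergence /=.
transitivity (\int[P2]_s (\sum_a ((row a (Y s) *m Si *m row_field d h (X t) a (Y s)) 0 0)%:E))%E.
  by apply: eq_integral => s _; rewrite sumEFin; congr EFin; exact: (quad_row (t, s)).
transitivity (\int[P2]_s (\sum_a (\tr (row_jacobian d h h' (X t) a (Y s)))%:E))%E; last first.
  by apply: eq_integral => s _; rewrite sumEFin.
have mfield a : measurable_fun setT (fun Z : 'M[R]_(n, p) => row_field d h (X t) a Z).
  by apply: (measurable_row_field d0 sh).
have mjac a : measurable_fun setT (fun Z : 'M[R]_(n, p) => row_jacobian d h h' (X t) a Z).
  by apply: (measurable_row_jacobian d0 sh).
have bound (a : 'I_n) := row_field_C1 d0 sh (X t) a.
rewrite integral_sum//; last first.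
  move=> a; have [C [_ GC _]] := bound a.
  apply: (row_mul_integrable hY a (G := fun s => row_field d h (X t) a (Y s)) (C := C)).
    exact: (measurableT_comp (mfield a) mY).
  by move=> s; exact: GC.
rewrite integral_sum//; last first.
  move=> a; have [C [_ _ GC]] := bound a.
  apply: (@bounded_integrable _ _ _ _ _ (p%:R * C)).
    by apply: measurable_mxtrace; exact: (measurableT_comp (mjac a) mY).
  move=> s; rewrite (le_trans (ler_norm_sum _ _ _))//.
  rewrite (le_trans (ler_sum _ (fun i _ => GC (Y s) i i)))//.
  by rewrite sumr_const card_ord mulr_natl.
apply: eq_bigr => a _; have [C GC] := bound a.
exact: (stein_row hY hS (mfield a) (mjac a) GC).
Qed.

(** The cross and quadratic terms of the expanded loss are replaced by the
    divergences of their fields. *)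
Lemma ridge_loss_mean : (\int[M]_z (ridge_loss z)%:E =
  \int[M]_z (loss0 z)%:E + \int[M]_z (ridge_gain z)%:E)%E.
Proof.
transitivity (\int[M]_z ((loss0 z)%:E + - (2%:E * (cross z)%:E) + (quad z)%:E))%E.
  by apply: eq_integral => z _; rewrite ridge_lossE.
transitivity (\int[M]_z (loss0 z)%:E
   + (\int[M]_z ((row_divergence z)%:E - 2%:E * (mean_divergence z)%:E)))%E; last first.
  by congr (_ + _)%E; apply: eq_integral => z _; rewrite -EFinM -EFinB.
have i2 := integrableZl measurableT 2 cross_integrable.
have j2 := integrableZl measurableT 2 mean_divergence_integrable.
rewrite integralD//; last 2 first.
- by apply: integrableB => //; exact: loss0_integrable.
- exact: quad_integrable.
rewrite integralB//; last exact: loss0_integrable.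
rewrite integralB// !integralZl//; [|exact: cross_integrable].
by rewrite cross_mean quad_mean -addeA; congr (_ + _)%E; rewrite addeC.
Qed.

End fixed_ridge.

End ridge_risk.

(** * The limit of a vanishing penalty *)

Section limits_of_integrals.
Context {R : realType} d (T : measurableType d) (P : probability T R).

(** Fatou's lemma: an upper bound on the integrals passes to the limit without any
    domination of the losses. *)
Lemma integral_limit_le (f : nat -> T -> R) (g : T -> R) (b : nat -> \bar R) c :
  (forall k, measurable_fun setT (f k)) -> (forall k t, 0 <= f k t) ->
  (forall t, f k t @[k --> \oo] --> g t) ->
  (forall k, \int[P]_t (f k t)%:E <= b k)%E -> (b k @[k --> \oo] --> c) ->
  (\int[P]_t (g t)%:E <= c)%E.
Proof.
move=> mf f0 fg fb bc.
have -> : (\int[P]_t (g t)%:E = \int[P]_t limn_einf (fun k => (f k t)%:E))%E.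
  apply: eq_integral => t _.
  have : (f k t)%:E @[k --> \oo] --> (g t)%:E by apply: cvg_EFin; [exact: nearW|exact: fg].
  by move=> /cvg_limn_einf_sup[].
apply: (le_trans (fatou P measurableT (f := fun k t => (f k t)%:E) _ _)).
- by move=> k; exact/measurable_EFinP.
- by move=> k t _; rewrite lee_fin.
rewrite -(cvg_lim _ bc)// limn_einf_lim.
apply: lee_lim; [exact: is_cvg_einfs|by apply/cvg_ex; exists c|].
by near=> k; apply: le_trans (fb k); apply: ereal_inf_lbound; exists k => /=.
Unshelve. all: by end_near. Qed.

Lemma qform_cvg (U : Type) (G : set_system U) (FG : Filter G) p (A : 'M[R]_p)
    (f : U -> 'cV[R]_p) v :
  mx_cvg G f v -> qform A (f u) @[u --> G] --> qform A v.
Proof.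
move=> fv; apply: mx_cvgM; last exact: fv.
by apply: mx_cvgM; [exact: mx_cvg_tr|exact: mx_cvg_cst].
Qed.

End limits_of_integrals.

Section pinv_risk.
Context {R : realType} d1 d2 (T1 : measurableType d1) (T2 : measurableType d2).
Variables (P1 : probability T1 R) (P2 : probability T2 R) (n p : nat).
Variables (theta : 'cV[R]_p) (Sigma : 'M[R]_p).
Variables (X : T1 -> 'cV[R]_p) (Y : T2 -> 'M[R]_(n, p)).
Hypotheses (hX : normal_vector P1 theta Sigma X) (hY : normal_matrix P2 Sigma Y).
Hypothesis hS : posdefmx Sigma.
Let M := (P1 \x P2)%E.
Let Si := invmx Sigma.

Let x (z : T1 * T2) := X z.1.
Let y (z : T1 * T2) := Y z.2.
Let S z := (y z)^T *m y z.
Let F z := qform (mpinv (S z)) (x z).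

Let mX : measurable_fun setT X. Proof. exact: normal_vector_measurable hX. Qed.
Let mY : measurable_fun setT Y. Proof. exact: normal_matrix_measurable hY. Qed.
Let mx : measurable_fun setT x. Proof. exact: (measurableT_comp mX). Qed.
Let my : measurable_fun setT y. Proof. exact: (measurableT_comp mY). Qed.

Lemma gram_pinv_energy z : F z = dot ((mpinv (y z))^T *m x z) ((mpinv (y z))^T *m x z).
Proof. by rewrite /F /qform mpinv_gram /dot trmx_mul trmxK !mulmxA. Qed.

Let F0 z : 0 <= F z. Proof. by rewrite gram_pinv_energy dot_ge0. Qed.

Lemma measurable_pinv_energy : measurable_fun setT F.
Proof.
have mV : measurable_fun setT (fun z => (mpinv (y z))^T *m x z).
  by apply: measurable_mulmx => //; apply: measurable_trmx; exact: measurable_mpinv.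
rewrite (_ : F = fun z => dot ((mpinv (y z))^T *m x z) ((mpinv (y z))^T *m x z)).
  exact: (measurable_dot mV mV).
by apply/funext => z; rewrite gram_pinv_energy.
Qed.

Definition pinv_loss (h : R -> R) z : R :=
  qform Si (x z - theta - h (F z) *: (S z *m mpinv (S z) *m x z)).

Lemma full_rank_ae : {ae M, forall z, \rank (y z) = minn n p}.
Proof.
have [N [mN N0 sN]] := normal_matrix_full_rank hY hS.
exists (setT `*` N); split; first exact: measurableX.
  by rewrite /M product_measure1E// [X in (_ * X)%E]N0 mule0.
by move=> z nz; split=> //; exact: sN.
Qed.

Variables (h h' : R -> R) (B : R) (sh : shrinkage h h' B).

Let m : R := (minn n p)%:R.
Definition limit_gain s : R := - 2 * m * h s - 4 * h' s * s
  + h s ^+ 2 * s * (n%:R + p%:R - 1 - 2 * m) - 4 * h s * h' s * s ^+ 2.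

Hypothesis gain_le0 : forall s, 0 <= s -> limit_gain s <= 0.

Let d k : R := vanishing k.
Let d0 k : 0 < d k. Proof. exact: vanishing_gt0. Qed.

Let gain k z := ridge_gain X Y (d k) h h' z.

Let h_cvg z : h (energy (d k) (y z) (x z)) @[k --> \oo] --> h (F z).
Proof.
have cF : energy (d k) (y z) (x z) @[k --> \oo] --> F z by exact: energy_cvg.
have ch : {for F z, continuous h}.
  apply: differentiable_continuous; apply/derivable1_diffP.
  by have [] := shrinkage_derive sh (F0 z).
exact: (cvg_comp _ _ cF ch).
Qed.

Lemma gain_cvg z : \rank (y z) = minn n p -> gain k z @[k --> \oo] --> limit_gain (F z).
Proof.
move=> fr.
have cF : energy (d k) (y z) (x z) @[k --> \oo] --> F z by exact: energy_cvg.
have ck : energy_defect (d k) (y z) (x z) @[k --> \oo] --> (0 : R) by exact: energy_defect_cvg.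
have ct : edf (d k) (y z) @[k --> \oo] --> m by exact: edf_cvg.
have ch : h (energy (d k) (y z) (x z)) @[k --> \oo] --> h (F z) by exact: h_cvg.
have ch' : h' (energy (d k) (y z) (x z)) @[k --> \oo] --> h' (F z).
  exact: (cvg_comp _ _ cF (shrinkage_continuous' sh (F0 z))).
have E k : gain k z = let f := energy (d k) (y z) (x z) in
    h f ^+ 2 * (f * (p%:R + n%:R - 1 - 2 * edf (d k) (y z)) + 2 * energy_defect (d k) (y z) (x z))
    + 4 * h f * h' f * f * (2 * energy_defect (d k) (y z) (x z) - f)
    - 2 * (h f * edf (d k) (y z) + 2 * h' f * (f - energy_defect (d k) (y z) (x z))).
  by rewrite /gain /ridge_gain row_divergenceE// mean_divergenceE.
under eq_fun do rewrite E /=.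
have -> : limit_gain (F z) = h (F z) ^+ 2 * (F z * (p%:R + n%:R - 1 - 2 * m) + 2 * 0)
    + 4 * h (F z) * h' (F z) * F z * (2 * 0 - F z)
    - 2 * (h (F z) * m + 2 * h' (F z) * (F z - 0)).
  by rewrite /limit_gain; ring.
apply: cvgB; first apply: cvgD.
- apply: cvgM; first by apply: (cvgM ch ch).
  apply: cvgD; last by apply: cvgM => //; exact: cvg_cst.
  apply: cvgM => //; apply: cvgB; first exact: cvg_cst.
  by apply: cvgM => //; exact: cvg_cst.
- apply: cvgM; last by apply: cvgB => //; apply: cvgM => //; exact: cvg_cst.
  apply: cvgM => //; apply: cvgM => //; apply: cvgM => //; exact: cvg_cst.
- apply: cvgM; first exact: cvg_cst.
  apply: cvgD; first exact: cvgM.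
  apply: cvgM; last exact: cvgB.
  by apply: cvgM => //; exact: cvg_cst.
Qed.

Lemma loss_cvg z :
  ridge_loss theta Sigma X Y (d k) h z @[k --> \oo] --> pinv_loss h z.
Proof.
apply: qform_cvg; apply: mx_cvgB; first exact: mx_cvg_cst.
under eq_fun do rewrite ridge_estimateE.
by apply: mx_cvgZ; [exact: h_cvg|exact: fit_cvg].
Qed.

Lemma measurable_limit_gain : measurable_fun setT (fun z => limit_gain (F z)).
Proof.
have mF := measurable_pinv_energy.
have mh := measurable_shrinkage sh mF F0; have mh' := measurable_shrinkage' sh mF F0.
apply: measurable_funB; first apply: measurable_funD; first apply: measurable_funB.
- by apply: measurable_funM.
- by apply: measurable_funM => //; apply: measurable_funM.
- apply: measurable_funM => //; apply: measurable_funM => //.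
  exact: measurable_funX.
- apply: measurable_funM; last exact: measurable_funX.
  by apply: measurable_funM => //; apply: measurable_funM.
Qed.

Lemma gain_integral_cvg : (\int[M]_z (gain k z)%:E)%E @[k --> \oo] -->
  (\int[M]_z (limit_gain (F z))%:E)%E.
Proof.
have mgain k : measurable_fun setT (fun z => (gain k z)%:E).
  apply/measurable_EFinP; apply: measurable_funB.
    exact: (measurable_row_divergence hX hY (d0 k) sh).
  by apply: measurable_funM => //; exact: (measurable_mean_divergence hX hY (d0 k) sh).
have mlimit : measurable_fun setT (fun z => (limit_gain (F z))%:E).
  by apply/measurable_EFinP; exact: measurable_limit_gain.
have cv : {ae M, forall z, setT z -> (gain k z)%:E @[k --> \oo] --> (limit_gain (F z))%:E}.
  apply: filterS full_rank_ae => z fr _.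
  by apply: cvg_EFin; [exact: nearW|exact: gain_cvg].
have ibound : M.-integrable setT (cst (ridge_bound n p B)%:E).
  by apply: (@bounded_integrable _ _ _ _ _ `|ridge_bound n p B|).
have dom : {ae M, forall z, forall k, setT z -> (`|(gain k z)%:E| <= cst (ridge_bound n p B)%:E z)%E}.
  by apply: aeW => z k _; rewrite lee_fin; exact: ridge_gain_le.
by have [] := dominated_convergence measurableT mgain mlimit cv ibound dom.
Qed.

(** [integral_limit_le] for the losses, dominated convergence for the gains. *)
Lemma pinv_loss_le : (\int[M]_z (pinv_loss h z)%:E <= \int[M]_z (loss0 theta Sigma X z)%:E)%E.
Proof.
have L0 : (\int[M]_z (loss0 theta Sigma X z)%:E)%E \is a fin_num.
  exact: integrable_fin_num (loss0_integrable P2 hX).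
apply: (@le_trans _ _ (\int[M]_z (loss0 theta Sigma X z)%:E +
    \int[M]_z (limit_gain (F z))%:E)%E); last first.
  rewrite geeDl//.
  have -> : (\int[M]_z (limit_gain (F z))%:E = - \int[M]_z (- limit_gain (F z))%:E)%E.
    rewrite -integral_ge0N; last by move=> z _; rewrite lee_fin oppr_ge0 gain_le0.
    by apply: eq_integral => z _; rewrite -EFinN opprK.
  by rewrite oppe_le0; apply: integral_ge0 => z _; rewrite lee_fin oppr_ge0 gain_le0.
apply: (integral_limit_le (f := fun k => ridge_loss theta Sigma X Y (d k) h)
  (b := fun k => (\int[M]_z (loss0 theta Sigma X z)%:E + \int[M]_z (gain k z)%:E)%E)).
- move=> k; apply: measurable_qform; apply: measurable_addmx.
    by apply: measurable_addmx => //; exact: measurable_cst.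
  have mest := measurable_mean_field (d0 k) sh my mx.
  rewrite (_ : (fun _ => _) = fun z => (-1) *: ridge_estimate X Y (d k) h z).
    by apply: measurable_scalemx => //; exact: measurable_cst.
  by apply/funext => z; rewrite scaleN1r.
- by move=> k z; exact: qform_inv_ge0.
- exact: loss_cvg.
- by move=> k; rewrite (ridge_loss_mean hX hY hS (d0 k) sh).
- apply: cvgeD; [exact: fin_num_adde_defr|exact: cvg_cst|exact: gain_integral_cvg].
Qed.

End pinv_risk.

(** * The limit of a vanishing smoothing, and transfer of the risk *)

Section transfer.
Context {R : realType} d (T : measurableType d) (P : probability T R).
Context d' (T' : measurableType d') (P' : probability T' R).
Context d1 d2 (T1 : measurableType d1) (T2 : measurableType d2).
Variables (U : {RV P >-> T1}) (V : {RV P >-> T2}) (W : {RV P' >-> T2}).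
Hypothesis UV : independent_pair P U V.
Hypothesis VW : forall B, measurable B -> P (V @^-1` B) = P' (W @^-1` B).

(** Only the joint law of [(U, V)] matters: [V] may be replaced by a variable with
    the same law on another sample space, independence being built into the
    product. *)
Lemma ge0_integral_copy (f : T1 * T2 -> \bar R) :
  measurable_fun setT f -> (forall z, 0 <= f z)%E ->
  (\int[P]_t f (U t, V t) = \int[P \x P']_z f (U z.1, W z.2))%E.
Proof.
move=> mf f0; rewrite ge0_integral_pair// fubini_tonelli1//.
transitivity (\int[distribution P U]_u fubini_F (distribution P' W) f u)%E.
  apply: eq_integral => u _; apply: eq_measure_integral => B mB _.
  exact: VW.
have mF : measurable_fun setT (fubini_F (distribution P' W) f).
  exact: measurable_fun_fubini_tonelli_F.
have F0 u : (0 <= fubini_F (distribution P' W) f u)%E by exact: integral_ge0.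
rewrite ge0_integral_distribution//.
have mUW : measurable_fun setT (fun z : T * T' => (U z.1, W z.2)).
  by apply: measurable_fun_pair;
    [exact: (measurableT_comp (measurable_funPT U) measurable_fst)
    |exact: (measurableT_comp (measurable_funPT W) measurable_snd)].
rewrite fubini_tonelli1//; last exact: (measurableT_comp mf mUW).
apply: eq_integral => t _ /=; rewrite /fubini_F ge0_integral_distribution//.
exact: measurableT_comp.
Qed.

End transfer.

Section shrinker_limit.
Context {R : realType} (r : R -> R) (c : R).
Hypothesis cr : continuous r.
Hypothesis rc : forall x, 0 <= r x <= c.
Hypothesis r_nd : {homo r : x y / x <= y}.

Lemma shrinker_cvg (s : R) : 0 < s ->
  shrinker r (vanishing j) s @[j --> \oo] --> r s / s.
Proof.
move=> s0; have s_ge0 := ltW s0.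
have cve : s + vanishing j @[j --> \oo] --> s.
  by rewrite -[X in _ --> X]addr0; apply: cvgD; [exact: cvg_cst|exact: vanishing_cvg].
apply: cvgM; last by apply: cvgV => //; rewrite gt_eqF.
apply: (squeeze_cvgr (f := cst (r s)) (h := fun j => r (s + vanishing j))).
- by apply: nearW => j; exact: (mollify_between cr r_nd (vanishing_gt0 j)).
- exact: cvg_cst.
- exact: (cvg_comp _ r cve (@cr s)).
Qed.

End shrinker_limit.

Section shrunken_loss.
Context {R : realType} d1 d2 (T1 : measurableType d1) (T2 : measurableType d2).
Variables (P1 : probability T1 R) (P2 : probability T2 R) (n p : nat).
Variables (theta : 'cV[R]_p) (Sigma : 'M[R]_p).
Variables (X : T1 -> 'cV[R]_p) (Y : T2 -> 'M[R]_(n, p)).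
Hypotheses (hX : normal_vector P1 theta Sigma X) (hY : normal_matrix P2 Sigma Y).
Hypothesis hS : posdefmx Sigma.
Let M := (P1 \x P2)%E.
Let m : R := (minn n p)%:R.

Variables (r : R -> R) (c : R).
Hypothesis cr : continuous r.
Hypothesis rc : forall x, 0 <= r x <= c.
Hypothesis r_nd : {homo r : x y / x <= y}.
Hypothesis m2 : 2 <= m.
Hypothesis c_le : c <= 2 * (m - 2) / (n%:R + p%:R - 2 * m + 3).

Let F (z : T1 * T2) := qform (mpinv ((Y z.2)^T *m Y z.2)) (X z.1).
Let loss := pinv_loss theta Sigma X Y.

Let measurable_loss h : measurable_fun setT (fun z => h (F z)) ->
  measurable_fun setT (loss h).
Proof.
have mX : measurable_fun setT X by exact: normal_vector_measurable hX.
have mY : measurable_fun setT Y by exact: normal_matrix_measurable hY.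
have mx : measurable_fun setT (fun z : T1 * T2 => X z.1) by exact: (measurableT_comp mX).
have my : measurable_fun setT (fun z : T1 * T2 => Y z.2) by exact: (measurableT_comp mY).
have mS : measurable_fun setT (fun z : T1 * T2 => (Y z.2)^T *m Y z.2).
  by apply: measurable_mulmx => //; exact: measurable_trmx.
move=> mh; apply: measurable_qform; apply: measurable_addmx.
  by apply: measurable_addmx => //; exact: measurable_cst.
under eq_fun do rewrite -scaleN1r.
apply: measurable_scalemx; first exact: measurable_cst.
apply: measurable_scalemx => //; apply: measurable_mulmx => //.
by apply: measurable_mulmx => //; exact: measurable_mpinv.
Qed.

(** [pinv_loss_le] for the shrinkers with [e = vanishing j], then
    [integral_limit_le] with a constant bound. *)
Lemma shrunken_loss_le :
  (\int[M]_z (loss (fun s => (r s / s)%R) z)%:E <= \int[M]_z (loss0 theta Sigma X z)%:E)%E.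
Proof.
pose h j := shrinker r (vanishing j); pose h' j := shrinker' r (vanishing j).
have sh j : exists B, shrinkage (h j) (h' j) B.
  exact: (shrinker_shrinkage cr rc r_nd (vanishing_gt0 j)).
apply: (integral_limit_le (f := fun j => loss (h j)) (b := cst (\int[M]_z (loss0 theta Sigma X z)%:E)%E)).
- move=> j; have [B shB] := sh j; apply: measurable_loss.
  apply: (measurable_shrinkage shB); first exact: (measurable_pinv_energy hX hY).
  by move=> z; rewrite /F gram_pinv_energy dot_ge0.
- by move=> j z; exact: qform_inv_ge0.
- move=> z; apply: qform_cvg; apply: mx_cvgB; first exact: mx_cvg_cst.
  (* where x^T S^+ x = 0, the vector S S^+ x is 0 as well, and every h gives the
     estimate x *)
  have [Fz|Fz] := eqVneq (F z) 0.
    set w := _ *m X z.1.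
    have -> : w = 0.
      have V0 : (mpinv (Y z.2))^T *m X z.1 = 0 by apply: dot_eq0; rewrite -gram_pinv_energy.
      have [_ _ _ VY] := mpinvP (Y z.2).
      by rewrite /w gram_mpinv_gram -VY trmx_mul -mulmxA V0 mulmx0.
    under eq_fun do rewrite scaler0.
    by rewrite scaler0; exact: mx_cvg_cst.
  apply: mx_cvgZ; last exact: mx_cvg_cst.
  by apply: (shrinker_cvg cr r_nd); rewrite lt_def Fz/= gram_pinv_energy dot_ge0.
- move=> j; have [B shB] := sh j; apply: (pinv_loss_le hX hY hS shB) => s s0.
  apply: (shrinker_sign cr rc r_nd (vanishing_gt0 j)) => //.
  have nm : m <= n%:R by rewrite ler_nat geq_minl.
  have pm : m <= p%:R by rewrite ler_nat geq_minr.
  by lra.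
- exact: cvg_cst.
Qed.

End shrunken_loss.

(** * Domination *)

Section loss.
Context {R : realType} {p : nat} (theta : 'cV[R]_p) (Sigma : 'M[R]_p).
Hypothesis hS : posdefmx Sigma.

Lemma inv_loss_ge0 a : 0 <= inv_loss Sigma theta a.
Proof. exact: qform_inv_ge0. Qed.

Lemma measurable_inv_loss d (T : measurableType d) (f : T -> 'cV[R]_p) :
  measurable_fun setT f -> measurable_fun setT (fun t => inv_loss Sigma theta (f t)).
Proof.
by move=> mf; apply: measurable_qform; apply: measurable_addmx.
Qed.

Lemma delta_rE (r : R -> R) (x : 'cV[R]_p) (S : 'M[R]_p) :
  let F := qform (mpinv S) x in
  delta_r r x S = x - (r F / F) *: (S *m mpinv S *m x).
Proof. by rewrite /delta_r mulmxBl mul1mx -scalemxAl. Qed.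

Lemma measurable_delta_r (r : R -> R) : continuous r ->
  measurable_fun setT (fun z : 'cV[R]_p * 'M[R]_p => delta_r r z.1 z.2).
Proof.
move=> cr; under eq_fun do rewrite delta_rE -scaleN1r.
have mx : measurable_fun setT (fun z : 'cV[R]_p * 'M[R]_p => z.1) by exact: measurable_fst.
have mS : measurable_fun setT (fun z : 'cV[R]_p * 'M[R]_p => z.2) by exact: measurable_snd.
have mV : measurable_fun setT (fun z : 'cV[R]_p * 'M[R]_p => mpinv z.2).
  exact: measurable_mpinv.
have mF : measurable_fun setT (fun z : 'cV[R]_p * 'M[R]_p => qform (mpinv z.2) z.1).
  apply: measurable_mx_entry; apply: measurable_mulmx => //.
  by apply: measurable_mulmx => //; exact: measurable_trmx.
apply: measurable_addmx => //; apply: measurable_scalemx; first exact: measurable_cst.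
apply: measurable_scalemx; last by do 2! apply: measurable_mulmx => //.
apply: measurable_funM; last exact: measurable_inv.
exact: (measurableT_comp (continuous_measurable_fun cr) mF).
Qed.

End loss.

Theorem theorem1 (R : realType) (n p : nat) (hnp : (3 <= minn p n)%N)
    (r : R -> R) (r_diff : forall x : R, derivable r x 1)
    (r_bound : forall x, 0 <= r x <=
       2 * ((minn n p)%:R - 2) / (n%:R + p%:R - 2 * (minn n p)%:R + 3))
    (r_nondecr : {homo r : x y / x <= y})
    (r'_bounded : exists M : R, forall x, `|derive1 r x| <= M) :
  dominates (p := p) n (delta_r r) delta_0.
Proof.
move=> theta Sigma hS d T P X S hX [d' [T' [P' [Y [hY SY]]]]] XS.
have cr : continuous r.
  by move=> x; apply: differentiable_continuous; apply/derivable1_diffP.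
have mY : measurable_fun setT (fun t => (Y t)^T *m Y t).
  have mY := normal_matrix_measurable hY.
  by apply: measurable_mulmx => //; exact: measurable_trmx.
pose W := packRV P' mY.
have copy (delta : estimator) :
    measurable_fun setT (fun z : 'cV[R]_p * 'M[R]_p => delta z.1 z.2) ->
    risk P X S theta Sigma delta =
    (\int[P \x P']_z (inv_loss Sigma theta (delta (X z.1) ((Y z.2)^T *m Y z.2)))%:E)%E.
  move=> mdelta; rewrite /risk unlock.
  apply: (ge0_integral_copy (W := W) XS SY
    (f := fun z => (inv_loss Sigma theta (delta z.1 z.2))%:E)).
    by apply/measurable_EFinP; exact: measurable_inv_loss.
  by move=> z; rewrite lee_fin inv_loss_ge0.
rewrite !copy; [|exact: measurable_fst|exact: measurable_delta_r].
have L0 : (\int[P \x P']_z (loss0 theta Sigma X z)%:E)%E \is a fin_num.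
  exact: integrable_fin_num (loss0_integrable P' hX).
rewrite sube_le0//.
have m2 : 2 <= (minn n p)%:R :> R by rewrite (ler_nat _ 2) minnC ltnW.
apply: le_trans (shrunken_loss_le hX hY hS cr r_bound r_nondecr m2 (lexx _)).
rewrite le_eqVlt; apply/orP; left; apply/eqP; apply: eq_integral => z _.
by rewrite /inv_loss delta_rE addrAC.
Qed.
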